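(* Let $\lambda_j=(\lambda_1^{(j)},\lambda_2^{(j)})$, $j=1,\ldots,k$, be distinct points in $\triangle^2_0$ and let $z_1,\ldots,z_k\in\mathbb C$. There exists $\psi\in\mathscr H^\infty(\triangle^2_0)$ with $\|\psi\|_{\infty,\triangle^2_0}\le1$ such that $\psi(\lambda_j)=z_j$ for $j=1,\ldots,k$ if and only if there exists a pair of $k\times k$ positive semi-definite matrices $A_1=[a^{(1)}_{i,j}]$ and $A_2=[a^{(2)}_{i,j}]$ such that for $i,j=1,\ldots,k$, $$1-\overline z_iz_j=\Big(\overline{\lambda_2^{(i)}}\,\lambda_2^{(j)}-\overline{\lambda_1^{(i)}}\,\lambda_1^{(j)}\Big)a^{(1)}_{i,j}+\Big(1-\overline{\lambda_2^{(i)}}\,\lambda_2^{(j)}\Big)a^{(2)}_{i,j}.$$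
   Context: $\triangle^2_0=\{z\in\mathbb C^2:|z_1|<|z_2|<1\}$ is the Hartogs triangle, and $\mathscr H^\infty(\triangle^2_0)$ is the Banach algebra of bounded holomorphic functions on $\triangle^2_0$ with the sup norm $\|\cdot\|_{\infty,\triangle^2_0}$. *)

(* Defs.v *)
From HB Require Import structures.
From mathcomp Require Import all_boot all_order all_algebra.
From mathcomp Require Import all_classical all_reals all_analysis.
From mathcomp.real_closed Require Import complex.

Set Implicit Arguments.
Unset Strict Implicit.
Unset Printing Implicit Defensive.

Import Order.TTheory GRing.Theory Num.Theory.
Import numFieldNormedType.Exports.

Local Open Scope classical_set_scope.
Local Open Scope complex_scope.
Local Open Scope sesquilinear_scope.
Local Open Scope ring_scope.

(* The inequalities live in the partial order of [R[i]]; they are meaningful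
   because both sides are real. *)
Definition hartogs_triangle (R : realType) : set (R[i] * R[i]) :=
  [set z | `|z.1| < `|z.2| /\ `|z.2| < 1].

(* Complex (Frechet) differentiability at every point; this is holomorphy when
   [D] is open.  The regular module [R[i]^o] carries the norm topology, and
   [differentiable] is over the scalar field [R[i]], so the differential is
   [R[i]]-linear.  Only the germs of [f] at points of [D] matter: the values
   of [f] outside [D] are junk. *)
Definition holomorphic_on (R : realType) (D : set (R[i] * R[i]))
    (f : R[i] * R[i] -> R[i]) : Prop :=
  forall z : R[i]^o * R[i]^o, D z ->
    differentiable (f : R[i]^o * R[i]^o -> R[i]^o) z.

Definition Hinfty (R : realType) (D : set (R[i] * R[i])) :
    set (R[i] * R[i] -> R[i]) :=
  [set f | holomorphic_on D f /\ [bounded (f z : R[i]^o) | z in D]].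

(* [`|f z|] is an element of [R[i]] with zero imaginary part.  As [sup] is
   total, this is the sup norm only for [f] bounded on a nonempty [D]. *)
Definition sup_norm (R : realType) (D : set (R[i] * R[i]))
    (f : R[i] * R[i] -> R[i]) : R :=
  sup [set complex.Re `|f z| | z in D].

Definition psdmx (R : realType) (k : nat) (A : 'M[R[i]]_k) : Prop :=
  A \is hermsymmx /\ forall v : 'cV[R[i]]_k, 0 <= (v^t* *m A *m v) 0 0.

(* Main.v *)
(* The map [(z1, z2) |-> (z1 / z2, z2)] sends the triangle to the disc times the
   punctured disc, so the statement is Agler's Pick theorem for the bidisc.

   From matrices to a function: write [A1] and [A2] as Gram matrices.  The
   equation says that two families of vectors have the same Gram matrix, so a
   unitary [W] carries one to the other, and the transfer function of [W]
   interpolates and is bounded by 1.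

   From a function to matrices: the right-hand sides of the equation form a
   closed convex cone of hermitian matrices.  Let [E] be the difference between
   the left-hand side and its nearest point in the cone.  Minimality turns [- E]
   into a form [q] with [q (w_i v) <= q v] for [w = (lambda1 / lambda2, lambda2)];
   so [q] is positive semi-definite and multiplication by [w_1] and by [w_2] are
   commuting contractions for [q].  Ando's inequality gives [q (P(w) v) <= q v]
   for every polynomial [P] bounded by 1 on the torus.  As [psi] is a pointwise
   limit of such polynomials, [q z <= q 1], which forces [E = 0].

   Ando's inequality is proved with a finite dilation: powers of [T1 T2] applied
   to a vector give a block sequence indexed by [Z/N], on which [T1] and [T2] act,
   away from the last few blocks, as two commuting unitaries.

   The polynomials interpolate [psi], on a bidisc of radius [rho < 1], at [rho]
   times the [N]-th roots of unity.  Their error is controlled by Cauchy's formula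
   on a punctured disc: by Goursat's theorem in logarithmic coordinates, circular
   means of a holomorphic function do not depend on the radius. *)
From HB Require Import structures.
Require Import Defs.
From mathcomp Require Import all_boot all_order all_algebra.
From mathcomp Require Import cyclic separable cyclotomic.
From mathcomp Require Import all_classical all_reals all_analysis.
From mathcomp.real_closed Require Import complex.
From mathcomp Require Import ring lra.

Set Implicit Arguments.
Unset Strict Implicit.
Unset Printing Implicit Defensive.

Import Order.TTheory GRing.Theory Num.Theory.
Import numFieldNormedType.Exports.

Local Open Scope sesquilinear_scope.
Local Open Scope ring_scope.

(** * Unitary matrices and Gram factorizations *)

(** Everything stays finite-dimensional. A unitary dilation of two commuting contractions needs
    infinitely many blocks in general, but a polynomial of degree below [d] in each variable moves a
    block by fewer than [2 d] places, so the wrap-around of the cyclic shift spoils only the end of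
    the sequence. The price is an extra term with a power of [T1 T2], which dies because the points
    lie strictly inside the bidisc. The nearest point of the cone is found by minimizing over Gram
    factors: positivity is then no constraint, and the positive diagonals of the two coefficient
    matrices confine the factors to a box. In the coordinates [(u, v)] nothing is known of
    [psi (u v, v)] at [v = 0], and no extension there is built: boundedness alone makes the means
    used in Cauchy's formula vanish with the radius. Interpolation may enlarge a sup norm by a
    factor of order [N] in each variable, but the Taylor error decays geometrically in [N]; the
    interpolant is thus bounded by [1 + eta], and dividing by that restores the bound 1. *)

Section LinearAlgebra.
Variable C : numClosedFieldType.

Lemma trmxC_mul m n p (A : 'M[C]_(m, n)) (B : 'M[C]_(n, p)) :
  (A *m B)^t* = B^t* *m A^t*.
Proof. by rewrite trmx_mul map_mxM. Qed.

Lemma trmxCB m n (A B : 'M[C]_(m, n)) : (A - B)^t* = A^t* - B^t*.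
Proof. by rewrite linearB map_mxB. Qed.

Lemma trmxCD m n (A B : 'M[C]_(m, n)) : (A + B)^t* = A^t* + B^t*.
Proof. by rewrite linearD map_mxD. Qed.

Lemma trmxC1 n : (1%:M : 'M[C]_n)^t* = 1%:M.
Proof. by rewrite trmx1 map_mx1. Qed.

Lemma trmxC_row_mx m n1 n2 (A : 'M[C]_(m, n1)) (B : 'M[C]_(m, n2)) :
  (row_mx A B)^t* = col_mx (A^t* ) (B^t* ).
Proof. by rewrite tr_row_mx map_col_mx. Qed.

Lemma trmxC_col_mx m n1 n2 (A : 'M[C]_(n1, m)) (B : 'M[C]_(n2, m)) :
  (col_mx A B)^t* = row_mx (A^t* ) (B^t* ).
Proof. by rewrite tr_col_mx map_row_mx. Qed.

(** Vectors are rows, so operators act on the right and products compose from left to right. *)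
Definition sqn n (v : 'rV[C]_n) : C := (v *m v^t*) 0 0.

Lemma sqnE n (v : 'rV[C]_n) : sqn v = \sum_j `|v 0 j| ^+ 2.
Proof. by rewrite /sqn mxE; apply: eq_bigr => j _; rewrite !mxE normCK. Qed.

Lemma sqn_ge0 n (v : 'rV[C]_n) : 0 <= sqn v.
Proof. by rewrite sqnE sumr_ge0 // => j _; rewrite exprn_ge0. Qed.

Lemma sqn_eq0 n (v : 'rV[C]_n) : (sqn v == 0) = (v == 0).
Proof.
apply/eqP/eqP => [|->]; last by rewrite /sqn mul0mx mxE.
rewrite sqnE => /psumr_eq0P v0; apply/rowP => j; rewrite mxE.
have /v0 : forall j, true -> 0 <= `|v 0 j| ^+ 2 by move=> *; rewrite exprn_ge0.
by move=> /(_ j isT) /eqP; rewrite sqrf_eq0 normr_eq0 => /eqP.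
Qed.

Lemma sqn_unitary n (v : 'rV[C]_n) (U : 'M[C]_n) :
  U \is unitarymx -> sqn (v *m U) = sqn v.
Proof.
by move=> /unitarymxP UU; rewrite /sqn trmxC_mul mulmxA -[v *m U *m _]mulmxA UU mulmx1.
Qed.

(* For [x != y] the unitary is the complex reflection
   [v |-> v - (v d^* ) / (x d^* ) d] with [d = x - y]. *)
Lemma unitary_reflection n (x y : 'rV[C]_n) : x *m x^t* = y *m y^t* ->
  exists2 U : 'M[C]_n, U \is unitarymx & x *m U = y /\
    forall p (Z : 'M[C]_(p, n)), Z *m (x - y)^t* = 0 -> Z *m U = Z.
Proof.
move=> xxyy; set d := x - y.
have [d0|dn0] := eqVneq d 0.
  exists 1%:M; first by apply/unitarymxP; rewrite trmxC1 mulmx1.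
  split=> [|p Z _]; rewrite mulmx1 //.
  by apply/eqP; rewrite -subr_eq0 -/d d0.
pose s := (x *m d^t*) 0 0.
have sJ : s^* = (d *m x^t*) 0 0.
  by rewrite -[d in RHS]trmxCK -trmxC_mul [RHS]mxE; congr (_^* ); rewrite [RHS]mxE.
have sE : s + s^* = sqn d.
  rewrite sJ /sqn; suff <- : x *m d^t* + d *m x^t* = d *m d^t* by rewrite [RHS]mxE.
  rewrite /d trmxCB !mulmxBr !mulmxBl xxyy.
  by rewrite opprB addrC.
have sn0 : s != 0.
  apply/eqP => s0; move: sE; rewrite s0 conjC0 addr0 => /esym/eqP.
  by rewrite sqn_eq0 (negPf dn0).
pose U := 1%:M - s^-1 *: (d^t* *m d).
have dd : d *m d^t* = (sqn d)%:M by rewrite [LHS]mx11_scalar.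
have UJ : U^t* = 1%:M - (s^*)^-1 *: (d^t* *m d).
  by rewrite /U trmxCB trmxC1 linearZ map_mxZ trmxC_mul trmxCK /= fmorphV.
exists U; [apply/unitarymxP|split=> [|p Z Zd]].
- rewrite UJ /U mulmxBr mulmx1 mulmxBl mul1mx -scalemxAr -scalemxAl.
  rewrite mulmxA -(mulmxA (d^t*)) dd mul_mx_scalar -scalemxAl !scalerA.
  rewrite -!addrA -!opprD -[RHS]subr0; congr (_ - _).
  rewrite -scalerBl -scalerDl -sE.
  have -> : s^-1 + ((s^* )^-1 - (s^* )^-1 * s^-1 * (s + s^* )) = 0.
    by field; rewrite sn0 conjC_eq0.
  by rewrite scale0r.
- rewrite mulmxBr mulmx1 -scalemxAr mulmxA [x *m d^t*]mx11_scalar -/s.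
  by rewrite mul_scalar_mx scalerA mulVf // scale1r /d opprB addrC subrK.
- by rewrite mulmxBr mulmx1 -scalemxAr mulmxA Zd mul0mx scaler0 subr0.
Qed.

(** Induction on the rows: [U0] aligns the lower rows, then a reflection moves the image of the
    first row onto [y]. Equality of the Gram matrices makes [Y'] orthogonal to [x U0 - y], so the
    reflection leaves the aligned rows in place. *)
Lemma unitary_intertwining k n (X Y : 'M[C]_(k, n)) : X *m X^t* = Y *m Y^t* ->
  exists2 U : 'M[C]_n, U \is unitarymx & X *m U = Y.
Proof.
elim: k X Y => [|k IH] X Y.
  move=> _; exists 1%:M; first by apply/unitarymxP; rewrite trmxC1 mulmx1.
  by rewrite [LHS]flatmx0 [RHS]flatmx0.
rewrite -[k.+1]/(1 + k)%N in X Y *.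
rewrite -[X]vsubmxK -[Y]vsubmxK.
move: (usubmx X) (dsubmx X) (usubmx Y) (dsubmx Y) => x X' y Y' {X Y}.
rewrite !trmxC_col_mx !mul_col_row => /eq_block_mx [xx _ Xx XX].
have [U0 U0u X'U0] := IH _ _ XX.
have [|U1 U1u [xU1 fixU1]] := @unitary_reflection n (x *m U0) y.
  by rewrite trmxC_mul mulmxA mulmxtVK.
exists (U0 *m U1); first exact: mul_unitarymx.
rewrite mul_col_mx !mulmxA xU1 X'U0 fixU1 //.
rewrite trmxCB mulmxBr -{1}X'U0 trmxC_mul mulmxA mulmxtVK //.
by rewrite Xx subrr.
Qed.

(** The square root is taken in the spectral basis; the form at row [j] of [P] is the eigenvalue
    [D 0 j], hence nonnegative. *)
Lemma herm_psd_factor n (A : 'M[C]_n) : A \is hermsymmx ->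
  (forall v : 'rV[C]_n, 0 <= (v *m A *m v^t*) 0 0) ->
  exists G : 'M[C]_n, A = G *m G^t*.
Proof.
move=> Ah Apsd; have /hermitian_normalmx/orthomx_spectralP := Ah.
set P := spectralmx A; set D := spectral_diag A => AE.
have Pu : P \is unitarymx := spectral_unitarymx A.
rewrite invmx_unitary // in AE.
have D_ge0 j : 0 <= D 0 j.
  have := Apsd ('e_j *m P).
  rewrite {1}AE trmxC_mul !mulmxA mulmxtVK // mulmxtVK // -rowE row_diag_mx.
  by rewrite -scalemxAl mxE trmx_delta map_delta_mx mul_delta_mx mxE !eqxx mulr1.
exists (P^t* *m diag_mx (map_mx sqrtC D)).
rewrite trmxC_mul trmxCK tr_diag_mx map_diag_mx mulmxA.
rewrite {1}AE -[P^t* *m _ *m diag_mx _]mulmxA mulmx_diag; congr (_ *m diag_mx _ *m _).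
apply/rowP => j; rewrite !mxE /= geC0_conj ?sqrtC_ge0 //.
by rewrite -expr2 sqrtCK.
Qed.

End LinearAlgebra.

(** * Ando's inequality for commuting contraction matrices *)

Section VonNeumann.
Variable C : numClosedFieldType.

Definition bieval (c : nat -> nat -> C) d (x y : C) : C :=
  \sum_(a < d) \sum_(b < d) c a b * (x ^+ a * y ^+ b).

Definition mxbieval n (c : nat -> nat -> C) d (A B : 'M[C]_n) : 'M[C]_n :=
  \sum_(a < d) \sum_(b < d) c a b *: (A ^+ a *m B ^+ b).

Lemma conj_expmx n (P Q A : 'M[C]_n) a : P *m Q = 1%:M -> Q *m P = 1%:M ->
  (Q *m A *m P) ^+ a = Q *m A ^+ a *m P.
Proof.
move=> PQ QP; elim: a => [|a IH]; first by rewrite !expr0 mulmx1.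
rewrite !exprS IH -!mulmxE !mulmxA; congr (_ *m _ *m _).
by rewrite -[_ *m P *m Q]mulmxA PQ mulmx1.
Qed.

Lemma mxbieval_conj n c d (P Q A B : 'M[C]_n) : P *m Q = 1%:M -> Q *m P = 1%:M ->
  mxbieval c d (Q *m A *m P) (Q *m B *m P) = Q *m mxbieval c d A B *m P.
Proof.
move=> PQ QP; rewrite /mxbieval mulmx_sumr mulmx_suml; apply: eq_bigr => a _.
rewrite mulmx_sumr mulmx_suml; apply: eq_bigr => b _.
rewrite !conj_expmx // -scalemxAr -scalemxAl; congr (_ *: _).
by rewrite !mulmxA; congr (_ *m _ *m _); rewrite -[_ *m P *m Q]mulmxA PQ mulmx1.
Qed.

Lemma expmx_diag n (d : 'rV[C]_n) a : diag_mx d ^+ a = diag_mx (map_mx (fun x => x ^+ a) d).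
Proof.
elim: a => [|a IH].
  apply/matrixP => i j; rewrite !mxE; case: eqP => [->|_]; last by rewrite mulr0n.
  by rewrite expr0.
rewrite exprS IH -mulmxE mulmx_diag; congr diag_mx; apply/rowP => j.
by rewrite !mxE exprS.
Qed.

Lemma mxbieval_diag n c d (x y : 'rV[C]_n) :
  mxbieval c d (diag_mx x) (diag_mx y) = diag_mx (\row_j bieval c d (x 0 j) (y 0 j)).
Proof.
rewrite /mxbieval; apply/matrixP => i j; rewrite summxE !mxE /bieval -sumrMnl.
apply: eq_bigr => a _; rewrite summxE -sumrMnl; apply: eq_bigr => b _.
by rewrite !expmx_diag mulmx_diag !mxE mulrnAr.
Qed.

Lemma commuting_unitary_bound n c d (A B : 'M[C]_n) (v : 'rV[C]_n) :
  A \is unitarymx -> B \is unitarymx -> A *m B = B *m A ->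
  (forall x y, `|x| = 1 -> `|y| = 1 -> `|bieval c d x y| <= 1) ->
  sqn (v *m mxbieval c d A B) <= sqn v.
Proof.
move=> Au Bu AB c_le1.
have AA : A *m A^t* = 1%:M by apply/unitarymxP.
have AA' : A^t* *m A = 1%:M by apply: mulmx1C.
have BB : B *m B^t* = 1%:M by apply/unitarymxP.
have BB' : B^t* *m B = 1%:M by apply: mulmx1C.
have BA' : B *m A^t* = A^t* *m B.
  by rewrite -[LHS]mul1mx -AA' mulmxA -(mulmxA (A^t*)) AB mulmxA mulmxtVK.
have AB' : A *m B^t* = B^t* *m A.
  by rewrite -[LHS]mul1mx -BB' mulmxA -(mulmxA (B^t*)) -AB mulmxA mulmxtVK.
have A'B' : A^t* *m B^t* = B^t* *m A^t* by rewrite -!trmxC_mul AB.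
(* With the adjoints in the commuting family, simultaneous triangular form is diagonal form, and
   unitarity makes the diagonal entries unimodular. *)
have [|P Pu /allP trigP] := @cotrigonalization C n [:: A; A^t*; B; B^t*].
  by move=> X Y /[!inE] /or4P[] /eqP-> /or4P[] /eqP->; rewrite /comm_mx // ?AA ?AA' ?BB ?BB'.
have PP : P *m P^t* = 1%:M by apply/unitarymxP.
have PP' : P^t* *m P = 1%:M by apply: mulmx1C.
have diagP X : X \is unitarymx -> is_trig_mx (conjmx P X) -> is_trig_mx (conjmx P (X^t*)) ->
    exists2 x : 'rV[C]_n, X = P^t* *m diag_mx x *m P & forall j, `|x 0 j| = 1.
  move=> Xu; rewrite !conjymx // => /is_trig_mxP Xl /is_trig_mxP Xr.
  pose Y := P *m X *m P^t*.
  have Yd : Y = diag_mx (\row_j Y j j).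
    apply/matrixP => i j; rewrite [RHS]mxE [(\row__ _) _ _]mxE; case: (ltngtP i j) => [ij|ij|/val_inj ->].
    - by rewrite /Y Xl // -val_eqE /= (ltn_eqF ij).
    - rewrite -val_eqE /= (gtn_eqF ij) mulr0n.
      have := Xr j i ij; rewrite -{1}[P]trmxCK -mulmxA -!trmxC_mul.
      by rewrite mxE [in X in X -> _]mxE => /eqP; rewrite conjC_eq0 => /eqP.
    - by rewrite eqxx.
  exists (\row_j Y j j).
    by rewrite -Yd /Y !mulmxA PP' mul1mx -mulmxA PP' mulmx1.
  move=> j; apply/eqP; rewrite -sqrp_eq1 // normCK; apply/eqP.
  have : Y *m Y^t* = 1%:M.
    by apply/unitarymxP; rewrite !mul_unitarymx ?trmxC_unitary.
  rewrite Yd tr_diag_mx map_diag_mx mulmx_diag => /matrixP /(_ j j).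
  by rewrite !mxE eqxx !mulr1n.
have [x -> x1] : exists2 x : 'rV[C]_n, A = P^t* *m diag_mx x *m P & forall j, `|x 0 j| = 1.
  by apply: diagP => //; apply: trigP; rewrite !inE eqxx ?orbT.
have [y -> y1] : exists2 x : 'rV[C]_n, B = P^t* *m diag_mx x *m P & forall j, `|x 0 j| = 1.
  by apply: diagP => //; apply: trigP; rewrite !inE eqxx ?orbT.
rewrite mxbieval_conj // mxbieval_diag !mulmxA sqn_unitary //.
rewrite -[leRHS](@sqn_unitary _ _ v (P^t*)) ?trmxC_unitary //.
rewrite !sqnE; apply: ler_sum => j _.
by rewrite mul_mx_diag !mxE normrM exprMn ler_piMr ?exprn_ge0 // expr_le1 // c_le1.
Qed.

Lemma dot_mxvec N m (X Y : 'M[C]_(N, m)) :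
  (mxvec X *m (mxvec Y)^t*) 0 0 = \tr (X *m Y^t*).
Proof.
rewrite mxE (reindex _ (curry_mxvec_bij _ _)) /= /mxtrace.
rewrite [RHS](eq_bigr (fun i => \sum_j X i j * (Y i j)^*)); last first.
  by move=> i _; rewrite mxE; apply: eq_bigr => j _; rewrite !mxE.
rewrite pair_bigA /=; apply: eq_bigr => -[i j] _ /=.
by rewrite !mxE !mxvecE.
Qed.

Lemma sqn_mxvec N m (X : 'M[C]_(N, m)) : sqn (mxvec X) = \sum_i sqn (row i X).
Proof.
rewrite /sqn dot_mxvec; apply: eq_bigr => i _; rewrite !mxE.
by apply: eq_bigr => j _; rewrite !mxE.
Qed.

(** * Block operators over a cyclic shift *)

Section BlockShift.
Variables (N m : nat).

Definition cshift : 'M[C]_N := \matrix_(i, j) (j == ordS i)%:R.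

Lemma row_cshift p (X : 'M[C]_(N, p)) i : row i (cshift *m X) = row (ordS i) X.
Proof.
apply/rowP => j; rewrite !mxE (bigD1 (ordS i)) //= mxE eqxx mul1r big1 ?addr0 //.
by move=> k ki; rewrite mxE (negPf ki) mul0r.
Qed.

Lemma cshift_unitary : cshift \is unitarymx.
Proof.
apply/unitarymxP/row_matrixP => i; rewrite row_cshift; apply/rowP => j.
by rewrite !mxE conjC_nat eq_sym (can_eq (@ordSK _)) eq_sym.
Qed.

(** Multiplication by the symbol [a + z b], where [z] acts as the cyclic shift of the [N] blocks,
    the rows of [X]. *)
Definition bshift (a b : 'M[C]_m) (X : 'M[C]_(N, m)) := X *m a + cshift *m X *m b.

Lemma bshift_is_linear a b : linear (bshift a b).
Proof.
move=> k X Y; rewrite /bshift mulmxDl mulmxDr mulmxDl -!scalemxAl -scalemxAr -scalemxAl.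
by rewrite scalerDr addrACA.
Qed.

HB.instance Definition _ a b :=
  GRing.isLinear.Build C 'M[C]_(N, m) 'M[C]_(N, m) *:%R (bshift a b) (bshift_is_linear a b).

Definition bshiftmx a b := lin_mx (bshift a b).

(** The hypotheses say that [a + z b] is unitary for every [|z| = 1], coefficient by coefficient.
    The proof checks that the trace inner product of matrices is preserved. *)
Lemma bshiftmx_unitary a b : a *m a^t* + b *m b^t* = 1%:M -> a *m b^t* = 0 ->
  bshiftmx a b \is unitarymx.
Proof.
move=> ab1 ab0; have ba0 : b *m a^t* = 0.
  by rewrite -[LHS]trmxCK trmxC_mul trmxCK ab0 trmx0 map_mx0.
have SS : cshift^t* *m cshift = 1%:M.
  by apply/mulmx1C/unitarymxP/cshift_unitary.
have iso (X Y : 'M[C]_(N, m)) :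
    \tr (bshift a b X *m (bshift a b Y)^t*) = \tr (X *m Y^t*).
  rewrite /bshift trmxCD !mulmxDl !mulmxDr !trmxC_mul !mulmxA.
  rewrite -[X *m a *m (b^t*)]mulmxA ab0 mulmx0 !mul0mx addr0.
  rewrite -[cshift *m X *m b *m (a^t*)]mulmxA ba0 mulmx0 mul0mx add0r.
  rewrite mxtraceD [X in _ + X]mxtrace_mulC -!mulmxA [cshift^t* *m _]mulmxA SS mul1mx.
  by rewrite -mxtraceD -mulmxDr !mulmxA -mulmxDl ab1 mul1mx.
apply/unitarymxP/matrixP => i j.
have -> : (bshiftmx a b *m (bshiftmx a b)^t*) i j =
   ((delta_mx 0 i : 'rV_ _) *m bshiftmx a b *m ((delta_mx 0 j : 'rV_ _) *m bshiftmx a b)^t*) 0 0.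
  rewrite trmxC_mul trmx_delta map_delta_mx mulmxA -colE -mulmxA -rowE.
  by rewrite [RHS]mxE [RHS]mxE.
rewrite -[delta_mx 0 i]vec_mxK -[delta_mx 0 j]vec_mxK !mul_vec_lin dot_mxvec iso.
rewrite -dot_mxvec !vec_mxK trmx_delta map_delta_mx mul_delta_mx_cond.
by rewrite mulmxnE !mxE; case: (i == j).
Qed.

(** The hypotheses compare the coefficients of [1], [z^2] and [z] in the two products of symbols. *)
Lemma bshiftmx_comm a1 b1 a2 b2 :
  a1 *m a2 = a2 *m a1 -> b1 *m b2 = b2 *m b1 ->
  b1 *m a2 + a1 *m b2 = b2 *m a1 + a2 *m b1 ->
  bshiftmx a1 b1 *m bshiftmx a2 b2 = bshiftmx a2 b2 *m bshiftmx a1 b1.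
Proof.
move=> aa bb ab; apply/row_matrixP => i; rewrite !rowE !mulmxA.
rewrite -[delta_mx 0 i]vec_mxK !mul_vec_lin; congr mxvec.
move: (vec_mx _) => X; rewrite /= /bshift.
rewrite !mulmxDl !mulmxDr !mulmxDl -!mulmxA aa bb !addrA; congr (_ + _).
by rewrite -!addrA; congr (_ + _); rewrite -!mulmxDr ab.
Qed.

End BlockShift.

Section Ando.
Variables (k : nat) (T1 T2 : 'M[C]_k).
Hypothesis T12 : T1 *m T2 = T2 *m T1.
Hypothesis T1_le1 : forall v : 'rV[C]_k, sqn (v *m T1) <= sqn v.
Hypothesis T2_le1 : forall v : 'rV[C]_k, sqn (v *m T2) <= sqn v.

Lemma defect_factor (T : 'M[C]_k) : (forall v : 'rV[C]_k, sqn (v *m T) <= sqn v) ->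
  exists D : 'M[C]_k, D *m D^t* = 1%:M - T *m T^t*.
Proof.
move=> T_le1; have [||D DE] := @herm_psd_factor C k (1%:M - T *m T^t*).
- by apply/is_hermitianmxP; rewrite expr0 scale1r trmxCB trmxC1 trmxC_mul trmxCK.
- move=> v; rewrite mulmxBr mulmx1 mulmxBl mulmxA -[_ *m T^t* *m _]mulmxA -trmxC_mul.
  by rewrite mxE [X in _ + X]mxE subr_ge0 T_le1.
- by exists D.
Qed.

Local Notation T := (T1 *m T2).

(* [a1 + z b1] and [a2 + z b2] are the Berger-Coburn-Lebow pair of commuting
   unitaries (for [|z| = 1]) with product [z]. *)
Lemma ando_pair : exists (E : 'M[C]_(k, k + k)) (a1 b1 a2 b2 : 'M[C]_(k + k)),
  [/\ E *m E^t* = 1%:M - T *m T^t*,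
      T1 *m E = E *m a1 + T *m E *m b1 /\ T2 *m E = E *m a2 + T *m E *m b2,
      (a1 *m a1^t* + b1 *m b1^t* = 1%:M /\ a1 *m b1^t* = 0),
      (a2 *m a2^t* + b2 *m b2^t* = 1%:M /\ a2 *m b2^t* = 0) &
      [/\ a1 *m a2 = a2 *m a1, b1 *m b2 = b2 *m b1
        & b1 *m a2 + a1 *m b2 = b2 *m a1 + a2 *m b1]].
Proof.
have [D1 D1E] := defect_factor T1_le1; have [D2 D2E] := defect_factor T2_le1.
(* The defect [1 - T T^*] telescopes through [T2] or through [T1], as
   [T2 (1 - T1 T1^* ) T2^* + (1 - T2 T2^* )] or with the indices exchanged. [E] and [F] factor the
   two sums, so a unitary carries one to the other. *)
pose E := row_mx (T2 *m D1) D2; pose F := row_mx D1 (T1 *m D2).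
have EE : E *m E^t* = 1%:M - T *m T^t*.
  rewrite /E trmxC_row_mx mul_row_col (trmxC_mul T2 D1) mulmxA -[_ *m D1 *m _]mulmxA D1E D2E.
  rewrite mulmxBr mulmx1 mulmxBl [LHS]addrC addrA subrK.
  by rewrite T12 trmxC_mul !mulmxA.
have FF : F *m F^t* = 1%:M - T *m T^t*.
  rewrite /F trmxC_row_mx mul_row_col (trmxC_mul T1 D2) mulmxA -[_ *m D2 *m _]mulmxA D2E D1E.
  rewrite mulmxBr mulmx1 mulmxBl addrA subrK.
  by rewrite trmxC_mul !mulmxA.
have [U Uu EU] : exists2 U : 'M[C]_(k + k), U \is unitarymx & E *m U = F.
  by apply: unitary_intertwining; rewrite EE FF.
have UU : U *m U^t* = 1%:M by apply/unitarymxP.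
have UU' : U^t* *m U = 1%:M by apply: mulmx1C.
have FU : F *m U^t* = E by rewrite -EU mulmxtVK.
pose P : 'M[C]_(k + k) := block_mx 1%:M 0 0 0.
pose Q : 'M[C]_(k + k) := block_mx 0 0 0 1%:M.
have PQ1 : P + Q = 1%:M by rewrite add_block_mx !addr0 !add0r -scalar_mx_block.
have PQ : P *m Q = 0.
  by rewrite mulmx_block !mulmx0 !mul0mx !addr0; exact: block_mx0.
have QP : Q *m P = 0.
  by rewrite mulmx_block !mulmx0 !mul0mx !addr0; exact: block_mx0.
have PP : P *m P = P by rewrite -[RHS]mulmx1 -PQ1 mulmxDr PQ addr0.
have QQ : Q *m Q = Q by rewrite -[RHS]mulmx1 -PQ1 mulmxDr QP add0r.
have PJ : P^t* = P.
  by rewrite /P tr_block_mx map_block_mx !trmx0 !map_mx0 trmxC1.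
have QJ : Q^t* = Q.
  by rewrite /Q tr_block_mx map_block_mx !trmx0 !map_mx0 trmxC1.
(* On the half selected by [P], [E] is [T2 F]; on the half selected by [Q], [F] is [T1 E]. Together
   with [E U = F] this gives both intertwining relations. *)
have EP : E *m P = T2 *m F *m P.
  rewrite /E /F -mulmxA /P !mul_row_block !mulmx0 !mulmx1 !addr0 mul_mx_row.
  by rewrite mulmx0.
have FQ : F *m Q = T1 *m E *m Q.
  rewrite /E /F -mulmxA /Q !mul_row_block !mulmx0 !mulmx1 !add0r mul_mx_row.
  by rewrite mulmx0.
clearbody P Q E F.
exists E, (U *m Q), (U *m P), (P *m U^t*), (Q *m U^t*).
split=> //; last 1 first.
- split.
  + by rewrite mulmxA -(mulmxA U) QP mulmx0 mul0mx -mulmxA (mulmxA (U^t*)) UU' mul1mx PQ.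
  + by rewrite mulmxA -(mulmxA U) PQ mulmx0 mul0mx -mulmxA (mulmxA (U^t*)) UU' mul1mx QP.
  + rewrite !mulmxA -!(mulmxA U) PP QQ -mulmxDr -mulmxDl PQ1 mul1mx UU.
    by rewrite -!(mulmxA _ (U^t*)) UU' !mulmx1 QQ PP addrC.
- split.
  + rewrite !mulmxA EU -[LHS]mulmx1 -PQ1 mulmxDr -FQ addrC; congr (_ + _).
    rewrite -[T1 *m T2 *m E *m U]mulmxA EU -!mulmxA; congr (_ *m _).
    by rewrite EP mulmxA.
  + rewrite !mulmxA EP -{1}FU -mulmxDl mulmxA; congr (_ *m _).
    by rewrite T12 -!mulmxA [T1 *m (E *m Q)]mulmxA -FQ -mulmxDr -mulmxDr PQ1 mulmx1.
- rewrite !trmxC_mul PJ QJ !mulmxA -!(mulmxA U) QQ PP QP mul0mx mulmx0.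
  by rewrite -mulmxDr -mulmxDl [Q + P]addrC PQ1 mul1mx UU.
- rewrite !trmxC_mul trmxCK PJ QJ !mulmxA -!(mulmxA _ (U^t*)) UU' !mulmx1 QQ PP PQ.
  by rewrite PQ1.
Qed.

End Ando.
End VonNeumann.

Section Ando2.
Variable C : numClosedFieldType.
Variables (k : nat) (T1 T2 : 'M[C]_k).
Hypothesis T12 : T1 *m T2 = T2 *m T1.
Hypothesis T1_le1 : forall v : 'rV[C]_k, sqn (v *m T1) <= sqn v.
Hypothesis T2_le1 : forall v : 'rV[C]_k, sqn (v *m T2) <= sqn v.
Local Notation T := (T1 *m T2).

Lemma expmxSr n (A : 'M[C]_n) a : A ^+ a.+1 = A ^+ a *m A.
Proof. by rewrite exprSr. Qed.

Lemma expmxS n (A : 'M[C]_n) a : A ^+ a.+1 = A *m A ^+ a.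
Proof. by rewrite exprS. Qed.

Lemma expmx_comm n (A B : 'M[C]_n) a : A *m B = B *m A -> A ^+ a *m B = B *m A ^+ a.
Proof. by move=> AB; apply/esym/commrX/esym. Qed.

Section Orbit.
Variables (m N : nat) (E : 'M[C]_(k, m)).

(* The first [M] rows of [u], read as an [N x m] matrix, follow the orbit of
   [h] under [T]; each application of a block shift loses one row. *)
Definition orbit_upto M (h : 'rV[C]_k) (u : 'rV[C]_(N * m)) :=
  forall n : 'I_N, (n < M)%N -> row n (vec_mx u) = h *m T ^+ n *m E.

(** Row [n] of the image only involves rows [n] and [n + 1] of [u], and [n < M < N] excludes
    wrap-around. The relation for [S E] then collapses the two terms into one. *)
Lemma orbit_upto_shift (S : 'M[C]_k) a b M h u : (M < N)%N ->
  S *m T = T *m S -> S *m E = E *m a + T *m E *m b ->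
  orbit_upto M.+1 h u -> orbit_upto M (h *m S) (u *m bshiftmx N a b).
Proof.
move=> MN ST SE hu n nM.
rewrite -[u]vec_mxK mul_vec_lin mxvecK /= /bshift linearD /= [row n (vec_mx u *m a)]row_mul [row n (_ *m b)]row_mul row_cshift.
have nS : ordS n = n.+1 :> nat by rewrite /= modn_small // (leq_ltn_trans nM MN).
rewrite !hu ?nS // ?(leqW nM) //.
have -> : h *m S *m T ^+ n *m E = h *m T ^+ n *m (S *m E).
  by rewrite -[h *m S *m _]mulmxA -expmx_comm // !mulmxA.
by rewrite SE mulmxDr expmxSr !mulmxA.
Qed.

Lemma orbit_uptoW M M' h u : (M' <= M)%N -> orbit_upto M h u -> orbit_upto M' h u.
Proof. by move=> MM hu n nM; apply: hu; apply: leq_trans nM MM. Qed.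

Lemma orbit_upto_iter (S : 'M[C]_k) a b p M h u : (M + p <= N)%N ->
  S *m T = T *m S -> S *m E = E *m a + T *m E *m b ->
  orbit_upto (M + p) h u -> orbit_upto M (h *m S ^+ p) (u *m bshiftmx N a b ^+ p).
Proof.
move=> + ST SE; elim: p M h u => [|p IH] M h u Mp hu.
  by rewrite !expr0 !mulmx1 -[M]addn0.
rewrite !expmxS !mulmxA; apply: IH; first by rewrite addnS in Mp; apply: ltnW.
by rewrite addnS in Mp hu; apply: orbit_upto_shift.
Qed.

Lemma orbit_upto_sum I (r : seq I) M (h : I -> 'rV[C]_k) u :
  (forall i, orbit_upto M (h i) (u i)) ->
  orbit_upto M (\sum_(i <- r) h i) (\sum_(i <- r) u i).
Proof.
move=> hu n nM; rewrite linear_sum linear_sum !mulmx_suml /=.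
by apply: eq_bigr => i _; apply: hu.
Qed.

Lemma orbit_upto_scale M h u x : orbit_upto M h u -> orbit_upto M (x *: h) (x *: u).
Proof. by move=> hu n nM; rewrite !linearZ /= -!scalemxAl hu. Qed.

End Orbit.

(** Since [E E^* = 1 - T T^*], the squared norms along an orbit telescope: the dilated vector [u]
    has norm at most that of [h], while the first [M] blocks of its image [u'] account for the norm
    of [h p(T1, T2)] up to the last term. In between, [p] is evaluated at commuting unitaries. *)
Theorem ando_inequality c d M (h : 'rV[C]_k) :
  (forall x y, `|x| = 1 -> `|y| = 1 -> `|bieval c d x y| <= 1) ->
  sqn (h *m mxbieval c d T1 T2) <=
    sqn h + sqn (h *m mxbieval c d T1 T2 *m T ^+ M).
Proof.
move=> c_le1.
have [E [a1 [b1 [a2 [b2 [EE [T1E T2E] [ab1 ab1'] [ab2 ab2'] [aa bb ab]]]]]]] :=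
  ando_pair T12 T1_le1 T2_le1.
have T1T : T1 *m T = T *m T1 by rewrite -mulmxA -T12.
have T2T : T2 *m T = T *m T2 by rewrite mulmxA -T12.
(* Each monomial consumes fewer than [d] rows per variable, so at least [M] correct rows survive. *)
pose N := (M + d + d)%N.
have sqnE x : sqn (x *m E) = sqn x - sqn (x *m T).
  rewrite [in LHS]/sqn trmxC_mul mulmxA -[x *m E *m _]mulmxA EE mulmxBr mulmx1 mulmxBl.
  by rewrite mxE [X in _ + X]mxE /sqn (trmxC_mul x T) !mulmxA.
have sum_orbit (g : 'rV[C]_k) n :
    \sum_(i < n) sqn (g *m T ^+ i *m E) = sqn g - sqn (g *m T ^+ n).
  elim: n => [|n IH]; first by rewrite big_ord0 expr0 mulmx1 subrr.
  by rewrite big_ord_recr /= IH sqnE expmxSr [in RHS]mulmxA addrA subrK.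
pose X : 'M[C]_(N, k + k) := \matrix_(n < N) (h *m T ^+ n *m E).
pose u := mxvec X.
have hu : orbit_upto E N h u by move=> n _; rewrite mxvecK rowK.
pose u' := u *m mxbieval c d (bshiftmx N a1 b1) (bshiftmx N a2 b2).
have hu' : orbit_upto E M (h *m mxbieval c d T1 T2) u'.
  rewrite /u' /mxbieval !mulmx_sumr; apply: orbit_upto_sum => a.
  rewrite !mulmx_sumr; apply: orbit_upto_sum => b.
  rewrite -!scalemxAr; apply: orbit_upto_scale; rewrite !mulmxA.
  have Mb : (M + b <= M + d)%N by rewrite leq_add2l ltnW.
  have Mba : (M + b + a <= N)%N by apply: leq_add => //; apply: ltnW.
  apply: orbit_upto_iter => //; first by rewrite (leq_trans _ Mba) ?leq_addr.
  by apply: orbit_upto_iter => //; apply: orbit_uptoW hu.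
have u'u : sqn u' <= sqn u.
  by apply: commuting_unitary_bound; rewrite ?bshiftmx_unitary // bshiftmx_comm.
have uh : sqn u <= sqn h.
  rewrite /u sqn_mxvec (eq_bigr (fun i : 'I_N => sqn (h *m T ^+ i *m E))) => [|i _].
    by rewrite sum_orbit gerBl sqn_ge0.
  by rewrite rowK.
rewrite -lerBlDr -sum_orbit; apply: le_trans uh; apply: le_trans u'u.
rewrite -[u']vec_mxK sqn_mxvec.
have MN : (M <= N)%N by rewrite /N -addnA leq_addr.
rewrite (big_ord_widen N (fun i => sqn (h *m mxbieval c d T1 T2 *m T ^+ i *m E)) MN).
rewrite [leRHS](bigID (fun i : 'I_N => (i < M)%N)) /= -[leLHS]addr0 lerD //.
  by apply: ler_sum => i iM; rewrite hu'.
by apply: sumr_ge0 => i _; apply: sqn_ge0.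
Qed.

End Ando2.

(** * Ando's inequality for diagonal contractions of a hermitian form *)

Section DiagonalVonNeumann.
Variable C : numClosedFieldType.
(** The Archimedean input over an abstract closed field; [complex_small_expr] supplies it for
    [R[i]]. *)
Hypothesis small_expr : forall r e : C, 0 <= r < 1 -> 0 < e -> exists n, r ^+ n < e.

Definition qform n (K : 'M[C]_n) (v : 'rV[C]_n) : C := (v *m K *m v^t*) 0 0.

Lemma real_le_lim (a b B : C) : a \is Num.real -> b \is Num.real -> 0 <= B ->
  (forall e, 0 < e -> a <= b + e * B) -> a <= b.
Proof.
move=> ar br B0 H; rewrite real_leNgt //; apply/negP => ba.
have B1 : 0 < B + 1 by rewrite ltr_wpDl.
have ab0 : 0 < a - b by rewrite subr_gt0.
have e0 : 0 < (a - b) / (B + 1) by rewrite divr_gt0.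
have := H _ e0; rewrite -lerBlDl mulrAC ler_pdivlMr // ler_pM2l //.
by rewrite -subr_ge0 opprD addNKr oppr_ge0 ler10.
Qed.

Lemma qform_sum n (K : 'M[C]_n) v :
  qform K v = \sum_i \sum_j v 0 j * K j i * (v 0 i)^*.
Proof.
rewrite /qform mxE; apply: eq_bigr => i _.
by rewrite !mxE mulr_suml.
Qed.

Lemma qform_real n (K : 'M[C]_n) v : K \is hermsymmx -> qform K v \is Num.real.
Proof.
move=> /is_hermitianmxP; rewrite expr0 scale1r => KE.
apply/CrealP; rewrite /qform.
transitivity (((v *m K *m v^t*)^t*) 0 0); first by rewrite [RHS]mxE [in RHS]mxE.
by rewrite !trmxC_mul trmxCK -KE mulmxA.
Qed.

Lemma qform_gram n (G : 'M[C]_n) v : qform (G *m G^t*) v = sqn (v *m G).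
Proof. by rewrite /qform /sqn trmxC_mul !mulmxA. Qed.

Lemma qformD n (K L : 'M[C]_n) v : qform (K + L) v = qform K v + qform L v.
Proof. by rewrite /qform mulmxDr mulmxDl mxE. Qed.

Lemma qform_scalar n (e : C) (v : 'rV[C]_n) : qform e%:M v = e * sqn v.
Proof. by rewrite /qform /sqn mul_mx_scalar -scalemxAl mxE. Qed.

Section Points.
Variables (k : nat).

Lemma small_expr_fin (w : 'rV[C]_k) e : (forall j, `|w 0 j| < 1) -> 0 < e ->
  exists n, forall j, `|w 0 j| ^+ n <= e.
Proof.
move=> w1 e0; have /fin_all_exists [n nP] : forall j, exists n, `|w 0 j| ^+ n < e.
  by move=> j; apply: small_expr => //; rewrite normr_ge0 w1.
exists (\sum_j n j)%N => j; apply: le_trans (ltW (nP j)).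
by apply: ler_wiXn2l; [exact: normr_ge0 | exact: ltW | rewrite (bigD1 j) //= leq_addr].
Qed.

Lemma qform_expr_small (K : 'M[C]_k) (w v : 'rV[C]_k) e : (forall j, `|w 0 j| < 1) ->
  0 < e -> exists n, `|qform K (v *m diag_mx w ^+ n)| <= e.
Proof.
move=> w1 e0.
pose B := \sum_i \sum_j `|v 0 j| * `|K j i| * `|v 0 i|.
have B0 : 0 <= B by do 2![apply: sumr_ge0 => ? _]; rewrite !mulr_ge0.
have B1 : 0 < B + 1 by rewrite ltr_wpDl.
have [n nP] := small_expr_fin w1 (divr_gt0 e0 B1).
exists n; rewrite expmx_diag qform_sum.
apply: (@le_trans _ _ (B * (e / (B + 1)))); last first.
  by rewrite mulrCA ler_piMr ?(ltW e0) // ler_pdivrMr // mul1r lerDl.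
rewrite /B mulr_suml; apply: le_trans (ler_norm_sum _ _ _) _; apply: ler_sum => i _.
rewrite mulr_suml; apply: le_trans (ler_norm_sum _ _ _) _; apply: ler_sum => j _.
rewrite !mul_mx_diag !mxE !normrM norm_conjC normrM !normrX.
have -> : `|v 0 j| * `|w 0 j| ^+ n * `|K j i| * (`|v 0 i| * `|w 0 i| ^+ n) =
  `|v 0 j| * `|K j i| * `|v 0 i| * (`|w 0 j| ^+ n * `|w 0 i| ^+ n) by ring.
rewrite ler_wpM2l ?mulr_ge0 // -[leRHS]mulr1.
by rewrite ler_pM ?exprn_ge0 // exprn_ile1 // ltW.
Qed.

(** Iterating the contraction bounds [qform K v] below by its values at [v w^n], which tend to 0. *)
Lemma qform_contraction_ge0 (K : 'M[C]_k) (w : 'rV[C]_k) :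
  K \is hermsymmx -> (forall j, `|w 0 j| < 1) ->
  (forall v, qform K (v *m diag_mx w) <= qform K v) -> forall v, 0 <= qform K v.
Proof.
move=> Kh w1 Kw v.
have qn n : qform K (v *m diag_mx w ^+ n) <= qform K v.
  elim: n => [|n IH]; first by rewrite expr0 mulmx1.
  by rewrite expmxSr mulmxA; apply: le_trans IH.
apply: (@real_le_lim _ _ 1) => //; first exact: qform_real.
move=> e e0; have [n nP] := qform_expr_small K v w1 e0.
rewrite mulr1 -lerBlDr; apply: le_trans (qn n); rewrite sub0r.
by move: nP; rewrite real_ler_norml ?qform_real // => /andP[].
Qed.

(** Factoring the form as [G G^*] with [G] invertible turns contractions of the form into
    contractions of the Euclidean norm, to which [ando_inequality] applies. *)
Theorem von_neumann_diag (K : 'M[C]_k) (w1 w2 : 'rV[C]_k) c d :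
  K \is hermsymmx -> (forall j, `|w1 0 j| < 1) -> (forall j, `|w2 0 j| < 1) ->
  (forall v, qform K (v *m diag_mx w1) <= qform K v) ->
  (forall v, qform K (v *m diag_mx w2) <= qform K v) ->
  (forall x y, `|x| = 1 -> `|y| = 1 -> `|bieval c d x y| <= 1) ->
  forall v, qform K (v *m diag_mx (\row_j bieval c d (w1 0 j) (w2 0 j))) <= qform K v.
Proof.
move=> Kh w1_lt1 w2_lt1 Kw1 Kw2 c_le1 v.
set p := \row_j _.
have K_ge0 := qform_contraction_ge0 Kh w1_lt1 Kw1.
have diag_le1 (w u : 'rV[C]_k) : (forall j, `|w 0 j| < 1) -> sqn (u *m diag_mx w) <= sqn u.
  move=> w_lt1; rewrite !sqnE; apply: ler_sum => j _.
  by rewrite mul_mx_diag mxE normrM exprMn ler_piMr ?exprn_ge0 // expr_le1 // ltW.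
apply: (@real_le_lim _ _ (sqn v)); rewrite ?qform_real ?sqn_ge0 // => e e0.
(* [K] may be degenerate; adding [e] makes [G] invertible. Multiplication by [w1] and [w2] remains
   contractive because the points have modulus below 1. *)
have Lh : K + e%:M \is hermsymmx.
  apply/is_hermitianmxP; rewrite expr0 scale1r trmxCD.
  move/is_hermitianmxP: Kh; rewrite expr0 scale1r => <-.
  by rewrite tr_scalar_mx map_scalar_mx /= geC0_conj ?ltW.
have qL u : qform (K + e%:M) u = qform K u + e * sqn u by rewrite qformD qform_scalar.
have [u|G GE] := @herm_psd_factor C k _ Lh.
  by rewrite -/(qform _ _) qL addr_ge0 // mulr_ge0 ?sqn_ge0 ?ltW.
have sG u : sqn (u *m G) = qform K u + e * sqn u by rewrite -qform_gram -GE qL.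
have Gu : G \in unitmx.
  rewrite -row_free_unit -kermx_eq0; apply/eqP/row_matrixP => i; rewrite row0.
  apply/eqP; rewrite -sqn_eq0; have := sG (row i (kermx G)).
  rewrite -row_mul mulmx_ker row0 /sqn mul0mx mxE -/(sqn _) => /esym/eqP.
  rewrite paddr_eq0 ?K_ge0 ?mulr_ge0 ?sqn_ge0 ?ltW // => /andP[_].
  by rewrite mulf_eq0 gt_eqF.
have GV := mulmxV Gu; have VG := mulVmx Gu.
pose T1 := invmx G *m diag_mx w1 *m G; pose T2 := invmx G *m diag_mx w2 *m G.
have TT a b : (invmx G *m diag_mx a *m G) *m (invmx G *m diag_mx b *m G) =
    invmx G *m (diag_mx a *m diag_mx b) *m G.
  by rewrite !mulmxA -[_ *m G *m invmx G]mulmxA GV mulmx1.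
have T12 : T1 *m T2 = T2 *m T1 by rewrite !TT diag_mxC.
have vG u A : u *m G *m (invmx G *m A *m G) = u *m A *m G.
  by rewrite !mulmxA -[_ *m G *m invmx G]mulmxA GV mulmx1.
have T_le1 (w : 'rV[C]_k) : (forall j, `|w 0 j| < 1) ->
    (forall v, qform K (v *m diag_mx w) <= qform K v) ->
    forall h, sqn (h *m (invmx G *m diag_mx w *m G)) <= sqn h.
  move=> w_lt1 Kw h; have -> : h = h *m invmx G *m G by rewrite -mulmxA VG mulmx1.
  by rewrite vG !sG lerD // ler_wpM2l ?diag_le1 // ltW.
pose u := v *m diag_mx p.
have hp : v *m G *m mxbieval c d T1 T2 = u *m G.
  by rewrite mxbieval_conj // vG mxbieval_diag.
(* The last term goes to 0 as [M] grows, since every product [w1 w2] lies in the open disc; [e] was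
   set free by the outer limit. *)
have main M : qform K u + e * sqn u <= qform K v + e * sqn v +
    qform (K + e%:M) (u *m diag_mx (\row_j (w1 0 j * w2 0 j)) ^+ M).
  have := ando_inequality T12 (T_le1 _ w1_lt1 Kw1) (T_le1 _ w2_lt1 Kw2) M (v *m G) c_le1.
  by rewrite hp TT mulmx_diag conj_expmx // vG !sG qL.
have w12 j : `|(\row_j (w1 0 j * w2 0 j)) 0 j : C| < 1.
  by rewrite mxE normrM mulr_ilt1.
apply: (@real_le_lim _ _ 1) => //; rewrite ?qform_real ?rpredD ?qform_real //.
  by rewrite ger0_real // mulr_ge0 ?sqn_ge0 ?ltW.
move=> e' e'0; have [M MP] := qform_expr_small (K + e%:M) u w12 e'0.
rewrite mulr1; apply: (@le_trans _ _ (qform K u + e * sqn u)).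
  by rewrite lerDl mulr_ge0 ?sqn_ge0 ?ltW.
apply: le_trans (main M) _; rewrite lerD2l.
by apply: le_trans MP; rewrite real_ler_norm // qform_real.
Qed.

End Points.
End DiagonalVonNeumann.

Local Open Scope classical_set_scope.
Local Open Scope complex_scope.
Local Open Scope ring_scope.

(** * The cone of admissible right-hand sides *)

Section ComplexContinuity.
Variables (R : realType) (T : topologicalType).

(** Stated on real and imaginary parts, the form required by the real extreme value theorem and by
    the componentwise integrals. *)
Definition ccont (f : T -> R[i]) (a : T) :=
  continuous_at a (fun t => complex.Re (f t)) /\
  continuous_at a (fun t => complex.Im (f t)).

Lemma ccont_cst (c : R[i]) a : ccont (fun=> c) a.
Proof. by split; apply: cst_continuous. Qed.

Lemma cReD (x y : R[i]) : complex.Re (x + y) = complex.Re x + complex.Re y.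
Proof. by case: x => ??; case: y. Qed.
Lemma cImD (x y : R[i]) : complex.Im (x + y) = complex.Im x + complex.Im y.
Proof. by case: x => ??; case: y. Qed.
Lemma cReN (x : R[i]) : complex.Re (- x) = - complex.Re x.
Proof. by case: x. Qed.
Lemma cImN (x : R[i]) : complex.Im (- x) = - complex.Im x.
Proof. by case: x. Qed.
Lemma cReM (x y : R[i]) : complex.Re (x * y) =
  complex.Re x * complex.Re y - complex.Im x * complex.Im y.
Proof. by case: x => ??; case: y. Qed.
Lemma cImM (x y : R[i]) : complex.Im (x * y) =
  complex.Re x * complex.Im y + complex.Im x * complex.Re y.
Proof. by case: x => ??; case: y. Qed.
Lemma cReJ (x : R[i]) : complex.Re x^* = complex.Re x.
Proof. by case: x. Qed.
Lemma cImJ (x : R[i]) : complex.Im x^* = - complex.Im x.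
Proof. by case: x. Qed.

Lemma ccontD f g a : ccont f a -> ccont g a -> ccont (fun t => f t + g t) a.
Proof.
move=> [f1 f2] [g1 g2]; split.
  by under eq_fun do rewrite cReD; apply: cvgD.
by under eq_fun do rewrite cImD; apply: cvgD.
Qed.

Lemma ccontN f a : ccont f a -> ccont (fun t => - f t) a.
Proof.
move=> [f1 f2]; split.
  by under eq_fun do rewrite cReN; apply: cvgN.
by under eq_fun do rewrite cImN; apply: cvgN.
Qed.

Lemma ccontJ f a : ccont f a -> ccont (fun t => (f t)^* ) a.
Proof.
move=> [f1 f2]; split.
  by under eq_fun do rewrite cReJ.
by under eq_fun do rewrite cImJ; apply: cvgN.
Qed.

Lemma ccontM f g a : ccont f a -> ccont g a -> ccont (fun t => f t * g t) a.
Proof.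
move=> [f1 f2] [g1 g2]; split.
  by under eq_fun do rewrite cReM; apply: cvgB; apply: cvgM.
by under eq_fun do rewrite cImM; apply: cvgD; apply: cvgM.
Qed.

Lemma ccont_sum I (r : seq I) (f : I -> T -> R[i]) a :
  (forall i, ccont (f i) a) -> ccont (fun t => \sum_(i <- r) f i t) a.
Proof.
move=> fc; elim: r => [|i r IH].
  by under eq_fun do rewrite big_nil; apply: ccont_cst.
by under eq_fun do rewrite big_cons; apply: ccontD.
Qed.

End ComplexContinuity.

Section Minimization.
Variables (R : realType) (k : nat).
Notation C := R[i].

Definition frob2 (E : 'M[C]_k) : C := \sum_i \sum_j `|E i j| ^+ 2.

(** Booleans index the two terms of the right-hand side; [true] will be the one with [A1]. *)
Definition schur_comb (l A : bool -> 'M[C]_k) : 'M[C]_k :=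
  \matrix_(i, j) \sum_b l b i j * A b i j.

Lemma frob2_ge0 (E : 'M[C]_k) : 0 <= frob2 E.
Proof. by do 2![apply: sumr_ge0 => ? _]; rewrite exprn_ge0. Qed.

Lemma frob2_ge (E : 'M[C]_k) i j : `|E i j| ^+ 2 <= frob2 E.
Proof.
rewrite /frob2 (bigD1 i) //= (bigD1 j) //= -addrA lerDl addr_ge0 //.
  by apply: sumr_ge0 => ? _; rewrite exprn_ge0.
by do 2![apply: sumr_ge0 => ? _]; rewrite exprn_ge0.
Qed.

(** Turns bounds on squares into bounds on norms without square roots; hence the additive 1 in later
    constants. *)
Lemma norm_le_sqr1 (t : C) : `|t| <= 1 + `|t| ^+ 2.
Proof.
rewrite -subr_ge0; have -> : 1 + `|t| ^+ 2 - `|t| = (`|t| - 2^-1) ^+ 2 + 3 / 4 by field.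
by rewrite addr_ge0 ?divr_ge0 // -realEsqr rpredB ?normr_real // rpredV realn.
Qed.

Variables (l : bool -> 'M[C]_k) (M : 'M[C]_k).
Hypothesis l_gt0 : forall b i, 0 < l b i i.

Local Notation coord := (bool * 'I_k * 'I_k * bool)%type.

(** Real coordinates for a pair of complex matrices, so that compactness of boxes in real row
    vectors applies. *)
Definition mx_of_coord (x : 'rV[R]_#|{: coord}|) (b : bool) : 'M[C]_k :=
  \matrix_(i, j) Complex (x 0 (enum_rank (b, i, j, true))) (x 0 (enum_rank (b, i, j, false))).

Definition coord_of_mx (X : bool -> 'M[C]_k) : 'rV[R]_#|{: coord}| :=
  \row_n let: (b, i, j, re) := enum_val n in
    if re then complex.Re (X b i j) else complex.Im (X b i j).

Lemma coord_of_mxK X : mx_of_coord (coord_of_mx X) =1 X.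
Proof.
by move=> b; apply/matrixP => i j; rewrite !mxE !enum_rankK; case: (X b i j).
Qed.

(** Squared distance from [M] to a point of the cone, as a function of Gram factors, which range
    over all matrices. *)
Definition gram_residual (X : bool -> 'M[C]_k) : C :=
  frob2 (M - schur_comb l (fun b => X b *m (X b)^t*)).

Lemma gram_residual_continuous :
  continuous (fun x => complex.Re (gram_residual (mx_of_coord x))).
Proof.
move=> a; suff : ccont (fun x => gram_residual (mx_of_coord x)) a by case.
apply: ccont_sum => i; apply: ccont_sum => j.
under eq_fun do rewrite normCK !mxE.
suff H : ccont (fun x => M i j -
    \sum_b l b i j * \sum_m mx_of_coord x b i m * (mx_of_coord x b j m)^*) a.
  under eq_fun => x.
    under eq_bigr => b _.
      rewrite mxE; under eq_bigr do rewrite [(_^t*) _ _]mxE [(_^T) _ _]mxE.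
      over.
    over.
  by apply: ccontM => //; apply: ccontJ.
apply: ccontD; first exact: ccont_cst.
apply: ccontN; apply: ccont_sum => b; apply: ccontM; first exact: ccont_cst.
have X_cont i' j' : ccont (fun x => mx_of_coord x b i' j') a.
  by split => /=; under eq_fun do rewrite mxE /=; apply: coord_continuous.
by apply: ccont_sum => m; apply: ccontM; rewrite ?X_cont //; apply: ccontJ.
Qed.

(** If [X] does at least as well as 0, the diagonal entries of the residual bound the sums of
    [l b i i] times the squared rows of [X b]. As [l b i i > 0], all entries of such [X] lie in a
    fixed box, where the minimum is attained. *)
Lemma gram_residual_minimizer : exists X0, forall X, gram_residual X0 <= gram_residual X.
Proof.
pose B : C := 1 + \sum_b \sum_i (`|M i i| + (1 + gram_residual (fun=> 0))) / l b i i.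
have D_ge0 b i : 0 <= (`|M i i| + (1 + gram_residual (fun=> 0))) / l b i i.
  by rewrite divr_ge0 ?(ltW (l_gt0 _ _)) // !addr_ge0 // frob2_ge0.
have B_ge0 : 0 <= B.
  by rewrite addr_ge0 //; do 2![apply: sumr_ge0 => ? _].
have BE : B = (complex.Re B)%:C by rewrite RRe_real // ger0_real.
have X_le X b i j : gram_residual X <= gram_residual (fun=> 0) -> `|X b i j| <= B.
  move=> XM.
  have AE c : (X c *m (X c)^t*) i i = \sum_m `|X c i m| ^+ 2.
    by rewrite mxE; apply: eq_bigr => m _; rewrite !mxE normCK.
  have A_ge0 c : 0 <= (X c *m (X c)^t*) i i.
    by rewrite AE sumr_ge0 // => m _; rewrite exprn_ge0.
  pose s := \sum_c l c i i * (X c *m (X c)^t*) i i.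
  have s_ge0 : 0 <= s by apply: sumr_ge0 => c _; rewrite mulr_ge0 // ltW.
  have s_le : s <= `|M i i| + (1 + gram_residual (fun=> 0)).
    apply: (@le_trans _ _ (`|M i i| + (1 + gram_residual X))); last by rewrite !lerD2l.
    rewrite -lerBlDl -(ger0_norm s_ge0).
    apply: le_trans (lerB_dist _ _) _; rewrite distrC.
    apply: le_trans (norm_le_sqr1 _) _; rewrite lerD2l.
    have := frob2_ge (M - schur_comb l (fun b => X b *m (X b)^t*)) i i.
    by rewrite [X in `|X| ^+ 2 <= _]mxE [X in `|_ + X|]mxE [X in `|_ - X|]mxE.
  have X2 : `|X b i j| ^+ 2 <= (`|M i i| + (1 + gram_residual (fun=> 0))) / l b i i.
    rewrite ler_pdivlMr //; apply: le_trans s_le; rewrite mulrC.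
    rewrite /s (bigD1 b) //= -[leLHS]addr0 lerD //.
      rewrite ler_pM2l // AE (bigD1 j) //= lerDl sumr_ge0 // => m _; rewrite exprn_ge0.
    by apply: sumr_ge0 => c _; rewrite mulr_ge0 // ltW.
  apply: le_trans (norm_le_sqr1 _) _; rewrite lerD2l; apply: le_trans X2 _.
  rewrite (bigD1 b) //= (bigD1 i) //= -addrA lerDl addr_ge0 //.
    by apply: sumr_ge0.
  by do 2![apply: sumr_ge0 => ? _].
pose r := complex.Re B.
have r_ge0 : 0 <= r by rewrite -lecR -BE.
pose K := [set x : 'rV[R]_#|{: coord}| | forall n, `[- r, r]%classic (x ord0 n)].
have K0 : 0 \in K by rewrite inE => n /=; rewrite mxE in_itv /= oppr_le0 r_ge0.
have Kc : compact K.
  by apply: (@rV_compact R _ (fun=> `[- r, r]%classic)) => n; apply: segment_compact.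
have [||x0 x0K x0min] := @compact_EVT_min _ R
    (fun x => complex.Re (gram_residual (mx_of_coord x))) K _ Kc.
- by exists 0; rewrite inE in K0.
- exact/continuous_subspaceT/gram_residual_continuous.
have resE X : (complex.Re (gram_residual X))%:C = gram_residual X.
  by rewrite RRe_real // ger0_real // frob2_ge0.
have res_ext X Y : X =1 Y -> gram_residual X = gram_residual Y.
  by move=> /funext ->.
have x0_le0 : gram_residual (mx_of_coord x0) <= gram_residual (fun=> 0).
  have <- : gram_residual (mx_of_coord 0) = gram_residual (fun=> 0).
    by apply: res_ext => b; apply/matrixP => i j; rewrite !mxE.
  by rewrite -resE -[leRHS]resE lecR; apply: x0min.
exists (mx_of_coord x0) => X.
have res_real Y : gram_residual Y \is Num.real := ger0_real (frob2_ge0 _).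
have /orP[XM|XM] := real_leVge (res_real X) (res_real (fun=> 0)); last exact: le_trans x0_le0 XM.
rewrite -(res_ext _ _ (coord_of_mxK X)) -resE -[leRHS]resE lecR; apply: x0min.
rewrite inE => n /=; rewrite mxE in_itv /= -ler_norml.
case: (enum_val n) => [[[b i] j] re].
rewrite -lecR -BE; apply: le_trans (X_le X b i j XM).
case: re; first exact: normc_ge_Re.
case: (X b i j) => x y /=; rewrite normc_def /= lecR -sqrtr_sqr ler_wsqrtr //.
by rewrite lerDr sqr_ge0.
Qed.

End Minimization.

Section Separation.
Variables (R : realType) (k : nat).
Notation C := R[i].

Definition frob_inner (E F : 'M[C]_k) : C := \sum_i \sum_j (E i j)^* * F i j.

Lemma frob_innerB E F G : frob_inner E (F - G) = frob_inner E F - frob_inner E G.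
Proof.
rewrite /frob_inner -sumrB; apply: eq_bigr => i _; rewrite -sumrB.
by apply: eq_bigr => j _; rewrite !mxE mulrBr.
Qed.

Lemma frob_inner_self E : frob_inner E E = frob2 E.
Proof. by apply: eq_bigr => i _; apply: eq_bigr => j _; rewrite normCK mulrC. Qed.

Lemma hermmxE (A : 'M[C]_k) : A \is hermsymmx -> forall i j, (A i j)^* = A j i.
Proof.
move=> /is_hermitianmxP; rewrite expr0 scale1r => AE i j.
by rewrite {2}AE !mxE.
Qed.

Lemma hermmxP (A : 'M[C]_k) : (forall i j, (A i j)^* = A j i) -> A \is hermsymmx.
Proof.
move=> AE; apply/is_hermitianmxP; rewrite expr0 scale1r.
by apply/matrixP => i j; rewrite !mxE -AE.
Qed.

Lemma frob_inner_real E F : E \is hermsymmx -> F \is hermsymmx ->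
  (frob_inner E F)^* = frob_inner E F.
Proof.
move=> Eh Fh; rewrite /frob_inner rmorph_sum exchange_big /=; apply: eq_bigr => i _.
rewrite rmorph_sum; apply: eq_bigr => j _.
by rewrite rmorphM /= (hermmxE Eh) (hermmxE Fh).
Qed.

Lemma frob2BZ E F t : t \is Num.real -> E \is hermsymmx -> F \is hermsymmx ->
  frob2 (E - t *: F) = frob2 E - 2 * t * frob_inner E F + t ^+ 2 * frob2 F.
Proof.
move=> tr Eh Fh.
have -> : 2 * t * frob_inner E F = t * frob_inner E F + t * (frob_inner E F)^*.
  by rewrite frob_inner_real //; ring.
rewrite /frob_inner rmorph_sum /frob2 !mulr_sumr -big_split /= -sumrB -big_split /=.
apply: eq_bigr => i _.
rewrite rmorph_sum !mulr_sumr -big_split /= -sumrB -big_split /=.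
apply: eq_bigr => j _.
rewrite !mxE !normCK !(rmorphB, rmorphM) /= conjCK (CrealP tr).
ring.
Qed.

Definition grammx (X : 'M[C]_k) := X *m X^t*.

Lemma grammx_herm X : grammx X \is hermsymmx.
Proof. by apply/is_hermitianmxP; rewrite expr0 scale1r trmxC_mul trmxCK. Qed.

Lemma grammx_ge0 X v : 0 <= qform (grammx X) v.
Proof. by rewrite qform_gram sqn_ge0. Qed.

Lemma gram_factor (A : bool -> 'M[C]_k) :
  (forall b, A b \is hermsymmx /\ forall v, 0 <= qform (A b) v) ->
  exists X, forall b, A b = grammx (X b).
Proof.
move=> Apsd; have /choice[X AX] : forall b, exists X, A b = grammx X; last by exists X.
by move=> b; have [Ah A0] := Apsd b; apply: herm_psd_factor.
Qed.

Variables (l : bool -> 'M[C]_k) (M : 'M[C]_k).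
Hypothesis l_gt0 : forall b i, 0 < l b i i.
Hypothesis l_herm : forall b, l b \is hermsymmx.
Hypothesis M_herm : M \is hermsymmx.

Lemma schur_comb_herm A : (forall b, A b \is hermsymmx) -> schur_comb l A \is hermsymmx.
Proof.
move=> Ah; apply: hermmxP => i j; rewrite !mxE rmorph_sum; apply: eq_bigr => b _.
by rewrite rmorphM /= (hermmxE (l_herm b)) (hermmxE (Ah b)).
Qed.

Lemma schur_combD A B : schur_comb l (fun b => A b + B b) = schur_comb l A + schur_comb l B.
Proof.
apply/matrixP => i j; rewrite !mxE -big_split; apply: eq_bigr => b _.
by rewrite !mxE mulrDr.
Qed.

Lemma schur_combZ t A : schur_comb l (fun b => t *: A b) = t *: schur_comb l A.
Proof.
apply/matrixP => i j; rewrite !mxE mulr_sumr; apply: eq_bigr => b _.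
by rewrite !mxE mulrCA.
Qed.

Lemma qformZ t (A : 'M[C]_k) v : qform (t *: A) v = t * qform A v.
Proof. by rewrite /qform -scalemxAr -scalemxAl mxE. Qed.

Lemma hermD (A B : 'M[C]_k) : A \is hermsymmx -> B \is hermsymmx -> A + B \is hermsymmx.
Proof. by move=> Ah Bh; apply: hermmxP => i j; rewrite !mxE rmorphD /= !hermmxE. Qed.

Lemma hermZ t (A : 'M[C]_k) : t \is Num.real -> A \is hermsymmx -> t *: A \is hermsymmx.
Proof.
by move=> tr Ah; apply: hermmxP => i j; rewrite !mxE rmorphM /= hermmxE // (CrealP tr).
Qed.

(** First-order conditions at the nearest point: moving towards any [P] of the cone cannot help, and
    shrinking the nearest point towards 0 cannot help either. *)
Theorem nearest_schur_comb : exists X : bool -> 'M[C]_k,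
  let E := M - schur_comb l (fun b => grammx (X b)) in
  [/\ E \is hermsymmx,
      forall P : bool -> 'M[C]_k, (forall b, P b \is hermsymmx /\ forall v, 0 <= qform (P b) v) ->
        frob_inner E (schur_comb l P) <= 0
    & frob2 E <= frob_inner E M].
Proof.
have [X X_min] := gram_residual_minimizer M l_gt0.
exists X; set A := fun b => grammx (X b); move=> E.
have Ah b : A b \is hermsymmx by apply: grammx_herm.
have LA := schur_comb_herm Ah.
have Eh : E \is hermsymmx.
  by rewrite /E -scaleN1r; exact: hermD M_herm (hermZ (rpredN1 _) LA).
(* Expansion of the squared distance when [A] moves to [A + t P]; [t] may be negative as long as
   positivity persists. *)
have step (P : bool -> 'M[C]_k) t : t \is Num.real -> (forall b, P b \is hermsymmx) ->
    (forall b v, 0 <= qform (A b + t *: P b) v) ->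
    2 * t * frob_inner E (schur_comb l P) <= t ^+ 2 * frob2 (schur_comb l P).
  move=> tr Ph AP.
  have [|Y YE] := @gram_factor (fun b => A b + t *: P b).
    by move=> b; split; [exact: hermD (Ah b) (hermZ tr (Ph b)) | exact: AP].
  have := X_min Y; rewrite /gram_residual -/(A _).
  have -> : schur_comb l (fun b => Y b *m (Y b)^t*) = schur_comb l A + t *: schur_comb l P.
    rewrite -schur_combZ -schur_combD; congr schur_comb; apply/funext => b.
    by rewrite YE.
  rewrite opprD addrA -/E (frob2BZ tr Eh (schur_comb_herm Ph)).
  by rewrite -addrA lerDl addrC subr_ge0.
split=> // [P Ppsd|].
  have Ph b : P b \is hermsymmx by case: (Ppsd b).
  apply: (@real_le_lim _ _ _ (frob2 (schur_comb l P))) => //.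
  - by apply/CrealP; rewrite (frob_inner_real Eh (schur_comb_herm Ph)).
  - exact: frob2_ge0.
  move=> e e0.
  have Ap b v : 0 <= qform (A b + e *: P b) v.
    rewrite qformD qformZ addr_ge0 ?grammx_ge0 // mulr_ge0 ?(ltW e0) //.
    by case: (Ppsd b).
  have := step P e (ger0_real (ltW e0)) Ph Ap.
  rewrite add0r; set x := frob_inner _ _; set y := frob2 _.
  rewrite -mulrA mulrCA expr2 -mulrA ler_pM2l // => xy.
  have y0 : 0 <= y by apply: frob2_ge0.
  have ey : e * y <= 2 * (e * y).
    by rewrite mulr_natl mulr2n lerDl mulr_ge0 // ltW.
  by have := le_trans xy ey; rewrite ler_pM2l.
have AE : frob_inner E M = frob2 E + frob_inner E (schur_comb l A).
  by rewrite -frob_inner_self -[in RHS]/E /E frob_innerB subrK.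
rewrite AE lerDl.
apply: (@real_le_lim _ _ _ (frob2 (schur_comb l A))) => //.
- by apply/CrealP; rewrite (frob_inner_real Eh LA).
- exact: frob2_ge0.
(* This [t] is at most 1, so that [A - t A] stays positive, and at most [e], so that the quadratic
   error is controlled. *)
move=> e e0; pose t := e / (1 + e).
have e1 : 0 < 1 + e by rewrite ltr_wpDl.
have t0 : 0 < t by rewrite divr_gt0.
have te : t <= e by rewrite /t ler_pdivrMr // mulrDr mulr1 lerDl mulr_ge0 ?ltW.
have t1 : t <= 1 by rewrite /t ler_pdivrMr // mul1r lerDr.
clearbody t.
have tr : - t \is Num.real by rewrite rpredN ger0_real // ltW.
have Ap b v : 0 <= qform (A b + - t *: A b) v.
  by rewrite -{1}[A b]scale1r -scalerDl qformZ mulr_ge0 ?grammx_ge0 // subr_ge0.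
have := step A (- t) tr Ah Ap.
set x := frob_inner _ _; set y := frob2 _.
have -> : 2 * - t * x = t * (2 * - x) by ring.
rewrite sqrrN expr2 -mulrA ler_pM2l // => xy.
have y0 : 0 <= y by apply: frob2_ge0.
have tey : t * y <= e * y by rewrite ler_wpM2r.
rewrite -lerBlDl sub0r.
have x2 : 2 * - x <= 2 * (e * y).
  have H := le_trans xy tey.
  apply: (le_trans H).
  by rewrite mulr_natl mulr2n lerDl mulr_ge0 // ltW.
by move: x2; rewrite ler_pM2l.
Qed.

End Separation.

(** * From approximating polynomials to the two matrices *)

Section PickForward.
Variables (R : realType) (k : nat).
Notation C := R[i].

Lemma complex_small_expr (r e : C) : 0 <= r < 1 -> 0 < e -> exists n, r ^+ n < e.
Proof.
move=> /andP[r0 r1] e0.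
have rE : r = (complex.Re r)%:C by rewrite RRe_real // ger0_real.
have eE : e = (complex.Re e)%:C by rewrite RRe_real // gtr0_real.
have r1' : `|complex.Re r| < 1.
  by rewrite ger0_norm -?ltcR -?lecR -rE.
have e0' : 0 < complex.Re e by rewrite -ltcR -eE.
have := cvg_expr r1' => /cvgrPdist_lt /(_ _ e0') [N _ /(_ N (leqnn N))].
rewrite sub0r normrN normrX => /= H; exists N.
by rewrite rE eE -rmorphXn ltcR (le_lt_trans _ H) // -normrX ler_norm.
Qed.

(** A local Lipschitz bound at [v]; it transfers an inequality from approximating polynomial values
    to their limit. *)
Lemma qform_approx (K : 'M[C]_k) (v : 'rV[C]_k) :
  exists2 B : C, 0 <= B & forall (e : C) (u : 'rV[C]_k), 0 < e <= 1 -> (forall j, `|u 0 j - v 0 j| <= e) ->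
    `|qform K u - qform K v| <= e * B.
Proof.
pose B := \sum_i \sum_j `|K j i| * (2 * `|v 0 j| + 2 * `|v 0 i| + 1).
exists B => [|e u /andP[e0 e1] uv].
  by do 2![apply: sumr_ge0 => ? _]; rewrite mulr_ge0 // !addr_ge0 ?mulr_ge0.
rewrite !qform_sum -sumrB /B mulr_sumr.
apply: le_trans (ler_norm_sum _ _ _) _; apply: ler_sum => i _.
rewrite -sumrB mulr_sumr.
apply: le_trans (ler_norm_sum _ _ _) _; apply: ler_sum => j _.
pose a := u 0 j - v 0 j; pose b := u 0 i - v 0 i.
have -> : u 0 j * K j i * (u 0 i)^* - v 0 j * K j i * (v 0 i)^* =
   K j i * (a * (v 0 i)^* + v 0 j * b^* + a * b^*).
  by rewrite /a /b !rmorphB /=; ring.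
rewrite normrM mulrCA ler_wpM2l //.
have ae : `|a| <= e by apply: uv.
have be : `|b| <= e by apply: uv.
apply: le_trans (ler_normD _ _) _.
apply: (@le_trans _ _ (e * `|v 0 i| + `|v 0 j| * e + e * 1)).
  rewrite lerD //; last by rewrite normrM norm_conjC ler_pM // (le_trans be).
  by apply: le_trans (ler_normD _ _) _; rewrite lerD // normrM norm_conjC ler_pM.
rewrite -subr_ge0 [X in 0 <= X](_ : _ = e * (`|v 0 i| + `|v 0 j|)); last by ring.
by rewrite mulr_ge0 ?addr_ge0 // ltW.
Qed.

Variables (lambda : 'I_k -> C * C) (z : 'I_k -> C).
Hypothesis lambda_triangle : forall j, hartogs_triangle (lambda j).

Theorem pick_necessary :
  (forall e : C, 0 < e -> exists c d,
     (forall x y : C, `|x| = 1 -> `|y| = 1 -> `|bieval c d x y| <= 1) /\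
     forall j, `|bieval c d ((lambda j).1 / (lambda j).2) (lambda j).2 - z j| <= e) ->
  exists A1 A2 : 'M[C]_k,
     [/\ psdmx A1, psdmx A2
       & forall i j,
           1 - (z i)^* * z j =
             ((lambda i).2^* * (lambda j).2
                - (lambda i).1^* * (lambda j).1) * A1 i j
             + (1 - (lambda i).2^* * (lambda j).2) * A2 i j].
Proof.
move=> approx.
have l2_lt1 j : `|(lambda j).2| < 1 by case: (lambda_triangle j).
have l12 j : `|(lambda j).1| < `|(lambda j).2| by case: (lambda_triangle j).
have l2_neq0 j : (lambda j).2 != 0.
  by rewrite -normr_gt0; apply: le_lt_trans (l12 j).
pose M : 'M[C]_k := \matrix_(i, j) (1 - (z i)^* * z j).
pose l1 : 'M[C]_k := \matrix_(i, j) ((lambda i).2^* * (lambda j).2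
                - (lambda i).1^* * (lambda j).1).
pose l2 : 'M[C]_k := \matrix_(i, j) (1 - (lambda i).2^* * (lambda j).2).
pose l b := if b then l1 else l2.
have M_herm : M \is hermsymmx.
  by apply: hermmxP => i j; rewrite !mxE rmorphB rmorphM /= conjCK conjC1 mulrC.
have l_herm b : l b \is hermsymmx.
  by case: b; apply: hermmxP => i j; rewrite !mxE rmorphB ?rmorphM /= ?rmorphM ?conjCK ?conjC1
    /= ?conjCK; ring.
have l_gt0 b i : 0 < l b i i.
  case: b; rewrite !mxE ![_^* * _]mulrC -!normCK subr_gt0.
    by rewrite ltr_pXn2r ?nnegrE.
  by rewrite expr_lt1.
have [X [Eh EP EM]] := nearest_schur_comb l_gt0 l_herm M_herm.
move: Eh EP EM; set E := M - _ => Eh EP EM.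
(* Tests [E] on a rank-one matrix placed in one of the two slots, with 0 in the other. *)
have E_rank1 b (v : 'rV[C]_k) : \sum_i \sum_j (E i j)^* * (l b i j * ((v 0 i)^* * v 0 j)) <= 0.
  have := EP (fun b' => if b' == b then v^t* *m v else 0).
  have -> : frob_inner E (schur_comb l (fun b' => if b' == b then v^t* *m v else 0)) =
     \sum_i \sum_j (E i j)^* * (l b i j * ((v 0 i)^* * v 0 j)).
    apply: eq_bigr => i _; apply: eq_bigr => j _; congr (_ * _).
    rewrite mxE (bigD1 b) //= eqxx big1 ?addr0; last first.
      by move=> b' /negPf->; rewrite mxE mulr0.
    by congr (_ * _); rewrite mxE big_ord1 !mxE.
  apply=> b'; case: ifP => _; split.
  - by apply: hermmxP => i j; rewrite !mxE !big_ord1 !mxE rmorphM /= conjCK mulrC.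
  - move=> u; rewrite /qform.
    have -> : u *m (v^t* *m v) *m u^t* = (u *m v^t* ) *m (u *m v^t* )^t*.
      by rewrite trmxC_mul trmxCK !mulmxA.
    exact: sqn_ge0.
  - by apply: hermmxP => i j; rewrite !mxE conjC0.
  - by move=> u; rewrite /qform mulmx0 mul0mx mxE.
pose K := - E.
have Kh : K \is hermsymmx by rewrite /K -scaleN1r; apply: hermZ.
have KE v : qform K v = - \sum_i \sum_j (E i j)^* * ((v 0 i)^* * v 0 j).
  rewrite qform_sum -sumrN; apply: eq_bigr => i _; rewrite -sumrN; apply: eq_bigr => j _.
  by rewrite mxE (hermmxE Eh); ring.
pose w1 : 'rV[C]_k := \row_j ((lambda j).1 / (lambda j).2).
pose w2 : 'rV[C]_k := \row_j (lambda j).2.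
have w1_lt1 j : `|w1 0 j| < 1.
  by rewrite mxE normrM normfV ltr_pdivrMr ?normr_gt0 // mul1r.
have w2_lt1 j : `|w2 0 j| < 1 by rewrite mxE.
have Kw2 v : qform K (v *m diag_mx w2) <= qform K v.
  rewrite -subr_ge0 !KE opprK addrC -opprB oppr_ge0; apply: le_trans (E_rank1 false v).
  rewrite -sumrB le_eqVlt; apply/orP; left; apply/eqP; apply: eq_bigr => i _.
  rewrite -sumrB; apply: eq_bigr => j _.
  by rewrite !mul_mx_diag !mxE rmorphM /=; ring.
have Kw1 v : qform K (v *m diag_mx w1) <= qform K v.
  (* The coefficient [l1 i j] is [1 - (w1 i)^* w1 j] times [(lambda i).2^* (lambda j).2]; dividing
     [v] by the second coordinates absorbs that factor. *)
  pose u : 'rV[C]_k := \row_j (v 0 j / (lambda j).2).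
  rewrite -subr_ge0 !KE opprK addrC -opprB oppr_ge0; apply: le_trans (E_rank1 true u).
  rewrite -sumrB le_eqVlt; apply/orP; left; apply/eqP; apply: eq_bigr => i _.
  rewrite -sumrB; apply: eq_bigr => j _.
  rewrite !mul_mx_diag !mxE !rmorphM !fmorphV /=.
  by field; rewrite conjC_eq0 !l2_neq0.
pose o : 'rV[C]_k := const_mx 1; pose zz : 'rV[C]_k := \row_j z j.
have Kz : qform K zz <= qform K o.
  have [B B0 BP] := qform_approx K zz.
  apply: (@real_le_lim _ _ _ B); rewrite ?qform_real // => e e0.
  pose t := e / (1 + e).
  have e1 : 0 < 1 + e by rewrite ltr_wpDl.
  have t0 : 0 < t by rewrite divr_gt0.
  have te : t <= e by rewrite /t ler_pdivrMr // mulrDr mulr1 lerDl mulr_ge0 ?ltW.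
  have t1 : t <= 1 by rewrite /t ler_pdivrMr // mul1r lerDr.
  have [c [d [cd_le1 cd_z]]] := approx _ t0.
  have := von_neumann_diag complex_small_expr Kh w1_lt1 w2_lt1 Kw1 Kw2 cd_le1 o.
  set u := o *m _ => Ku.
  have uE j : u 0 j = bieval c d ((lambda j).1 / (lambda j).2) (lambda j).2.
    by rewrite /u mul_mx_diag !mxE mul1r.
  have tt : 0 < t <= 1 by rewrite t0 t1.
  have uz j : `|u 0 j - zz 0 j| <= t by rewrite uE mxE; apply: cd_z.
  have := BP _ _ tt uz.
  rewrite real_ler_norml ?rpredB ?qform_real // => /andP[+ _].
  rewrite lerBrDr addrC lerBlDr => H; apply: le_trans H _.
  by rewrite lerD // ler_wpM2r.
have E0 : frob2 E <= 0.
  apply: le_trans EM _.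
  (* [M] is the rank-one matrix of the constant vector 1 minus that of [z], and [K = - E]. *)
  have -> : frob_inner E M = qform K zz - qform K o.
    rewrite !KE opprK addrC -sumrB; apply: eq_bigr => i _.
    rewrite -sumrB; apply: eq_bigr => j _; rewrite !mxE conjC1; ring.
  by rewrite subr_le0.
have Eij i j : E i j = 0.
  apply/eqP; rewrite -normr_eq0 -sqrf_eq0 eq_le exprn_ge0 // andbT.
  exact: le_trans (frob2_ge _ _ _) E0.
exists (grammx (X true)), (grammx (X false)); split.
- split; first exact: grammx_herm.
  by move=> v; have := grammx_ge0 (X true) (v^t*); rewrite /qform trmxCK.
- split; first exact: grammx_herm.
  by move=> v; have := grammx_ge0 (X false) (v^t*); rewrite /qform trmxCK.
move=> i j; have := Eij i j.
have -> : E i j = (1 - (z i)^* * z j) - \sum_b l b i j * grammx (X b) i j.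
  by rewrite /E mxE [M i j]mxE; congr (_ + _); rewrite mxE [in LHS]mxE.
by rewrite big_bool /= !mxE => /eqP; rewrite subr_eq0 => /eqP.
Qed.

End PickForward.

(** * Transfer functions *)

Section DifferentiableDet.
Variables (K : numFieldType) (V : normedModType K) (x : V).

Lemma differentiable_bigsum I (r : seq I) (f : I -> V -> K) :
  (forall i, differentiable (f i) x) -> differentiable (fun y => \sum_(i <- r) f i y) x.
Proof.
move=> df; elim: r => [|i r IH].
  by under eq_fun do rewrite big_nil; apply: differentiable_cst.
by under eq_fun do rewrite big_cons; apply: differentiableD.
Qed.

Lemma differentiable_bigprod I (r : seq I) (f : I -> V -> K) :
  (forall i, differentiable (f i) x) -> differentiable (fun y => \prod_(i <- r) f i y) x.
Proof.
move=> df; elim: r => [|i r IH].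
  by under eq_fun do rewrite big_nil; apply: differentiable_cst.
by under eq_fun do rewrite big_cons; apply: differentiableM.
Qed.

Lemma differentiable_det n (A : V -> 'M[K]_n) :
  (forall i j, differentiable (fun y => A y i j) x) -> differentiable (fun y => \det (A y)) x.
Proof.
move=> dA; apply: differentiable_bigsum => s; apply: differentiableM.
  exact: differentiable_cst.
by apply: differentiable_bigprod.
Qed.

Lemma differentiable_adj n (A : V -> 'M[K]_n) i j :
  (forall i j, differentiable (fun y => A y i j) x) ->
  differentiable (fun y => (\adj (A y)) i j) x.
Proof.
move=> dA; under eq_fun do rewrite mxE /cofactor.
apply: differentiableM; first exact: differentiable_cst.
by apply: differentiable_det => i' j'; under eq_fun do rewrite !mxE.
Qed.

Lemma differentiable_mulmx m n p (A : V -> 'M[K]_(m, n)) (B : V -> 'M[K]_(n, p)) i j :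
  (forall i j, differentiable (fun y => A y i j) x) ->
  (forall i j, differentiable (fun y => B y i j) x) ->
  differentiable (fun y => (A y *m B y) i j) x.
Proof.
move=> dA dB; under eq_fun do rewrite mxE.
by apply: differentiable_bigsum => l; apply: differentiableM.
Qed.

End DifferentiableDet.

Section PickBackward.
Variables (R : realType) (k : nat).
Notation C := R[i].

Lemma psdmx_factor (A : 'M[C]_k) : psdmx A -> exists G, A = grammx G.
Proof.
move=> [Ah A0]; apply: herm_psd_factor => // v.
by have := A0 (v^t*); rewrite trmxCK.
Qed.

(** The transfer function [a + b (1 - D d)^-1 D c], with the inverse written by Cramer's rule so
    that differentiability in [D] follows from that of determinants. *)
Definition transfer m (a : C) (b : 'rV[C]_m) (c : 'cV[C]_m) (d D : 'M[C]_m) : C :=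
  a + (\det (1%:M - D *m d))^-1 * (b *m \adj (1%:M - D *m d) *m (D *m c)) 0 0.

Section Transfer.
Variables (m : nat) (a : C) (b : 'rV[C]_m) (c : 'cV[C]_m) (d D : 'M[C]_m).
Let W := block_mx (a%:M : 'M[C]_1) b c d.
Hypothesis W_unitary : W \is unitarymx.
Hypothesis D_lt1 : forall u : 'rV[C]_m, u != 0 -> sqn (u *m D) < sqn u.

Lemma sqn_row_mx n1 n2 (u : 'rV[C]_n1) (v : 'rV[C]_n2) :
  sqn (row_mx u v) = sqn u + sqn v.
Proof. by rewrite /sqn trmxC_row_mx mul_row_col mxE. Qed.

(** If [v = v D d], then [v] is a component of [(0, v D) W], so its norm is at most that of [v D],
    which is smaller than that of [v] unless [v = 0]. *)
Lemma transfer_unit : 1%:M - D *m d \in unitmx.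
Proof.
rewrite -row_free_unit -kermx_eq0; apply/eqP/row_matrixP => i; rewrite row0.
set v := row i _; have : v *m (1%:M - D *m d) = 0 by rewrite -row_mul mulmx_ker row0.
rewrite mulmxBr mulmx1 => /eqP; rewrite subr_eq0 => /eqP vE.
apply/eqP; apply: contraT => vn0.
have : sqn v < sqn v; last by rewrite ltxx.
apply: le_lt_trans (D_lt1 vn0).
rewrite {1}vE mulmxA -(addr0 (sqn (v *m D))) -[leRHS]addrC.
have <- : sqn (row_mx 0 (v *m D) : 'rV[C]_(1 + m)) = 0 + sqn (v *m D).
  by rewrite sqn_row_mx; congr (_ + _); apply/eqP; rewrite sqn_eq0.
rewrite -(sqn_unitary _ W_unitary) /W mul_row_block !mul0mx !add0r sqn_row_mx.
by rewrite lerDr sqn_ge0.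
Qed.

Let h := b *m invmx (1%:M - D *m d).

Lemma transfer_stateE u : u = b + u *m D *m d -> u = h.
Proof.
move=> uE; have : u *m (1%:M - D *m d) = b.
  by rewrite mulmxBr mulmx1 {1}uE mulmxA addrK.
by rewrite /h => <-; rewrite mulmxK ?transfer_unit.
Qed.

Lemma transferE : transfer a b c d D = a + (h *m D *m c) 0 0.
Proof.
rewrite /transfer /h /invmx transfer_unit -scalemxAr -!scalemxAl [in RHS]mxE.
by rewrite !mulmxA.
Qed.

(** Energy balance: [W] maps [(1, h D)] isometrically to the pair of the transfer value and [h], and
    [h D] is no longer than [h]. *)
Lemma transfer_le1 : `|transfer a b c d D| <= 1.
Proof.
rewrite -(@expr_le1 _ 2%N) // transferE.
have hE : b + h *m D *m d = h.
  have /eqP : h *m (1%:M - D *m d) = b by rewrite mulmxKV ?transfer_unit.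
  by rewrite mulmxBr mulmx1 mulmxA subr_eq => /eqP.
have WE : row_mx 1%:M (h *m D) *m W = row_mx (a + (h *m D *m c) 0 0)%:M h.
  rewrite /W mul_row_block !mul1mx hE; congr row_mx.
  by rewrite [h *m D *m c in LHS]mx11_scalar -raddfD.
have := sqn_unitary (row_mx 1%:M (h *m D)) W_unitary.
rewrite WE !sqn_row_mx.
have s1 (t : C) : sqn (t%:M : 'rV[C]_1) = `|t| ^+ 2 by rewrite sqnE big_ord1 mxE eqxx mulr1n.
rewrite !s1 normr1 expr1n => sE.
have hD : sqn (h *m D) <= sqn h.
  have [->|/D_lt1/ltW //] := eqVneq h 0.
  by rewrite mul0mx.
by rewrite -(lerD2r (sqn h)) sE lerD2l.
Qed.

End Transfer.

Variables (lambda : 'I_k -> C * C) (z : 'I_k -> C).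
Hypothesis lambda_triangle : forall j, hartogs_triangle (lambda j).

Theorem pick_sufficient :
  (exists A1 A2 : 'M[C]_k,
     [/\ psdmx A1, psdmx A2
       & forall i j,
           1 - (z i)^* * z j =
             ((lambda i).2^* * (lambda j).2
                - (lambda i).1^* * (lambda j).1) * A1 i j
             + (1 - (lambda i).2^* * (lambda j).2) * A2 i j]) ->
  exists psi : C * C -> C,
     [/\ holomorphic_on (@hartogs_triangle R) psi,
         forall x, hartogs_triangle x -> `|psi x| <= 1
       & forall j, psi (lambda j) = z j].
Proof.
move=> [A1 [A2 [/psdmx_factor[G1 ->] /psdmx_factor[G2 ->] zE]]].
(* Moving all negative terms of the equation to the other side leaves an equality of two sums of
   Gram matrices, those of [X] and [Y]. *)
pose X : 'M[C]_(k, 1 + (k + k)) := \matrix_(i < k)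
  row_mx 1%:M (row_mx ((lambda i).1^* *: row i G1) ((lambda i).2^* *: row i G2)).
pose Y : 'M[C]_(k, 1 + (k + k)) := \matrix_(i < k)
  row_mx ((z i)^*)%:M (row_mx ((lambda i).2^* *: row i G1) (row i G2)).
have gramE (G : 'M[C]_k) i j : row i G *m (row j G)^t* = (grammx G i j)%:M.
  rewrite [LHS]mx11_scalar; congr (_%:M); rewrite !mxE.
  by apply: eq_bigr => l _; rewrite !mxE.
have XY : X *m X^t* = Y *m Y^t*.
  apply/matrixP => i j.
  have entry (Z : 'M[C]_(k, 1 + (k + k))) : (Z *m Z^t*) i j = (row i Z *m (row j Z)^t*) 0 0.
    by rewrite !mxE; apply: eq_bigr => l _; rewrite !mxE.
  rewrite !entry !rowK !trmxC_row_mx !mul_row_col.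
  rewrite ![(_ *: row j _)^T]linearZ /= !map_mxZ /= !conjCK.
  rewrite -!scalemxAl -!scalemxAr !gramE !tr_scalar_mx !map_scalar_mx /= conjCK conjC1.
  rewrite -!scalar_mxM -!scale_scalar_mx.
  move: (grammx G1 i j) (grammx G2 i j) (zE i j) => g1 g2 zij.
  rewrite !mxE !eqxx !mulr1n.
  have -> : (z i)^* * z j = 1 - (1 - (z i)^* * z j) by ring.
  by rewrite zij; ring.
have [U Uu XU] := unitary_intertwining XY.
(* The rows of [X] and [Y] carry conjugated coordinates; conjugating the whole relation makes it
   holomorphic in the points. *)
pose W := map_mx Num.conj U; have Wu : W \is unitarymx by rewrite conjC_unitary.
pose a := ulsubmx (W : 'M[C]_(1 + (k + k))) 0 0; pose b := ursubmx (W : 'M[C]_(1 + (k + k))).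
pose c := dlsubmx (W : 'M[C]_(1 + (k + k))); pose d := drsubmx (W : 'M[C]_(1 + (k + k))).
have WE : W = block_mx a%:M b c d.
  by rewrite -[LHS]submxK /a -mx11_scalar.
pose D (x : C * C) : 'M[C]_(k + k) := block_mx (x.1 / x.2)%:M 0 0 (x.2)%:M.
exists (fun x => transfer a b c d (D x)).
have D_lt1 x : hartogs_triangle x -> forall u : 'rV[C]_(k + k), u != 0 -> sqn (u *m D x) < sqn u.
  move=> [x12 x21] u; rewrite -[u]hsubmxK; move: (lsubmx u) (rsubmx u) => u1 u2 un0.
  have x20 : 0 < `|x.2| by apply: le_lt_trans x12.
  rewrite mul_row_block !mulmx0 addr0 add0r !sqn_row_mx !mul_mx_scalar.
  have sZ n t (v : 'rV[C]_n) : sqn (t *: v) = `|t| ^+ 2 * sqn v.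
    by rewrite !sqnE mulr_sumr; apply: eq_bigr => j _; rewrite mxE normrM exprMn.
  have lt_v n t (v : 'rV[C]_n) : `|t| < 1 -> v != 0 -> sqn (t *: v) < sqn v.
    move=> t1 v0; rewrite sZ gtr_pMl ?expr_lt1 //.
    by rewrite lt_neqAle sqn_ge0 andbT eq_sym sqn_eq0.
  have le_v n t (v : 'rV[C]_n) : `|t| < 1 -> sqn (t *: v) <= sqn v.
    by move=> t1; have [->|/(lt_v _ _ _ t1)/ltW//] := eqVneq v 0; rewrite scaler0.
  have x1 : `|x.1 / x.2| < 1 by rewrite normrM normfV ltr_pdivrMr // mul1r.
  have [u10|u10] := eqVneq u1 0; last by rewrite ltr_leD ?lt_v ?le_v.
  rewrite ler_ltD ?le_v ?lt_v //; apply: contra un0 => /eqP ->.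
  by rewrite u10 row_mx0.
have Wu' : block_mx a%:M b c d \is unitarymx by rewrite -WE.
split.
- move=> x xH; have [x12 x21] := xH.
  have x20 : x.2 != 0 by rewrite -normr_gt0; apply: le_lt_trans x12.
  have dfst : differentiable (fun y : C^o * C^o => y.1 : C^o) x.
    by apply: linear_differentiable => ?; apply: cvg_fst.
  have dsnd : differentiable (fun y : C^o * C^o => y.2 : C^o) x.
    by apply: linear_differentiable => ?; apply: cvg_snd.
  have dD i j : differentiable (fun y : C^o * C^o => D y i j : C^o) x.
    rewrite /D; case: (split_ordP i) => i' ->; case: (split_ordP j) => j' ->.
    - under eq_fun do rewrite block_mxEul mxE.
      case: (i' == j') => /=.
        under eq_fun do rewrite mulr1n.
        by apply: differentiableM => //; apply: differentiableV.
      by under eq_fun do rewrite mulr0n; apply: differentiable_cst.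
    - by under eq_fun do rewrite block_mxEur mxE; apply: differentiable_cst.
    - by under eq_fun do rewrite block_mxEdl mxE; apply: differentiable_cst.
    - under eq_fun do rewrite block_mxEdr mxE.
      case: (i' == j') => /=.
        by under eq_fun do rewrite mulr1n.
      by under eq_fun do rewrite mulr0n; apply: differentiable_cst.
  have cst m n (A : 'M[C]_(m, n)) i j : differentiable (fun y : C^o * C^o => A i j : C^o) x.
    exact: differentiable_cst.
  have dB i j : differentiable (fun y : C^o * C^o => (1%:M - D y *m d) i j : C^o) x.
    have -> : (fun y : C^o * C^o => (1%:M - D y *m d) i j : C^o) =
        (fun y : C^o * C^o => (1%:M : 'M[C]_(k + k)) i j - (D y *m d) i j : C^o).
      by apply/funext => y; rewrite mxE [X in _ + X]mxE.
    apply: differentiableB; first exact: differentiable_cst.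
    by apply: differentiable_mulmx => // i' j'; apply: cst.
  apply: differentiableD; first exact: differentiable_cst.
  apply: differentiableM.
    apply: differentiableV; first exact: differentiable_det.
    by have := transfer_unit Wu' (D_lt1 _ xH); rewrite unitmxE unitfE.
  apply: differentiable_mulmx => i j.
    apply: differentiable_mulmx => i' j'; first exact: cst.
    exact: differentiable_adj.
  by apply: differentiable_mulmx => i' j' //; apply: cst.
- by move=> x xH; apply: transfer_le1 => //; apply: D_lt1.
- move=> j.
  have : map_mx Num.conj (row j X) *m W = map_mx Num.conj (row j Y).
    by rewrite -map_mxM -row_mul XU.
  rewrite !rowK !map_row_mx !map_scalar_mx /= conjC1 conjCK !map_mxZ /= !conjCK WE.
  rewrite mul_row_block !mul1mx => /eq_row_mx [zjE hE].
  (* With this state, row [j] of the intertwining relation reads [(1, h D) W = (z j, h)]: its second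
     component is the state equation, its first the interpolation. *)
  pose h := row_mx ((lambda j).2 *: map_mx Num.conj (row j G1)) (map_mx Num.conj (row j G2)).
  have l20 : (lambda j).2 != 0.
    by case: (lambda_triangle j) => l12 _; rewrite -normr_gt0; apply: le_lt_trans l12.
  have hD : h *m D (lambda j) =
      row_mx ((lambda j).1 *: map_mx Num.conj (row j G1)) ((lambda j).2 *: map_mx Num.conj (row j G2)).
    rewrite mul_row_block !mulmx0 addr0 add0r !mul_mx_scalar scalerA.
    by rewrite divfK.
  rewrite (transferE Wu' (D_lt1 _ (lambda_triangle j))).
  have <- : h = b *m invmx (1%:M - D (lambda j) *m d).
    by apply: (transfer_stateE Wu' (D_lt1 _ (lambda_triangle j))); rewrite hD.
  rewrite hD; have /matrixP /(_ 0 0) := zjE.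
  by rewrite mxE mxE eqxx mulr1n [in RHS]mxE eqxx mulr1n.
Qed.

End PickBackward.

(** * Goursat's theorem and circular means *)

Section ComplexIntegral.
Variable R : realType.
Notation C := R[i].
Notation mu := (@lebesgue_measure R).
Import Normc.

Lemma normc_ge0 (z : C) : 0 <= normc z.
Proof. by case: z => x y; apply: sqrtr_ge0. Qed.

Lemma norm_normc (z : C) : `|z| = (normc z)%:C.
Proof. by []. Qed.

Lemma normcB (x y : C) : normc (x - y) = normc (y - x).
Proof. by rewrite -normcN opprB. Qed.

Lemma Re_le_normc (z : C) : `|complex.Re z| <= normc z.
Proof. by have := normc_ge_Re z; rewrite norm_normc lecR. Qed.

Lemma Im_le_normc (z : C) : `|complex.Im z| <= normc z.
Proof. by case: z => x y /=; rewrite -sqrtr_sqr ler_wsqrtr // lerDr sqr_ge0. Qed.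

Lemma normc_le_ReIm (z : C) : normc z <= `|complex.Re z| + `|complex.Im z|.
Proof.
case: z => x y /=; rewrite -[leRHS]ger0_norm ?addr_ge0 // -sqrtr_sqr ler_wsqrtr //.
rewrite sqrrD !real_normK ?num_real // lerD2r lerDl mulrn_wge0 // mulr_ge0 //.
Qed.

Lemma normcC (x : R) : normc x%:C = `|x|.
Proof. by rewrite /= expr0n addr0 sqrtr_sqr. Qed.

Lemma normci : normc 'i%C = 1 :> R.
Proof. by rewrite /= expr0n expr1n add0r sqrtr1. Qed.

Definition cint (a b : R) (F : R -> C) : C :=
  Complex (\int[mu]_(t in `[a, b]) complex.Re (F t))
          (\int[mu]_(t in `[a, b]) complex.Im (F t)).

Definition ccont_itv (a b : R) (F : R -> C) := forall t, a <= t <= b -> ccont F t.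

Lemma ccont_itv_integrable a b F : ccont_itv a b F ->
  mu.-integrable `[a, b] (EFin \o (fun t => complex.Re (F t))) /\
  mu.-integrable `[a, b] (EFin \o (fun t => complex.Im (F t))).
Proof.
move=> Fc; split; apply: continuous_compact_integrable; try exact: segment_compact.
  apply: continuous_in_subspaceT => t; rewrite inE /= in_itv /= => /Fc [+ _]; exact.
apply: continuous_in_subspaceT => t; rewrite inE /= in_itv /= => /Fc [_]; exact.
Qed.

Lemma cint_itv_split a b c F : a <= b -> b <= c -> ccont_itv a c F ->
  cint a c F = cint a b F + cint b c F.
Proof.
move=> ab bc Fc; have [iRe iIm] := ccont_itv_integrable Fc.
have Fbc : ccont_itv b c F.
  by move=> t /andP[bt tc]; apply: Fc; rewrite tc (le_trans ab bt).
have [jRe jIm] := ccont_itv_integrable Fbc.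
have split1 (f : R -> R) : mu.-integrable `[a, c] (EFin \o f) ->
    mu.-integrable `[b, c] (EFin \o f) ->
    \int[mu]_(t in `[a, c]) f t = \int[mu]_(t in `[a, b]) f t + \int[mu]_(t in `[b, c]) f t.
  move=> fi fj; apply/eqP; rewrite addrC -subr_eq; apply/eqP.
  rewrite (Rintegral_itvB (x := b) fi) ?bnd_simp //.
  apply: Rintegral_itv_obnd_cbnd; apply: integrableS fj => //.
  by apply: subset_itvr; rewrite bnd_simp.
by rewrite /cint !split1.
Qed.

Lemma cint_ext a b F G : (forall t, a <= t <= b -> F t = G t) -> cint a b F = cint a b G.
Proof.
move=> FG; rewrite /cint; congr Complex; apply: eq_Rintegral => t;
  by rewrite inE /= in_itv /= => /FG ->.
Qed.

Lemma cintD a b F G : ccont_itv a b F -> ccont_itv a b G ->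
  cint a b (fun t => F t + G t) = cint a b F + cint a b G.
Proof.
move=> /ccont_itv_integrable [F1 F2] /ccont_itv_integrable [G1 G2].
rewrite /cint; under eq_Rintegral do rewrite cReD.
by under [X in Complex _ X]eq_Rintegral do rewrite cImD; rewrite !RintegralD.
Qed.

Lemma cintZ a b (c : C) F : ccont_itv a b F -> cint a b (fun t => c * F t) = c * cint a b F.
Proof.
move=> /ccont_itv_integrable [F1 F2]; rewrite /cint; case: c => x y.
under eq_Rintegral do rewrite cReM /=.
under [X in Complex _ X]eq_Rintegral do rewrite cImM /=.
have mI : measurable (`[a, b]%classic : set R) by [].
have Z (f : R -> R) (r : R) : mu.-integrable `[a, b] (EFin \o f) ->
    mu.-integrable `[a, b] (EFin \o (fun t => r * f t)).
  by move=> fi; under [X in mu.-integrable _ X]eq_fun do rewrite /= EFinM; apply: integrableZl.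
rewrite RintegralB ?RintegralD ?RintegralZl //; try exact: Z.
Qed.

Lemma ccont_itvN a b F : ccont_itv a b F -> ccont_itv a b (fun t => - F t).
Proof. by move=> Fc t /Fc; apply: ccontN. Qed.

Lemma cintB a b F G : ccont_itv a b F -> ccont_itv a b G ->
  cint a b (fun t => F t - G t) = cint a b F - cint a b G.
Proof.
move=> Fc Gc; rewrite cintD //; last exact: ccont_itvN.
rewrite -[in RHS](mulN1r (cint a b G)) -cintZ //; congr (_ + _).
by apply: cint_ext => t _; rewrite mulN1r.
Qed.

Lemma cint_cst a b (c : C) : a <= b -> cint a b (fun=> c) = (b - a)%:C * c.
Proof.
move=> ab; rewrite /cint !Rintegral_cst //= lebesgue_measure_itv /= lte_fin.
case: c => x y; case: ltgtP ab => // [ab|->] _ /=.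
  by simpc; rewrite mulrC [X in Complex _ X]mulrC.
by rewrite subrr !mulr0 mul0r.
Qed.

Lemma cint_sum a b I (r : seq I) (F : I -> R -> C) : a <= b -> (forall i, ccont_itv a b (F i)) ->
  cint a b (fun t => \sum_(i <- r) F i t) = \sum_(i <- r) cint a b (F i).
Proof.
move=> ab Fc; elim: r => [|i r IH].
  rewrite big_nil -[RHS](mulr0 (b - a)%:C) -cint_cst //.
  by apply: cint_ext => t _; rewrite big_nil.
rewrite big_cons -IH -cintD //; last by move=> t tab; apply: ccont_sum => j; apply: Fc.
by apply: cint_ext => t _; rewrite big_cons.
Qed.

(** The factor 2 comes from estimating real and imaginary parts separately. *)
Lemma cint_le a b M F : a <= b -> ccont_itv a b F ->
  (forall t, a <= t <= b -> normc (F t) <= M) -> normc (cint a b F) <= 2 * M * (b - a).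
Proof.
move=> ab Fc FM; have [F1 F2] := ccont_itv_integrable Fc.
have mI : measurable (`[a, b]%classic : set R) by [].
have bound (f : R -> R) : mu.-integrable `[a, b] (EFin \o f) ->
    (forall t, a <= t <= b -> `|f t| <= M) -> `|\int[mu]_(t in `[a, b]) f t| <= M * (b - a).
  move=> fi fM; have /le_trans := @le_normr_Rintegral _ _ R mu `[a, b]%classic f (measurable_itv _) fi; apply.
  have -> : M * (b - a) = \int[mu]_(t in `[a, b]) M.
    rewrite Rintegral_cst //= lebesgue_measure_itv /= lte_fin.
    by move: ab; rewrite le_eqVlt => /predU1P[->|ab]; rewrite ?ltxx ?ab /= ?subrr.
  apply: le_Rintegral => //.
  - have := fi; move/integrable_norm; exact.
  - by apply: continuous_compact_integrable; [exact: segment_compact | move=> ?; apply: cst_continuous].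
apply: le_trans (normc_le_ReIm _) _.
rewrite -mulrA mulr_natl mulr2n lerD //= bound // => t tab.
  exact: le_trans (Re_le_normc _) (FM _ tab).
exact: le_trans (Im_le_normc _) (FM _ tab).
Qed.

End ComplexIntegral.

Section Goursat.
Variable R : realType.
Notation C := R[i].
Import Normc.

Lemma ccont_eps (G : R -> C) x :
  (forall e, 0 < e -> exists2 d, 0 < d & forall u, `|u| < d -> normc (G (x + u) - G x) <= e) ->
  ccont G x.
Proof.
move=> Gx; split; apply/cvgrPdist_le => e e0; have [d d0 dP] := Gx _ e0.
  near=> t; have : `|t - x| < d by rewrite distrC; near: t; exists d.
  move=> /dP; rewrite subrKC => /(le_trans _); apply.
  by rewrite distrC -cReN -cReD Re_le_normc.
near=> t; have : `|t - x| < d by rewrite distrC; near: t; exists d.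
move=> /dP; rewrite subrKC => /(le_trans _); apply.
by rewrite distrC -cImN -cImD Im_le_normc.
Unshelve. all: by end_near. Qed.

(** Complex differentiability at [x + i y], written in real coordinates. *)
Definition rdiff (F : R -> R -> C) x y := exists a : C, forall e, 0 < e ->
  exists2 d, 0 < d & forall u v, `|u| < d -> `|v| < d ->
    normc (F (x + u) (y + v) - F x y - a * (u +i* v)) <= e * (`|u| + `|v|).

Lemma rdiff_eps F x y : rdiff F x y -> forall e, 0 < e ->
  exists2 d, 0 < d & forall u v, `|u| < d -> `|v| < d ->
    normc (F (x + u) (y + v) - F x y) <= e.
Proof.
move=> [a Fa] e e0; have [d d0 dP] := Fa _ ltr01.
pose K := 2 * (normc a + 1).
have K0 : 0 < K by rewrite mulr_gt0 // ltr_wpDl // normc_ge0.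
exists (Num.min d (e / K)) => [|u v]; first by rewrite lt_min d0 divr_gt0.
rewrite !lt_min => /andP[ud ue] /andP[vd ve].
rewrite -[X in normc X](subrK (a * (u +i* v))).
apply: le_trans (le_normcD _ _) _; rewrite normcM.
apply: (@le_trans _ _ ((normc a + 1) * (`|u| + `|v|))).
  rewrite mulrDl [leRHS]addrC lerD ?dP // ler_wpM2l ?normc_ge0 //.
  exact: normc_le_ReIm.
apply: (@le_trans _ _ ((normc a + 1) * (e / K + e / K))).
  by rewrite ler_pM2l ?lerD ?ltW // ltr_wpDl ?normc_ge0.
rewrite le_eqVlt; apply/orP; left; apply/eqP; rewrite /K; field.
by rewrite gt_eqF // ltr_wpDl ?normc_ge0.
Qed.

Lemma rdiff_ccont1 F x y : rdiff F x y -> ccont (fun t => F t y) x.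
Proof.
move=> Fxy; apply: ccont_eps => e e0; have [d d0 dP] := rdiff_eps Fxy e0.
by exists d => // u ud; have := dP u 0 ud; rewrite normr0 addr0; apply.
Qed.

Lemma rdiff_ccont2 F x y : rdiff F x y -> ccont (fun t => F x t) y.
Proof.
move=> Fxy; apply: ccont_eps => e e0; have [d d0 dP] := rdiff_eps Fxy e0.
by exists d => // u ud; have := dP 0 u; rewrite normr0 addr0; apply.
Qed.

(** The counterclockwise boundary integral of a rectangle, with opposite sides grouped under one
    integral. *)
Definition bdint (F : R -> R -> C) x0 x1 y0 y1 : C :=
  cint x0 x1 (fun x => F x y0 - F x y1) + 'i%C * cint y0 y1 (fun y => F x1 y - F x0 y).

Definition rect_diff F x0 x1 y0 y1 :=
  forall x y, x0 <= x <= x1 -> y0 <= y <= y1 -> rdiff F x y.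

Lemma rect_diff1 F x0 x1 y0 y1 y : rect_diff F x0 x1 y0 y1 -> y0 <= y <= y1 ->
  ccont_itv x0 x1 (fun x => F x y).
Proof. by move=> FF yy x xx; apply: rdiff_ccont1; apply: FF. Qed.

Lemma rect_diff2 F x0 x1 y0 y1 x : rect_diff F x0 x1 y0 y1 -> x0 <= x <= x1 ->
  ccont_itv y0 y1 (fun y => F x y).
Proof. by move=> FF xx y yy; apply: rdiff_ccont2; apply: FF. Qed.

Lemma ccont_itvB a b (F G : R -> C) : ccont_itv a b F -> ccont_itv a b G ->
  ccont_itv a b (fun t => F t - G t).
Proof. by move=> Fc Gc t tab; apply: ccontD; [exact: Fc | apply/ccontN/Gc]. Qed.

Lemma bdint_splitx F x0 xm x1 y0 y1 : x0 <= xm -> xm <= x1 -> y0 <= y1 ->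
  rect_diff F x0 x1 y0 y1 ->
  bdint F x0 x1 y0 y1 = bdint F x0 xm y0 y1 + bdint F xm x1 y0 y1.
Proof.
move=> x0m xm1 y01 Fd.
have x01 := le_trans x0m xm1.
have F0 : ccont_itv y0 y1 (F x0) by apply: rect_diff2 Fd _; rewrite lexx.
have Fm : ccont_itv y0 y1 (F xm) by apply: rect_diff2 Fd _; rewrite x0m.
have F1 : ccont_itv y0 y1 (F x1) by apply: rect_diff2 Fd _; rewrite lexx andbT.
rewrite /bdint (cint_itv_split x0m xm1); last first.
  by apply: ccont_itvB; apply: rect_diff1 Fd _; rewrite lexx ?andbT.
rewrite (cintB F1 F0) (cintB Fm F0) (cintB F1 Fm); ring.
Qed.

Lemma bdint_splity F x0 x1 y0 ym y1 : y0 <= ym -> ym <= y1 -> x0 <= x1 ->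
  rect_diff F x0 x1 y0 y1 ->
  bdint F x0 x1 y0 y1 = bdint F x0 x1 y0 ym + bdint F x0 x1 ym y1.
Proof.
move=> y0m ym1 x01 Fd.
have y01 := le_trans y0m ym1.
have F0 : ccont_itv x0 x1 (F^~ y0) by apply: rect_diff1 Fd _; rewrite lexx.
have Fm : ccont_itv x0 x1 (F^~ ym) by apply: rect_diff1 Fd _; rewrite y0m.
have F1 : ccont_itv x0 x1 (F^~ y1) by apply: rect_diff1 Fd _; rewrite lexx andbT.
rewrite /bdint (cint_itv_split y0m ym1); last first.
  by apply: ccont_itvB; apply: rect_diff2 Fd _; rewrite lexx ?andbT.
rewrite (cintB F0 F1) (cintB F0 Fm) (cintB Fm F1); ring.
Qed.

(* Near [(s, t)] the affine part of [F] contributes nothing to [bdint]. *)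
Lemma bdint_small F a w b h s t al e : 0 <= w -> 0 <= h -> 0 <= e ->
  rect_diff F a (a + w) b (b + h) ->
  (forall x y, a <= x <= a + w -> b <= y <= b + h ->
     normc (F x y - F s t - al * ((x - s) +i* (y - t))) <= e * (w + h)) ->
  normc (bdint F a (a + w) b (b + h)) <= 4 * e * (w + h) ^+ 2.
Proof.
move=> w0 h0 e0 Fd Fe.
have aw : a <= a + w by rewrite lerDl.
have bh : b <= b + h by rewrite lerDl.
pose r x y := F x y - F s t - al * ((x - s) +i* (y - t)).
pose d1 x := F x b - F x (b + h) + al * h*i; pose d2 y := F (a + w) y - F a y - al * w%:C.
have c1 : ccont_itv a (a + w) (fun x => F x b - F x (b + h)).
  by apply: ccont_itvB; apply: rect_diff1 Fd _; rewrite lexx ?andbT.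
have c2 : ccont_itv b (b + h) (fun y => F (a + w) y - F a y).
  by apply: ccont_itvB; apply: rect_diff2 Fd _; rewrite lexx ?andbT.
have -> : bdint F a (a + w) b (b + h) = cint a (a + w) d1 + 'i%C * cint b (b + h) d2.
  rewrite /d1 /d2 cintD //; last by move=> *; apply: ccont_cst.
  rewrite (@cintB _ _ _ _ (fun=> al * w%:C)) //; last by move=> *; apply: ccont_cst.
  rewrite !cint_cst // /bdint !(addrAC _ w) !(addrAC _ h) !subrr !add0r.
  have -> : h*i = 'i%C * h%:C by simpc.
  ring.
have d1_le x : a <= x <= a + w -> normc (d1 x) <= 2 * (e * (w + h)).
  move=> xa; have -> : d1 x = r x b - r x (b + h).
    rewrite /d1 /r; have -> : h*i = ((x - s) +i* (b + h - t)) - ((x - s) +i* (b - t)).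
      by simpc; congr Complex; ring.
    ring.
  rewrite mulr_natl mulr2n; apply: le_trans (le_normcD _ _) _.
  by rewrite normcN lerD // Fe // lexx ?andbT.
have d2_le y : b <= y <= b + h -> normc (d2 y) <= 2 * (e * (w + h)).
  move=> yb; have -> : d2 y = r (a + w) y - r a y.
    rewrite /d2 /r; have -> : w%:C = ((a + w - s) +i* (y - t)) - ((a - s) +i* (y - t)).
      by simpc; congr Complex; ring.
    ring.
  rewrite mulr_natl mulr2n; apply: le_trans (le_normcD _ _) _.
  by rewrite normcN lerD // Fe // lexx ?andbT.
apply: le_trans (le_normcD _ _) _; rewrite normcM normci mul1r.
have -> : 4 * e * (w + h) ^+ 2 = 2 * (2 * (e * (w + h))) * (a + w - a) +
  2 * (2 * (e * (w + h))) * (b + h - b) by ring.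
rewrite lerD // cint_le // => t' t'ab.
  by apply: ccontD; [exact: c1 | exact: ccont_cst].
by apply: ccontD; [exact: c2 | exact: ccont_cst].
Qed.

(** The point is the supremum of the left endpoints, each of which lies below every right
    endpoint. *)
Lemma nested_point (a w : R) (s : nat -> R) : s 0 = a ->
  (forall n, s n <= s n.+1 /\ s n.+1 + w / 2 ^+ n.+1 <= s n + w / 2 ^+ n) -> 0 <= w ->
  exists p, forall n, s n <= p <= s n + w / 2 ^+ n.
Proof.
move=> s0 sn w0.
have wn n : 0 <= w / 2 ^+ n by rewrite divr_ge0 // exprn_ge0.
have up m n : (m <= n)%N -> s m <= s n.
  elim: n => [|n IH]; first by rewrite leqn0 => /eqP ->.
  rewrite leq_eqVlt => /predU1P[-> //|]; rewrite ltnS => /IH /le_trans; apply.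
  by case: (sn n).
have dn m n : (m <= n)%N -> s n + w / 2 ^+ n <= s m + w / 2 ^+ m.
  elim: n => [|n IH]; first by rewrite leqn0 => /eqP ->.
  rewrite leq_eqVlt => /predU1P[-> //|]; rewrite ltnS => /IH; apply: le_trans.
  by case: (sn n).
have cross m n : s m <= s n + w / 2 ^+ n.
  have [mn|/ltnW nm] := leqP m n.
    by rewrite (le_trans (up _ _ mn)) // lerDl.
  by rewrite (le_trans _ (dn _ _ nm)) // lerDl.
exists (sup (range s)) => n; apply/andP; split.
  apply: ub_le_sup; last by exists n.
  by exists (s 0 + w / 2 ^+ 0) => _ [m _ <-].
apply: ge_sup; first by exists (s 0); exists 0.
by move=> _ [m _ <-].
Qed.

Theorem goursat F a w b h : 0 <= w -> 0 <= h -> rect_diff F a (a + w) b (b + h) ->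
  bdint F a (a + w) b (b + h) = 0.
Proof.
move=> w0 h0 Fd; apply: eq0_normc; apply/eqP; rewrite eq_le normc_ge0 andbT.
apply/ler_addgt0Pr => e' e'0; rewrite add0r.
(* The added 1 keeps the denominator positive for a degenerate rectangle. *)
pose e := e' / (4 * ((w + h) ^+ 2 + 1)).
have K0 : 0 < 4 * ((w + h) ^+ 2 + 1) by rewrite mulr_gt0 // ltr_wpDl // sqr_ge0.
have e0 : 0 < e by rewrite divr_gt0.
suff : normc (bdint F a (a + w) b (b + h)) <= 4 * e * (w + h) ^+ 2.
  move/le_trans; apply; rewrite /e [leLHS](_ : _ =
    e' * ((4 * (w + h) ^+ 2) / (4 * ((w + h) ^+ 2 + 1)))); last by ring.
  by rewrite ler_piMr ?(ltW e'0) // ler_pdivrMr // mul1r ler_pM2l // lerDl.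
pose wn n := w / 2 ^+ n; pose hn n := h / 2 ^+ n.
have wn0 n : 0 <= wn n by rewrite divr_ge0 // exprn_ge0.
have hn0 n : 0 <= hn n by rewrite divr_ge0 // exprn_ge0.
have wnS n : wn n = wn n.+1 + wn n.+1 by rewrite /wn exprS; field.
have hnS n : hn n = hn n.+1 + hn n.+1 by rewrite /hn exprS; field.
(* The bound scales like the area: four small quarters make a small whole, so a bad rectangle has a
   bad quarter. *)
pose small n (p : R * R) := normc (bdint F p.1 (p.1 + wn n) p.2 (p.2 + hn n)) <=
  4 * e * (wn n + hn n) ^+ 2.
pose inside n (p : R * R) := [/\ a <= p.1, p.1 + wn n <= a + w, b <= p.2 & p.2 + hn n <= b + h].
pose sub n (p q : R * R) := [/\ p.1 <= q.1, q.1 + wn n.+1 <= p.1 + wn n,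
   p.2 <= q.2 & q.2 + hn n.+1 <= p.2 + hn n].
have rect_sub n p : inside n p -> rect_diff F p.1 (p.1 + wn n) p.2 (p.2 + hn n).
  move=> [pa pw pb ph] x y /andP[x1 x2] /andP[y1 y2]; apply: Fd.
    by rewrite (le_trans pa x1) (le_trans x2 pw).
  by rewrite (le_trans pb y1) (le_trans y2 ph).
have step n p : inside n p -> ~ small n p -> exists2 q, sub n p q & ~ small n.+1 q.
  move=> pin; apply: contra_notP => Nq.
  have qsmall q : sub n p q -> small n.+1 q.
    by move=> pq; apply: contrapT => ns; apply: Nq; exists q.
  have Fp := rect_sub _ _ pin; case: p pin Fp qsmall {Nq} => p1 p2 /= pin Fp qsmall.
  rewrite /small [(p1, p2).1]/= [(p1, p2).2]/=.
  have le1 : p1 <= p1 + wn n.+1 by rewrite lerDl.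
  have le2 : p1 + wn n.+1 <= p1 + wn n by rewrite lerD2l [wn n]wnS lerDl.
  have le3 : p2 <= p2 + hn n.+1 by rewrite lerDl.
  have le4 : p2 + hn n.+1 <= p2 + hn n by rewrite lerD2l [hn n]hnS lerDl.
  have q1 : normc (bdint F p1 (p1 + wn n.+1) p2 (p2 + hn n.+1)) <=
      4 * e * (wn n.+1 + hn n.+1) ^+ 2 by apply: (qsmall (p1, p2)).
  have q2 : normc (bdint F (p1 + wn n.+1) (p1 + wn n) p2 (p2 + hn n.+1)) <=
      4 * e * (wn n.+1 + hn n.+1) ^+ 2.
    by rewrite [wn n]wnS addrA; apply: (qsmall (p1 + wn n.+1, p2)); split=> //=; rewrite -addrA -wnS.
  have q3 : normc (bdint F p1 (p1 + wn n.+1) (p2 + hn n.+1) (p2 + hn n)) <=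
      4 * e * (wn n.+1 + hn n.+1) ^+ 2.
    by rewrite [hn n]hnS addrA; apply: (qsmall (p1, p2 + hn n.+1)); split=> //=; rewrite -addrA -hnS.
  have q4 : normc (bdint F (p1 + wn n.+1) (p1 + wn n) (p2 + hn n.+1) (p2 + hn n)) <=
      4 * e * (wn n.+1 + hn n.+1) ^+ 2.
    rewrite [wn n]wnS [hn n]hnS !addrA; apply: (qsmall (p1 + wn n.+1, p2 + hn n.+1)).
    by split=> //=; rewrite -addrA -?wnS -?hnS.
  rewrite (bdint_splitx le1 le2 (le_trans le3 le4) Fp).
  rewrite (bdint_splity le3 le4 le1); last first.
    by move=> x y /andP[x1 x2]; apply: Fp; rewrite x1 (le_trans x2).
  rewrite (bdint_splity le3 le4 le2); last first.
    by move=> x y /andP[x1 x2]; apply: Fp; rewrite x2 (le_trans le1).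
  have -> : 4 * e * (wn n + hn n) ^+ 2 =
     4 * e * (wn n.+1 + hn n.+1) ^+ 2 + 4 * e * (wn n.+1 + hn n.+1) ^+ 2 +
     (4 * e * (wn n.+1 + hn n.+1) ^+ 2 + 4 * e * (wn n.+1 + hn n.+1) ^+ 2).
    by rewrite [wn n]wnS [hn n]hnS; ring.
  by apply: le_trans (le_normcD _ _) _; rewrite lerD //;
    apply: le_trans (le_normcD _ _) _; rewrite lerD.
apply: contrapT => nsmall.
(* Along [s] the default value [p] is never taken: by [inv] every rectangle reached is bad. *)
pose next n (p : R * R) := xget p [set q | sub n p q /\ ~ small n.+1 q].
pose fix s n := if n is m.+1 then next m (s m) else (a, b).
have inv n : inside n (s n) /\ ~ small n (s n).
  elim: n => [|n [IHin IHs]].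
    by rewrite /inside /small /wn /hn expr0 !divr1.
  have [q q1 q2] := step _ _ IHin IHs.
  have [sq1 sq2] : sub n (s n) (s n.+1) /\ ~ small n.+1 (s n.+1).
    by rewrite /= /next; case: xgetP => [? -> //|/(_ q) []].
  split=> //; case: IHin => i1 i2 i3 i4; case: sq1 => j1 j2 j3 j4; split.
  - exact: le_trans j1.
  - exact: le_trans j2 i2.
  - exact: le_trans j3.
  - exact: le_trans j4 i4.
have subs n : sub n (s n) (s n.+1).
  have [q q1 q2] := step _ _ (inv n).1 (inv n).2.
  by rewrite /= /next; case: xgetP => [? -> [] //|/(_ q) []].
have [x xP] : exists p, forall n, (s n).1 <= p <= (s n).1 + wn n.
  by apply: (@nested_point a) => // n; have [] := subs n.
have [y yP] : exists p, forall n, (s n).2 <= p <= (s n).2 + hn n.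
  by apply: (@nested_point b) => // n; have [] := subs n.
have xy : rdiff F x y.
  apply: Fd; first by have := xP 0; rewrite /wn expr0 divr1.
  by have := yP 0; rewrite /hn expr0 divr1.
have [al /(_ _ e0) [d d0 dP]] := xy.
(* At this scale differentiability at the common point [(x, y)] makes the rectangle small by
   [bdint_small], a contradiction. *)
have [n nP] : exists n, w / 2 ^+ n + h / 2 ^+ n < d.
  have half1 : `|2^-1 : R| < 1 by rewrite ger0_norm // invf_lt1 // ltr1n.
  have e1 : 0 < d / (w + h + 1) by rewrite divr_gt0 // ltr_wpDl // addr_ge0.
  have := cvg_expr half1 => /cvgrPdist_lt /(_ _ e1) [N _ /(_ N (leqnn N))].
  rewrite sub0r normrN normrX ger0_norm // exprVn => HN; exists N.
  rewrite -mulrDl; move: HN; rewrite ltr_pdivlMr; last by rewrite ltr_wpDl // addr_ge0.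
  apply: le_lt_trans; rewrite mulrC ler_wpM2l ?invr_ge0 ?exprn_ge0 //.
  by rewrite lerDl.
have [_] := inv n; apply; apply: (@bdint_small _ _ _ _ _ x y al) => //.
- exact: ltW.
- by apply: rect_sub; case: (inv n).
move=> x' y' x'P y'P.
have wx : `|x' - x| <= wn n.
  rewrite ler_norml; have /andP[? ?] := xP n; move/andP: x'P => [? ?].
  by apply/andP; split; lra.
have hy : `|y' - y| <= hn n.
  rewrite ler_norml; have /andP[? ?] := yP n; move/andP: y'P => [? ?].
  by apply/andP; split; lra.
have := dP (x' - x) (y' - y); rewrite !subrKC => /(_ _ _)/le_trans; apply.
- by apply: le_lt_trans wx (le_lt_trans _ nP); rewrite lerDl; apply: hn0.
- by apply: le_lt_trans hy (le_lt_trans _ nP); rewrite lerDr; apply: wn0.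
by rewrite ler_pM2l // lerD.
Qed.

End Goursat.

Lemma derivable_eps (K : numFieldType) (f : K^o -> K^o) (x : K^o) : derivable f x 1 ->
  forall e : K, 0 < e -> exists2 d : K, 0 < d &
    forall h, `|h| < d -> `|f (x + h) - f x - 'D_1 f x * h| <= e * `|h|.
Proof.
move=> df e e0.
have /cvgrPdist_le /(_ e e0) [d /= d0 dP] : (fun h => h^-1 *: (f (h *: 1 + x) - f x)) @ 0^' --> 'D_1 f x.
  exact: df.
exists d => // h hd; have [->|h0] := eqVneq h 0; first by rewrite addr0 subrr mulr0 subr0 !normr0 mulr0.
have := dP h; rewrite /ball_ /= sub0r normrN => /(_ hd h0).
have -> : h^-1 *: (f (h *: 1 + x) - f x) = (f (x + h) - f x) / h.
  by rewrite -[LHS]/(h^-1 * (f (h * 1 + x) - f x)) mulr1 [h + x]addrC mulrC.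
rewrite distrC -(ler_pM2r (_ : 0 < `|h|)) ?normr_gt0 // -normrM mulrBl.
by rewrite mulfVK.
Qed.

(** * Logarithmic coordinates and circular means *)

Section Exponential.
Variable R : realType.
Notation C := R[i].
Import Normc.

Definition cexp (x y : R) : C := (expR x)%:C * (cos y +i* sin y).

Definition cdiff (f : C -> C) (w : C) := exists a : C, forall e : R, 0 < e ->
  exists2 d, 0 < d & forall h, normc h < d ->
    normc (f (w + h) - f w - a * h) <= e * normc h.

Lemma cdiff_differentiable (f : C -> C) (w : C) :
  differentiable (f : C^o -> C^o) (w : C^o) -> cdiff f w.
Proof.
move=> /diff_derivable df; exists ('D_1 (f : C^o -> C^o) (w : C^o)) => e e0.
have e0' : 0 < e%:C :> C by rewrite ltcR.
have [d d0 dP] := derivable_eps (df 1) e0'.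
have dE : d = (complex.Re d)%:C by rewrite RRe_real // gtr0_real.
exists (complex.Re d); first by rewrite -ltcR -dE.
move=> h hd; have := dP h; rewrite -lecR !norm_normc dE ltcR => /(_ hd).
by rewrite rmorphM.
Qed.

Lemma normc_cexp x y : normc (cexp x y) = expR x.
Proof.
rewrite /cexp normcM normcC ger0_norm ?expR_ge0 //= cos2Dsin2 sqrtr1 mulr1 //.
Qed.

Lemma cexpD x y u v : cexp (x + u) (y + v) = cexp x y * cexp u v.
Proof.
rewrite /cexp expRD cosD sinD; simpc; congr Complex; ring.
Qed.

Lemma cexp_eps0 (e : R) : 0 < e -> exists2 d, 0 < d & forall u v : R, `|u| < d -> `|v| < d ->
  normc (cexp u v - 1 - (u +i* v)) <= e * (`|u| + `|v|).
Proof.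
move=> e0.
(* The final estimate contains [e1 |v|] five times; [e1 <= 1] and [|u| < e1 / 2] keep [expR u] below
   2. *)
pose e1 := Num.min (e / 5) 1.
have e10 : 0 < e1 by rewrite lt_min divr_gt0 //= ltr01.
have e1e : e1 <= e / 5 by rewrite ge_min lexx.
have e11 : e1 <= 1 by rewrite ge_min lexx orbT.
have [d1 d10 d1P] := @derivable_eps R expR 0 (ltac:(exact: derivable_expR)) _ e10.
have [d2 d20 d2P] := @derivable_eps R cos 0 (ltac:(exact: derivable_cos)) _ e10.
have [d3 d30 d3P] := @derivable_eps R sin 0 (ltac:(exact: derivable_sin)) _ e10.
exists (Num.min (Num.min d1 d2) (Num.min d3 (e1 / 2))) => [|u v].
  by rewrite !lt_min d10 d20 d30 divr_gt0.
rewrite !lt_min => /andP[/andP[ud1 _] /andP[_ ue]] /andP[/andP[_ vd2] /andP[vd3 ve]].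
have D1 : 'D_1 (expR : R^o -> R^o) (0 : R^o) = 1.
  by rewrite -[RHS](@expR0 R); apply: derive_val.
have D2 : 'D_1 (cos : R^o -> R^o) (0 : R^o) = 0.
  by rewrite -[RHS]oppr0 -[X in - X](@sin0 R); apply: derive_val.
have D3 : 'D_1 (sin : R^o -> R^o) (0 : R^o) = 1.
  by rewrite -[RHS](@cos0 R); apply: derive_val.
have := d1P u ud1; rewrite D1 expR0 add0r mul1r => E1.
have := d2P v vd2; rewrite D2 mul0r subr0 cos0 add0r => E2.
have := d3P v vd3; rewrite D3 mul1r sin0 subr0 add0r => E3.
have E4 : `|expR u - 1| <= e1.
  rewrite -[X in `|X|](subrK u); apply: le_trans (ler_normD _ _) _.
  apply: (@le_trans _ _ (e1 * `|u| + `|u|)); first by rewrite lerD2r.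
  have : e1 * `|u| <= `|u| by rewrite ler_piMl.
  by move: ue; set a := `|u|; set b := e1 * a; lra.
have E5 : expR u <= 2 by move: E4; rewrite ler_norml; lra.
have u0 : 0 <= expR u by apply: expR_ge0.
apply: le_trans (normc_le_ReIm _) _.
rewrite /cexp /=; simpc.
have -> : expR u * cos v - 1 - u = expR u * (cos v - 1) + (expR u - 1 - u) by ring.
have -> : expR u * sin v - v = expR u * (sin v - v) + (expR u - 1) * v by ring.
apply: (@le_trans _ _ (2 * (e1 * `|v|) + e1 * `|u| + (2 * (e1 * `|v|) + e1 * `|v|))).
  rewrite lerD //; apply: le_trans (ler_normD _ _) _; rewrite lerD ?normrM //.
  - by rewrite ler_pM // ger0_norm.
  - by rewrite ler_pM // ger0_norm.
  - by rewrite ler_wpM2r.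
have := ler_wpM2r (normr_ge0 u) e1e; have := ler_wpM2r (normr_ge0 v) e1e.
have := mulr_ge0 (ltW e0) (normr_ge0 u); rewrite mulrDr.
set a := e1 * `|u|; set b := e1 * `|v|; set c := e * `|u|; set d := e * `|v|.
have -> : e / 5 * `|v| = d / 5 by rewrite /d; ring.
have -> : e / 5 * `|u| = c / 5 by rewrite /c; ring.
by lra.
Qed.

(** Pulls an annulus back to a rectangle, so that [goursat] applies with circles as vertical
    segments. *)
Lemma rdiff_comp (f : C -> C) x y : cdiff f (cexp x y) -> rdiff (fun x y => f (cexp x y)) x y.
Proof.
set E := cexp x y => -[a fa]; exists (a * E) => e e0.
rewrite -/E.
have E0 : 0 < normc E by rewrite normc_cexp expR_gt0.
have a0 := normc_ge0 a.
pose e1 := Num.min 1 (e / (2 * (normc a + 1) * normc E)).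
have K0 : 0 < 2 * (normc a + 1) * normc E by rewrite !mulr_gt0 // ltr_wpDl.
have e10 : 0 < e1 by rewrite lt_min ltr01 divr_gt0.
have e11 : e1 <= 1 by rewrite ge_min lexx.
have e1e : normc a * normc E * e1 <= e / 2.
  apply: (@le_trans _ _ (normc a * normc E * (e / (2 * (normc a + 1) * normc E)))).
    by rewrite ler_wpM2l ?mulr_ge0 ?normc_ge0 // ge_min lexx orbT.
  rewrite mulrA ler_pdivrMr // -subr_ge0 [X in 0 <= X](_ : _ = e * normc E); last by field.
  by rewrite mulr_ge0 ?ltW.
have [d1 d10 d1P] := cexp_eps0 e10.
pose e2 := e / (2 * (4 * normc E)).
have e20 : 0 < e2 by rewrite divr_gt0 ?mulr_gt0.
have [d2 d20 d2P] := fa _ e20.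
pose d := Num.min d1 (d2 / (8 * normc E)).
exists d => [|u v]; first by rewrite lt_min d10 divr_gt0 ?mulr_gt0.
rewrite !lt_min => /andP[ud1 ud2] /andP[vd1 vd2].
have H1 := d1P u v ud1 vd1.
pose k := cexp (x + u) (y + v) - E.
have kE : k = E * (u +i* v) + E * (cexp u v - 1 - (u +i* v)) by rewrite /k cexpD -/E; ring.
have kE' : E + k = cexp (x + u) (y + v) by rewrite /k subrKC.
clearbody k E.
set s := `|u| + `|v| in H1 *.
have s0 : 0 <= s by rewrite addr_ge0.
have uvs : normc (u +i* v) <= s by apply: normc_le_ReIm.
have k_le : normc k <= 2 * normc E * s.
  rewrite kE; apply: le_trans (le_normcD _ _) _; rewrite !normcM.
  have -> : 2 * normc E * s = normc E * s + normc E * (1 * s) by ring.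
  rewrite lerD // ler_wpM2l ?normc_ge0 //; apply: le_trans H1 _.
  by rewrite ler_wpM2r.
have kd2 : normc k < d2.
  apply: le_lt_trans k_le _.
  have sd : s < 2 * (d2 / (8 * normc E)) by rewrite /s; lra.
  have E20 : 0 < 2 * normc E by rewrite mulr_gt0.
  apply: (@lt_le_trans _ _ (2 * normc E * (2 * (d2 / (8 * normc E))))); first by rewrite ltr_pM2l.
  have -> : 2 * normc E * (2 * (d2 / (8 * normc E))) = d2 / 2 by field; rewrite gt_eqF.
  by rewrite ler_pdivrMr // ler_peMr ?ler1n // ltW.
have := d2P _ kd2; rewrite kE' => H2.
have -> : f (cexp (x + u) (y + v)) - f E - a * E * (u +i* v) =
   (f (cexp (x + u) (y + v)) - f E - a * k) + a * (E * (cexp u v - 1 - (u +i* v))).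
  by rewrite kE; ring.
apply: le_trans (le_normcD _ _) _; rewrite !normcM.
apply: (@le_trans _ _ (e2 * (2 * normc E * s) + normc a * (normc E * (e1 * s)))).
  rewrite lerD //; first by apply: le_trans H2 _; rewrite ler_wpM2l // ltW.
  by rewrite !ler_wpM2l ?normc_ge0.
have -> : e2 * (2 * normc E * s) = e / 4 * s by rewrite /e2; field; rewrite gt_eqF.
rewrite !mulrA -mulrDl ler_wpM2r //.
by move: e1e; set t := _ * e1; lra.
Qed.

Lemma cexp_period x : cexp x (pi *+ 2) = cexp x 0.
Proof. by rewrite /cexp cos2pi sin2pi cos0 sin0. Qed.

(** [2 pi] times the mean over the circle of radius [expR x]; it is not normalized. *)
Definition cmean (f : C -> C) x : C := cint 0 (pi *+ 2) (fun y => f (cexp x y)).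

Lemma pi2_gt0 : 0 < pi *+ 2 :> R.
Proof. by rewrite mulrn_wgt0 // pi_gt0. Qed.

(** In the rectangle of height [2 pi] the horizontal sides cancel by periodicity, so the two
    vertical sides agree. *)
Lemma cmean_const (f : C -> C) x0 x1 : x0 <= x1 ->
  (forall z, expR x0 <= normc z <= expR x1 -> cdiff f z) -> cmean f x0 = cmean f x1.
Proof.
move=> x01 df.
have Fd : rect_diff (fun x y => f (cexp x y)) x0 (x0 + (x1 - x0)) 0 (0 + pi *+ 2).
  move=> x y; rewrite subrKC => /andP[xx xx'] _; apply: rdiff_comp; apply: df.
  by rewrite normc_cexp !ler_expR xx xx'.
have w0 : 0 <= x1 - x0 by rewrite subr_ge0.
have := goursat w0 (ltW pi2_gt0) Fd; rewrite /bdint.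
rewrite add0r subrKC.
rewrite (@cint_ext _ _ _ (fun x => f (cexp x 0) - f (cexp x (pi *+ 2))) (fun=> 0)); last first.
  by move=> t _; rewrite cexp_period subrr.
rewrite (cint_cst _ x01) mulr0 add0r => /eqP.
have i0 : 'i%C != 0 :> C by rewrite eq_complex /= oner_eq0 andbF.
have Fd' : rect_diff (fun x y => f (cexp x y)) x0 x1 0 (pi *+ 2) by rewrite subrKC add0r in Fd.
have c0 := rect_diff2 Fd' (_ : x0 <= x0 <= x1); have c1 := rect_diff2 Fd' (_ : x0 <= x1 <= x1).
rewrite lexx x01 in c0; rewrite lexx x01 in c1.
rewrite mulf_eq0 (negPf i0) orFb (cintB (c1 isT) (c0 isT)) subr_eq0 => /eqP H.
by rewrite /cmean H.
Qed.

End Exponential.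

(** * Bounded holomorphic functions on the punctured disc *)

Section PuncturedDisc.
Variable R : realType.
Notation C := R[i].
Import Normc.

Definition ceps (f : C -> C) (w : C) := forall e : R, 0 < e ->
  exists2 d, 0 < d & forall h, normc h < d -> normc (f (w + h) - f w) <= e.

Lemma cdiff_ceps (f : C -> C) (w : C) : cdiff f w -> ceps f w.
Proof.
move=> [a fa] e e0; have [d d0 dP] := fa _ ltr01.
have a1 : 0 < normc a + 1 by rewrite ltr_wpDl ?normc_ge0.
exists (Num.min d (e / (normc a + 1))) => [|h]; first by rewrite lt_min d0 divr_gt0.
rewrite lt_min => /andP[hd he]; rewrite -[X in normc X](subrK (a * h)).
apply: le_trans (le_normcD _ _) _; rewrite normcM.
apply: (@le_trans _ _ ((normc a + 1) * normc h)); first by rewrite mulrDl addrC lerD2l dP.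
by move: he; rewrite ltr_pdivlMr // mulrC => /ltW.
Qed.

Lemma cdiff_id (w : C) : cdiff id w.
Proof.
exists 1 => e e0; exists 1 => // h _.
by rewrite mul1r (addrC w) addrK subrr normc0 mulr_ge0 ?normc_ge0 // ltW.
Qed.

Lemma cdiff_local (f g : C -> C) (w : C) : cdiff f w ->
  (exists2 d, 0 < d & forall h, normc h < d -> g (w + h) = f (w + h)) -> cdiff g w.
Proof.
move=> [a fa] [d d0 gf]; exists a => e e0; have [d' d'0 dP] := fa _ e0.
exists (Num.min d d') => [|h]; first by rewrite lt_min d0.
rewrite lt_min => /andP[hd hd']; rewrite gf // -[g w]/(g w).
have -> : g w = f w by rewrite -[w in LHS]addr0 gf ?addr0 // normc0.
exact: dP.
Qed.

Lemma ceps_ccont1 f x y : ceps f (cexp x y) -> ccont (fun t => f (cexp t y)) x.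
Proof.
move=> fc; apply: ccont_eps => e e0; have [d d0 dP] := fc _ e0.
have d20 : 0 < d / 2 by rewrite divr_gt0.
have [d' d'0 d'P] := rdiff_eps (rdiff_comp (cdiff_id (cexp x y))) d20.
exists d' => // u ud; have := d'P u 0 ud; rewrite normr0 addr0 => /(_ d'0) H.
rewrite -[cexp (x + u) y](subrKC (cexp x y)); apply: dP.
by apply: le_lt_trans H _; rewrite ltr_pdivrMr // ltr_pMr // ltr1n.
Qed.

Lemma ceps_ccont2 f x y : ceps f (cexp x y) -> ccont (fun t => f (cexp x t)) y.
Proof.
move=> fc; apply: ccont_eps => e e0; have [d d0 dP] := fc _ e0.
have d20 : 0 < d / 2 by rewrite divr_gt0.
have [d' d'0 d'P] := rdiff_eps (rdiff_comp (cdiff_id (cexp x y))) d20.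
exists d' => // u ud; have := d'P 0 u; rewrite normr0 addr0 => /(_ d'0 ud) H.
rewrite -[cexp x (y + u)](subrKC (cexp x y)); apply: dP.
by apply: le_lt_trans H _; rewrite ltr_pdivrMr // ltr_pMr // ltr1n.
Qed.

Lemma cmean_le f x M : (forall z, normc z = expR x -> ceps f z) ->
  (forall z, normc z = expR x -> normc (f z) <= M) ->
  normc (cmean f x) <= 2 * M * (pi *+ 2).
Proof.
move=> fc fM; have := @cint_le R 0 (pi *+ 2) M (fun y => f (cexp x y)) (ltW (pi2_gt0 R)).
rewrite subr0; apply.
  by move=> t _; apply: ceps_ccont2; apply: fc; rewrite normc_cexp.
by move=> t _; apply: fM; rewrite normc_cexp.
Qed.

Lemma cmean_continuous f u v B :
  (forall z, expR u < normc z < expR v -> ceps f z /\ normc (f z) <= B) ->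
  forall x, u < x < v -> ccont (cmean f) x.
Proof.
move=> fuv x xuv.
have xI : x \in [set` `]u, v[] by rewrite inE /= in_itv.
have mI : measurable (`[0, pi *+ 2]%classic : set R) by [].
have fz t y : u < t < v -> ceps f (cexp t y) /\ normc (f (cexp t y)) <= B.
  by move=> /andP[ut tv]; apply: fuv; rewrite normc_cexp !ltr_expR ut.
have int_t t : u < t < v -> ccont_itv 0 (pi *+ 2) (fun y => f (cexp t y)).
  by move=> tuv y _; apply: ceps_ccont2; have [] := fz t y tuv.
have Bint : (@lebesgue_measure R).-integrable `[0, pi *+ 2] (EFin \o (fun=> B)).
  by apply: continuous_compact_integrable; [exact: segment_compact | move=> ?; apply: cst_continuous].
split.
- apply: (@continuity_under_integral R _ _ (@lebesgue_measure R)
    (fun t y => complex.Re (f (cexp t y))) `[0, pi *+ 2]%classic mI u v _ _ (fun=> B)) => //.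
  + by move=> t; rewrite /= in_itv /= => /int_t /ccont_itv_integrable [].
  + apply/aeW => y _ t; rewrite inE /= in_itv /= => tuv.
    by have [/ceps_ccont1 []] := fz t y tuv.
  + move=> t; rewrite /= in_itv /= => tuv; apply/aeW => y _.
    by apply: le_trans (Re_le_normc _) _; have [] := fz t y tuv.
- apply: (@continuity_under_integral R _ _ (@lebesgue_measure R)
    (fun t y => complex.Im (f (cexp t y))) `[0, pi *+ 2]%classic mI u v _ _ (fun=> B)) => //.
  + by move=> t; rewrite /= in_itv /= => /int_t /ccont_itv_integrable [].
  + apply/aeW => y _ t; rewrite inE /= in_itv /= => tuv.
    by have [/ceps_ccont1 []] := fz t y tuv.
  + move=> t; rewrite /= in_itv /= => tuv; apply/aeW => y _.
    by apply: le_trans (Im_le_normc _) _; have [] := fz t y tuv.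
Qed.

Lemma ccont_limit (m : R -> C) x c : ccont m x ->
  (forall d, 0 < d -> exists2 t, `|t - x| < d & m t = c) -> m x = c.
Proof.
move=> [/cvgrPdist_lt cRe /cvgrPdist_lt cIm] mc.
have eqr (a b : R) : (forall e, 0 < e -> `|a - b| < e) -> a = b.
  move=> ab; apply/eqP; rewrite -subr_eq0 -normr_eq0 eq_le normr_ge0 andbT.
  by apply/ler_addgt0Pr => e e0; rewrite add0r ltW // ab.
suff [H1 H2] : complex.Re (m x) = complex.Re c /\ complex.Im (m x) = complex.Im c.
  by rewrite [LHS]complexE [RHS]complexE H1 H2.
split; apply: eqr => e e0.
  have [d /= d0 dP] := cRe _ e0; have [t td <-] := mc _ d0.
  by apply: dP; rewrite /ball_ /= distrC.
have [d /= d0 dP] := cIm _ e0; have [t td <-] := mc _ d0.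
by apply: dP; rewrite /ball_ /= distrC.
Qed.

(* Removing one exceptional point [w] at which [f] is merely continuous; the
   mean is locally constant off [ln |w|], continuous, and tends to 0. *)
Lemma cmean_eq0 f w B : 0 < normc w < 1 ->
  (forall z, 0 < normc z < 1 -> z != w -> cdiff f z) -> ceps f w ->
  (forall z, 0 < normc z < 1 -> normc (f z) <= B * normc z) ->
  forall x, x < 0 -> cmean f x = 0.
Proof.
move=> /andP[w0 w1] fd fw fB.
have z01 (z : C) x : normc z <= expR x -> x < 0 -> normc z < 1.
  by move=> zx x0; apply: le_lt_trans zx _; rewrite -expR0 ltr_expR.
have fceps z : 0 < normc z < 1 -> ceps f z.
  by move=> z1; have [->//|zw] := eqVneq z w; apply/cdiff_ceps/fd.
have B0 : 0 <= B.
  have := fB w; rewrite w0 w1 => /(_ isT) /(le_trans (normc_ge0 _)).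
  by rewrite pmulr_lge0.
pose xw := ln (normc w).
have xwE : expR xw = normc w by rewrite lnK // posrE.
have xw0 : xw < 0 by rewrite -ltr_expR xwE expR0.
have below x : x < xw -> cmean f x = 0.
  move=> xxw; apply: eq0_normc; apply/eqP; rewrite eq_le normc_ge0 andbT.
  apply/ler_addgt0Pr => e e0; rewrite add0r.
  have K0 : 0 < 2 * (B + 1) * (pi *+ 2) by rewrite !mulr_gt0 ?pi2_gt0 // ltr_wpDl.
  (* A circle small enough for the bound [B |z|] to make its mean at most [e]; the mean at [x] is
     the same. *)
  pose t := Num.min x (ln (e / (2 * (B + 1) * (pi *+ 2)))).
  have tx : t <= x by rewrite ge_min lexx.
  have te : expR t <= e / (2 * (B + 1) * (pi *+ 2)).
    rewrite -[leRHS]lnK ?posrE ?divr_gt0 // ler_expR ge_min lexx orbT //.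
  rewrite -(@cmean_const _ _ t) //; last first.
    move=> z /andP[tz zx]; apply: fd.
      rewrite (lt_le_trans (expR_gt0 t) tz) (le_lt_trans zx) //.
      by rewrite -expR0 ltr_expR (lt_trans xxw).
    apply: contraTneq zx => ->; rewrite -ltNge -xwE ltr_expR //.
  have zt (z : C) : normc z = expR t -> 0 < normc z < 1.
    move=> ->; rewrite expR_gt0 -expR0 ltr_expR.
    by rewrite (le_lt_trans tx) // (lt_trans xxw).
  apply: le_trans (@cmean_le _ _ (B * expR t) _ _) _.
  - by move=> z /zt; apply: fceps.
  - by move=> z zE; rewrite -zE; apply/fB/zt.
  apply: (@le_trans _ _ (2 * (B + 1) * (pi *+ 2) * expR t)).
    rewrite -subr_ge0 [X in 0 <= X](_ : _ = 2 * (pi *+ 2) * expR t); last by ring.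
    by rewrite !mulr_ge0 ?expR_ge0 // ltW // pi2_gt0.
  by rewrite mulrC -ler_pdivlMr.
have cont x : x < 0 -> ccont (cmean f) x.
  move=> x0; apply: (@cmean_continuous f (x - 1) 0 B); last by rewrite x0 ltrBlDr ltrDl ltr01.
  move=> z /andP[z1 z2]; have z3 : 0 < normc z < 1.
    by rewrite (lt_trans (expR_gt0 _) z1) -expR0.
  split; first exact: fceps.
  apply: le_trans (fB z z3) _; rewrite ler_piMr //.
  by case/andP: z3 => _ /ltW.
have atxw : cmean f xw = 0.
  apply: ccont_limit (cont _ xw0) _ => d d0; exists (xw - d / 2).
    rewrite addrAC subrr add0r normrN ger0_norm ?divr_ge0 ?(ltW d0) //.
    by rewrite ltr_pdivrMr // ltr_pMr // ltr1n.
  by apply: below; rewrite ltrBlDr ltrDl divr_gt0.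
move=> x x0; have [/below //|xwx|-> //] := ltgtP x xw.
rewrite -atxw; apply/esym; apply: ccont_limit (cont _ xw0) _ => d d0.
exists (Num.min (xw + d / 2) x).
  have : xw <= Num.min (xw + d / 2) x by rewrite le_min (ltW xwx) andbT lerDl divr_ge0 // ltW.
  rewrite -subr_ge0 => /ger0_norm ->; rewrite ltrBlDr gt_min; apply/orP; left.
  by rewrite addrC ltrD2r ltr_pdivrMr // ltr_pMr // ltr1n.
apply: cmean_const; first by rewrite ge_min lexx orbT.
move=> z /andP[z1 z2].
have xwz : normc w < normc z.
  apply: lt_le_trans z1; rewrite -xwE ltr_expR lt_min xwx andbT ltrDl divr_gt0 //.
apply: fd; first by rewrite (lt_trans w0 xwz) (z01 _ _ z2).
by apply: contraTneq xwz => ->; rewrite ltxx.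
Qed.

End PuncturedDisc.

Lemma differentiable_id (K : numFieldType) (x : K^o) : differentiable (fun y : K^o => y) x.
Proof. by apply/derivable1_diffP; exact: derivable_id. Qed.

Lemma differentiable_expr (K : numFieldType) (V : normedModType K) (f : V -> K) n x :
  differentiable f x -> differentiable (fun y => f y ^+ n) x.
Proof.
move=> df; elim: n => [|n IH].
  by under eq_fun do rewrite expr0; apply: differentiable_cst.
by under eq_fun do rewrite exprS; apply: differentiableM.
Qed.

(** * Taylor polynomials of a bounded function on the punctured disc *)

Section TaylorPolynomial.
Variable R : realType.
Notation C := R[i].
Import Normc.
Variables (f : C -> C) (M : R).
Hypothesis f_diff : forall z : C, 0 < normc z < 1 -> differentiable (f : C^o -> C^o) (z : C^o).
Hypothesis f_le : forall z, 0 < normc z < 1 -> normc (f z) <= M.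

Lemma normc_neq0 (z : C) : 0 < normc z -> z != 0.
Proof. by move=> z0; apply: contraTneq z0 => ->; rewrite normc0 ltxx. Qed.

Lemma normc_gt0 (z : C) : z != 0 -> 0 < normc z.
Proof. by rewrite -normr_gt0 norm_normc ltcR. Qed.

Lemma normcX (z : C) n : normc (z ^+ n) = normc z ^+ n.
Proof. by elim: n => [|n IH]; rewrite ?expr0 ?normc1 // !exprS normcM IH. Qed.

(** The factor [z] is the one in [dz = i z dy], so the circular mean is a contour integral of the
    difference quotient up to [i]. It also makes the function [O(|z|)] at 0, as [cmean_eq0]
    requires. *)
Definition dquot w a (z : C) : C := if z == w then w * a else z * ((f z - f w) / (z - w)).

Lemma cmean_dquot w : 0 < normc w < 1 -> exists a, forall x, x < 0 ->
  cmean (dquot w a) x = 0.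
Proof.
move=> w01; have /andP[w0 w1] := w01.
have M0 : 0 <= M by apply: le_trans (normc_ge0 _) (f_le w01).
have [a fa] := cdiff_differentiable (f_diff w01).
have [d d0 dP] := fa _ ltr01.
(* The derivative [a] makes [dquot] continuous at [w]. The quotient is at most [|a| + 1] within
   distance [d] of [w] and at most [2 M / d] beyond. *)
exists a; apply: (@cmean_eq0 _ _ w (normc a + 1 + 2 * M / d)) => // [z z01 zw|e e0|z z01].
- apply: (@cdiff_local _ (fun z => z * ((f z - f w) / (z - w)))).
    apply: cdiff_differentiable; apply: differentiableM; first exact: differentiable_id.
    apply: differentiableM.
      by apply: differentiableB; [exact: f_diff | exact: differentiable_cst].
    apply: differentiableV; last by rewrite subr_eq0.
    by apply: differentiableB; [exact: differentiable_id | exact: differentiable_cst].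
  exists (normc (z - w)); first by rewrite normc_gt0 // subr_eq0.
  move=> h hzw; rewrite /dquot; case: eqP => // zh; move: hzw.
  have -> : z - w = - h by rewrite -zh; ring.
  by rewrite normcN ltxx.
- have a1 : 0 < normc a + 1 by rewrite ltr_wpDl ?normc_ge0.
  have e2 : 0 < e / 2 by rewrite divr_gt0.
  have [d1 d10 d1P] := fa _ e2.
  pose d2 := Num.min (Num.min d1 (1 - normc w)) (e / (2 * (normc a + 1))).
  exists d2 => [|h]; first by rewrite !lt_min d10 subr_gt0 w1 divr_gt0 ?mulr_gt0.
  rewrite !lt_min => /andP[/andP[hd1 hw] he].
  have [->|h0] := eqVneq h 0; first by rewrite addr0 subrr normc0 ltW.
  rewrite /dquot eqxx; case: eqP => [/eqP|_].
    by rewrite -subr_eq0 addrAC subrr add0r (negPf h0).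
  have hh : w + h - w = h by ring.
  rewrite hh.
  have -> : (w + h) * ((f (w + h) - f w) / h) - w * a =
      h * a + (w + h) * ((f (w + h) - f w - a * h) / h) by field.
  apply: le_trans (le_normcD _ _) _; rewrite !normcM normcV.
  have hn0 : 0 < normc h by apply: normc_gt0.
  have -> : e = e / 2 + e / 2 by field.
  apply: lerD.
    apply: (@le_trans _ _ (normc h * (normc a + 1))); first by rewrite ler_wpM2l ?normc_ge0 // lerDl.
    rewrite -ler_pdivlMr //; apply: le_trans (ltW he) _.
    by rewrite le_eqVlt; apply/orP; left; apply/eqP; field; rewrite gt_eqF.
  rewrite -[leRHS]mul1r ler_pM ?normc_ge0 //.
  + by rewrite divr_ge0 ?normc_ge0.
  + apply: le_trans (le_normcD _ _) _; move: hw; lra.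
  + by rewrite ler_pdivrMr // d1P.
- have /andP[z0 z1] := z01.
  have Md : 0 <= 2 * M / d by rewrite divr_ge0 ?mulr_ge0 // ltW.
  have a0 := normc_ge0 a.
  rewrite /dquot; case: eqP => [->|/eqP zw].
    by rewrite normcM mulrC ler_wpM2r ?normc_ge0 //; lra.
  rewrite normcM mulrC ler_wpM2r ?normc_ge0 // normcM normcV.
  have zw0 : 0 < normc (z - w) by rewrite normc_gt0 // subr_eq0.
  have [zd|zd] := ltP (normc (z - w)) d.
    have := dP _ zd; rewrite subrKC mul1r => H.
    rewrite ler_pdivrMr //.
    have : normc (f z - f w) <= (normc a + 1) * normc (z - w).
      rewrite -[f z - f w](subrK (a * (z - w))).
      apply: le_trans (le_normcD _ _) _.
      by rewrite mulrDl mul1r addrC normcM lerD2l.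
    move/le_trans; apply; rewrite ler_wpM2r ?normc_ge0 //; lra.
  apply: (@le_trans _ _ (2 * M / d)); last by lra.
  rewrite ler_pM ?normc_ge0 ?invr_ge0 ?normc_ge0 //.
    by apply: le_trans (le_normcD _ _) _; rewrite normcN mulr_natl mulr2n lerD // f_le.
  by rewrite lef_pV2 // posrE.
Qed.

Lemma geometric_remainder (w z : C) N : z != 0 -> z != w ->
  z / (z - w) = \sum_(n < N) w ^+ n / z ^+ n + (w / z) ^+ N * (z / (z - w)).
Proof.
move=> z0 zw; elim: N => [|N IH]; first by rewrite big_ord0 add0r expr0 mul1r.
rewrite big_ord_recr /= {1}IH -!addrA; congr (_ + _).
rewrite -expr_div_n exprSr; field.
by rewrite z0 subr_eq0 zw.
Qed.

(** By homogeneity the mean scales with the radius to the power [-n], but it does not depend on the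
    radius. *)
Lemma cmean_inv_expr (x : R) n : (0 < n)%N -> cmean (fun z : C => (z ^+ n)^-1) x = 0.
Proof.
move=> n0.
have cexpE t y : ((cexp t y) ^+ n)^-1 = ((expR t)^-1 ^+ n)%:C * ((cexp 0 y) ^+ n)^-1.
  rewrite [cexp t y](_ : _ = (expR t)%:C * cexp 0 y); last by rewrite /cexp expR0 mul1r.
  by rewrite exprMn invfM -rmorphXn -fmorphV exprVn.
have cd z : z != 0 -> cdiff (fun z : C => (z ^+ n)^-1) z.
  move=> z0; apply: cdiff_differentiable; apply: differentiableV.
    by apply: differentiable_expr; exact: differentiable_id.
  by rewrite expf_eq0 (negPf z0) andbF.
have meanE t : cmean (fun z : C => (z ^+ n)^-1) t = ((expR t)^-1 ^+ n)%:C * cmean (fun z : C => (z ^+ n)^-1) 0.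
  rewrite /cmean -cintZ.
    by apply: cint_ext => y _; rewrite cexpE.
  move=> y _; apply: (@ceps_ccont2 _ (fun z : C => (z ^+ n)^-1)); apply/cdiff_ceps/cd.
  by apply: normc_neq0; rewrite normc_cexp expR_gt0.
suff c0 : cmean (fun z : C => (z ^+ n)^-1) 0 = 0 by rewrite meanE c0 mulr0.
have c1 : cmean (fun z : C => (z ^+ n)^-1) 0 = cmean (fun z : C => (z ^+ n)^-1) 1.
  apply: cmean_const => // z /andP[z1 _]; apply: cd; apply: normc_neq0.
  by apply: lt_le_trans z1; apply: expR_gt0.
move: c1; rewrite [RHS]meanE => /eqP; rewrite -subr_eq0.
rewrite -{1}[cmean _ 0]mul1r -mulrBl mulf_eq0 => /orP[|/eqP //].
rewrite subr_eq0 -[1]/(1%:C) (inj_eq (@complexI R)) => /eqP e1.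
have : (expR 1 : R)^-1 ^+ n < 1.
  rewrite exprn_ilt1 ?invr_ge0 ?expR_ge0 //; first by rewrite -lt0n.
  by rewrite invf_lt1 ?expR_gt0 // -expR0 ltr_expR.
by rewrite -e1 ltxx.
Qed.

(** Cauchy's formula in the form that the mean of [dquot] vanishes, with [z / (z - w)] expanded as a
    geometric sum. The constant is 2 from [cint_le] times 2 from [|f z - f w| <= 2 M]; the
    coefficients depend neither on [w] nor on [N]. *)
Theorem taylor_approx r : 0 < r < 1 -> exists p : nat -> C, forall N w, (0 < N)%N ->
  0 < normc w < r ->
  normc (f w - \sum_(n < N) p n * w ^+ n) <= 4 * M * (normc w / r) ^+ N / (r - normc w).
Proof.
move=> /andP[r0 r1].
pose x := ln r; have xE : expR x = r by rewrite lnK // posrE.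
have x0 : x < 0 by rewrite -ltr_expR xE expR0.
pose P2 : C := (pi *+ 2)%:C.
have P20 : P2 != 0 by rewrite -[0]/(0%:C) (inj_eq (@complexI R)) gt_eqF // pi2_gt0.
exists (fun n => P2^-1 * cmean (fun z => f z * (z ^+ n)^-1) x) => N w N0 /andP[w0 wr].
have w01 : 0 < normc w < 1 by rewrite w0 (lt_trans wr).
have M0 : 0 <= M by apply: le_trans (normc_ge0 _) (f_le w01).
have [a /(_ x x0) qa] := cmean_dquot w01.
(* On the circle, [dquot] is the sum of the [g n] for [n < N] and of the tail [rem]. *)
pose g n (z : C) := w ^+ n * (f z * (z ^+ n)^-1) - f w * w ^+ n * (z ^+ n)^-1.
pose rem (z : C) := (f z - f w) * ((w / z) ^+ N * (z / (z - w))).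
have on_circle z : normc z = expR x -> [/\ 0 < normc z < 1, z != 0 & z != w].
  rewrite xE => zr; rewrite zr r0 r1; split=> //; first by apply: normc_neq0; rewrite zr.
  by apply: contraTneq wr => <-; rewrite zr ltxx.
have fzn n z : 0 < normc z < 1 -> cdiff (fun z => f z * (z ^+ n)^-1) z.
  move=> z01; apply: cdiff_differentiable; apply: differentiableM; first exact: f_diff.
  apply: differentiableV; first by apply: differentiable_expr; exact: differentiable_id.
  by rewrite expf_eq0 (negPf (normc_neq0 _)) ?andbF //; case/andP: z01.
have zn n (z : C) : z != 0 -> cdiff (fun z => (z ^+ n)^-1) z.
  move=> z0; apply: cdiff_differentiable.
  apply: differentiableV; first by apply: differentiable_expr; exact: differentiable_id.
  by rewrite expf_eq0 (negPf z0) andbF.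
have remd z : normc z = expR x -> cdiff rem z.
  move=> /on_circle[z01 z0 zw]; apply: cdiff_differentiable; apply: differentiableM.
    by apply: differentiableB; [exact: f_diff | exact: differentiable_cst].
  apply: differentiableM.
    apply: differentiable_expr; apply: differentiableM; first exact: differentiable_cst.
    by apply: differentiableV => //; exact: differentiable_id.
  apply: differentiableM; first exact: differentiable_id.
  apply: differentiableV; last by rewrite subr_eq0.
  by apply: differentiableB; [exact: differentiable_id | exact: differentiable_cst].
have circ (h : C -> C) : (forall z, normc z = expR x -> cdiff h z) ->
    ccont_itv 0 (pi *+ 2) (fun y => h (cexp x y)).
  by move=> hd y _; apply/ceps_ccont2/cdiff_ceps/hd; rewrite normc_cexp.
have fznc n : ccont_itv 0 (pi *+ 2) (fun y => f (cexp x y) * (cexp x y ^+ n)^-1).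
  by apply: (circ (fun z => f z * (z ^+ n)^-1)) => z /on_circle[z01 _ _]; apply: fzn.
have znc n : ccont_itv 0 (pi *+ 2) (fun y => (cexp x y ^+ n)^-1).
  by apply: (circ (fun z => (z ^+ n)^-1)) => z /on_circle[_ z0 _]; apply: zn.
have remc := circ _ remd.
have meang n : cmean (g n) x = w ^+ n * cmean (fun z => f z * (z ^+ n)^-1) x
    - f w * w ^+ n * cmean (fun z => (z ^+ n)^-1) x.
  rewrite /cmean -cintZ; last exact: znc.
  rewrite -cintZ; last exact: fznc.
  rewrite -cintB //.
    by move=> y H; apply: ccontM; [exact: ccont_cst | exact: fznc].
  by move=> y H; apply: ccontM; [exact: ccont_cst | exact: znc].
have gc n : ccont_itv 0 (pi *+ 2) (fun y => g n (cexp x y)).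
  move=> y H; apply: ccontD; first by apply: ccontM; [exact: ccont_cst | exact: fznc].
  by apply: ccontN; apply: ccontM; [exact: ccont_cst | exact: znc].
have mean0 : \sum_(n < N) cmean (g n) x + cmean rem x = 0.
  have -> : \sum_(n < N) cmean (g n) x = cint 0 (pi *+ 2) (fun y => \sum_(n < N) g n (cexp x y)).
    by rewrite (cint_sum _ (ltW (pi2_gt0 R)) (fun n : 'I_N => gc n)).
  have sumc : ccont_itv 0 (pi *+ 2) (fun y => \sum_(n < N) g n (cexp x y)).
    by move=> y H; apply: ccont_sum => i; apply: gc.
  rewrite -[RHS]qa /cmean -(cintD sumc remc).
  apply: cint_ext => y _.
  have [z01 z0 zw] := on_circle _ (normc_cexp x y).
  rewrite /dquot (negPf zw) /g /rem; move: (cexp x y) z0 zw {z01} => z z0 zw.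
  have -> : z * ((f z - f w) / (z - w)) = (f z - f w) * (z / (z - w)) by ring.
  rewrite [in RHS](geometric_remainder N z0 zw) mulrDr; congr (_ + _).
  by rewrite mulr_sumr; apply: eq_bigr => i _; ring.
have mean_rem : normc (cmean rem x) <= 4 * M * (normc w / r) ^+ N / (r - normc w) * (pi *+ 2).
  have -> : 4 * M * (normc w / r) ^+ N / (r - normc w) * (pi *+ 2) =
    2 * ((2 * M) * ((normc w / r) ^+ N * (1 / (r - normc w)))) * (pi *+ 2) by ring.
  apply: cmean_le; first by move=> z zx; apply/cdiff_ceps/remd.
  move=> z zx; have [z01 z0 zw] := on_circle _ zx.
  rewrite xE in zx; rewrite /rem !normcM normcX normcM !normcV zx.
  have rw : 0 < r - normc w by rewrite subr_gt0.
  have zwr : r - normc w <= normc (z - w).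
    rewrite lerBlDr -zx -{1}[z](subrK w); exact: le_normcD.
  rewrite ler_pM ?normc_ge0 ?mulr_ge0 ?exprn_ge0 ?divr_ge0 ?invr_ge0 ?normc_ge0 ?(ltW r0) //.
    by apply: le_trans (le_normcD _ _) _; rewrite normcN mulr_natl mulr2n lerD // f_le.
  rewrite ler_wpM2l ?exprn_ge0 ?divr_ge0 ?normc_ge0 ?(ltW r0) //.
  rewrite ler_pM ?invr_ge0 ?normc_ge0 ?(ltW r0) ?(ltW r1) //.
  by rewrite lef_pV2 ?posrE // (lt_le_trans rw).
have sumg : \sum_(n < N) cmean (g n) x =
    P2 * (\sum_(n < N) P2^-1 * cmean (fun z => f z * (z ^+ n)^-1) x * w ^+ n - f w).
  rewrite mulrBr mulr_sumr (eq_bigr (fun n : 'I_N => w ^+ n * cmean (fun z => f z * (z ^+ n)^-1) x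
      - f w * w ^+ n * cmean (fun z => (z ^+ n)^-1) x)) => [|n _]; last exact: meang.
  rewrite sumrB; congr (_ - _).
    by apply: eq_bigr => n _; rewrite !mulrA mulfV // mul1r mulrC.
  (* Among the terms with [f w] only [n = 0] has a nonzero mean; [0 < N] guarantees that it is
     present. *)
  case: N N0 {rem remd remc mean0 mean_rem} => // N _.
  rewrite big_ord_recl big1 ?addr0 => [|n _]; last by rewrite cmean_inv_expr ?mulr0.
  rewrite expr0 mulr1 mulrC; congr (_ * _).
  rewrite /cmean (@cint_ext _ _ _ _ (fun=> 1)); last by move=> t _; rewrite expr0 invr1.
  by rewrite cint_cst ?(ltW (pi2_gt0 R)) // subr0 mulr1.
rewrite normcB -(ler_pM2r (pi2_gt0 R)).
apply: le_trans mean_rem.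
have -> : cmean rem x = - (P2 * (\sum_(n < N) P2^-1 * cmean (fun z => f z * (z ^+ n)^-1) x * w ^+ n - f w)).
  by rewrite -sumg; apply/eqP; rewrite -addr_eq0 addrC mean0.
by rewrite normcN normcM /P2 normcC ger0_norm ?(ltW (pi2_gt0 R)) // mulrC.
Qed.

End TaylorPolynomial.

(** * Interpolation at roots of unity *)

Section RootsOfUnity.
Variables (R : realType).
Notation C := R[i].
Import Normc.

Lemma primitive_root_exists N : (0 < N)%N -> exists z : C, N.-primitive_root z.
Proof.
move=> N0; pose p : {poly C} := 'X^N - 1.
have [s Dp] := closed_field_poly_normal p.
rewrite (monicP _) ?monicXnsubC // scale1r in Dp.
have sN : all N.-unity_root s by apply/allP=> z; rewrite -root_prod_XsubC -Dp.
have sz : (N < (size s).+1)%N by rewrite -(size_prod_XsubC s id) -Dp size_XnsubC.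
have [|z] := hasP (has_prim_root N0 sN _ sz); last by exists z.
rewrite -separable_prod_XsubC -Dp separable_Xn_sub_1 //.
by rewrite pnatr_eq0 -lt0n.
Qed.

Lemma sum_root_of_unity (x : C) N : x ^+ N = 1 -> x != 1 -> \sum_(k < N) x ^+ k = 0.
Proof.
move=> xN x1; have := subrX1 x N; rewrite xN subrr => /esym/eqP.
by rewrite mulf_eq0 subr_eq0 (negPf x1) => /eqP.
Qed.

Lemma normc_sum I (s : seq I) (F : I -> C) : normc (\sum_(i <- s) F i) <= \sum_(i <- s) normc (F i).
Proof.
elim: s => [|i s IH]; first by rewrite !big_nil normc0.
by rewrite !big_cons; apply: le_trans (le_normcD _ _) _; rewrite lerD2l.
Qed.

Section Interpolation.
Variables (N : nat) (zeta : C) (rho : R).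
Hypothesis N_gt0 : (0 < N)%N.
Hypothesis zetaP : N.-primitive_root zeta.
Hypothesis rho_gt0 : 0 < rho.

Definition node k : C := rho%:C * zeta ^+ k.

(** The Lagrange basis polynomial at the scaled roots of unity, as a geometric sum, which shows at
    once that it is at most 1 on the disc of radius [rho]. *)
Definition lagrange k (w : C) : C := N%:R^-1 * \sum_(n < N) (w / node k) ^+ n.

Lemma normc_unity (x : C) : x ^+ N = 1 -> normc x = 1.
Proof.
move=> xN; apply: (pexpIrn N_gt0); rewrite ?nnegrE ?normc_ge0 ?ler01 //=.
by rewrite -normcX xN normc1 expr1n.
Qed.

Lemma normc_zetaX k : normc (zeta ^+ k) = 1.
Proof. by apply: normc_unity; rewrite exprAC (prim_expr_order zetaP) expr1n. Qed.

Lemma normc_node k : normc (node k) = rho.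
Proof. by rewrite /node normcM normcC normc_zetaX mulr1 ger0_norm // ltW. Qed.

Lemma zeta_neq0 : zeta != 0.
Proof. by apply: normc_neq0; rewrite -[zeta]expr1 normc_zetaX. Qed.

Lemma rhoC_neq0 : rho%:C != 0 :> C.
Proof. by rewrite -[0]/(0%:C) (inj_eq (@complexI R)) gt_eqF. Qed.

Lemma lagrange_le1 k w : normc w <= rho -> normc (lagrange k w) <= 1.
Proof.
move=> wr; rewrite /lagrange normcM normcV.
have -> : normc (N%:R : C) = N%:R by rewrite -(rmorph_nat (real_complex R)) normcC ger0_norm.
rewrite mulrC ler_pdivrMr ?ltr0n // mul1r; apply: le_trans (normc_sum _ _) _.
apply: (@le_trans _ _ (\sum_(n < N) 1)); last by rewrite sumr_const card_ord.
apply: ler_sum => n _; rewrite normcX normcM normcV normc_node exprn_ile1 //.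
  by rewrite divr_ge0 ?normc_ge0 // ltW.
by rewrite ler_pdivrMr // mul1r.
Qed.

(** Orthogonality of the powers of [zeta]: exponents below [N] are told apart. *)
Lemma lagrange_expr n w : (n < N)%N -> \sum_(k < N) node k ^+ n * lagrange k w = w ^+ n.
Proof.
move=> nN.
have -> : \sum_(k < N) node k ^+ n * lagrange k w =
    \sum_(m < N) N%:R^-1 * (rho%:C ^+ n * (w / rho%:C) ^+ m) *
       \sum_(k < N) (zeta ^+ n / zeta ^+ m) ^+ k.
  rewrite /lagrange; under eq_bigr do rewrite mulrCA mulr_sumr mulr_sumr.
  rewrite exchange_big /=; apply: eq_bigr => m _; rewrite mulr_sumr; apply: eq_bigr => k _.
  rewrite -mulrA; congr (_ * _).
  rewrite /node !exprMn !exprVn !exprMn ![zeta ^+ k ^+ _]exprAC.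
  have : zeta ^+ m ^+ k != 0 by rewrite !expf_neq0 // zeta_neq0.
  have : rho%:C ^+ m != 0 :> C by rewrite expf_neq0 // rhoC_neq0.
  move: (zeta ^+ m ^+ k) (zeta ^+ n ^+ k) (rho%:C ^+ m) (rho%:C ^+ n) (w ^+ m) => a b c d e *.
  by field; apply/andP.
rewrite (bigD1 (Ordinal nN)) //= [X in _ + X]big1 ?addr0 => [|m mn].
  rewrite divff ?expf_neq0 ?zeta_neq0 //; under eq_bigr do rewrite expr1n.
  rewrite sumr_const card_ord exprMn exprVn.
  have : rho%:C ^+ n != 0 :> C by rewrite expf_neq0 // rhoC_neq0.
  have : (N%:R : C) != 0 by rewrite pnatr_eq0 -lt0n.
  move: (rho%:C ^+ n) (w ^+ n) (N%:R : C) => a b c *.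
  by field; apply/andP.
rewrite sum_root_of_unity ?mulr0 //.
  rewrite exprMn exprVn -!exprM ![(_ * N)%N]mulnC !exprM (prim_expr_order zetaP).
  by rewrite !expr1n divr1.
apply: contra mn => /eqP zz; rewrite -val_eqE /=.
have /eqP : zeta ^+ n = zeta ^+ m.
  by rewrite -[LHS](mulfVK (_ : zeta ^+ m != 0)) ?expf_neq0 ?zeta_neq0 // zz mul1r.
by rewrite (eq_prim_root_expr zetaP) !modn_small // eq_sym.
Qed.

(** [N + 1] times the Taylor error at radius [rho]: once at the point and once per node, since
    interpolation reproduces the Taylor polynomial. *)
Definition interp_err (r : R) : R := 4 * (N.+1)%:R * (rho / r) ^+ N / (r - rho).

Lemma interpolation_error (f : C -> C) M r w : rho < r < 1 ->
  (forall z : C, 0 < normc z < 1 -> differentiable (f : C^o -> C^o) (z : C^o)) ->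
  (forall z, 0 < normc z < 1 -> normc (f z) <= M) ->
  0 < normc w <= rho ->
  normc (f w - \sum_(k < N) f (node k) * lagrange k w) <= M * interp_err r.
Proof.
move=> /andP[rr r1] fd fM wr.
have r01 : 0 < r < 1 by rewrite r1 (lt_trans rho_gt0 rr).
have [p pP] := taylor_approx fd fM r01.
pose t w := \sum_(n < N) p n * w ^+ n.
pose d := 4 * M * (rho / r) ^+ N / (r - rho).
have M0 : 0 <= M.
  apply: le_trans (normc_ge0 (f w)) (fM _ _).
  by case/andP: wr => -> /le_lt_trans; apply; apply: lt_trans r1.
have r0 : 0 < r by case/andP: r01.
have tP u : 0 < normc u <= rho -> normc (f u - t u) <= d.
  move=> /andP[u0 ur]; apply: le_trans (pP _ _ N_gt0 _) _.
    by rewrite u0 (le_lt_trans ur).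
  have u1 : 0 < r - normc u by rewrite subr_gt0 (le_lt_trans ur).
  have rr0 : 0 < r - rho by rewrite subr_gt0.
  have q0 : 0 <= normc u / r by rewrite divr_ge0 ?normc_ge0 // ltW.
  rewrite /d ler_pM ?mulr_ge0 ?exprn_ge0 ?invr_ge0 ?(ltW u1) //.
    rewrite ler_wpM2l ?mulr_ge0 // lerXn2r ?nnegrE ?divr_ge0 ?normc_ge0 ?(ltW rho_gt0) ?(ltW r0) //.
    by rewrite ler_pM2r ?invr_gt0.
  by rewrite lef_pV2 ?posrE // lerD2l lerN2.
have tE : t w = \sum_(k < N) t (node k) * lagrange k w.
  rewrite /t; under [RHS]eq_bigr do rewrite mulr_suml.
  rewrite exchange_big /=; apply: eq_bigr => n _.
  rewrite -(lagrange_expr w (ltn_ord n)) mulr_sumr; apply: eq_bigr => k _.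
  by rewrite mulrA.
have -> : f w - \sum_(k < N) f (node k) * lagrange k w =
    (f w - t w) - \sum_(k < N) (f (node k) - t (node k)) * lagrange k w.
  under [X in _ = _ - X]eq_bigr do rewrite mulrBl.
  by rewrite sumrB -tE; ring.
apply: le_trans (le_normcD _ _) _; rewrite normcN.
have -> : M * interp_err r = d + N%:R * d by rewrite /interp_err /d -[N.+1%:R]natr1; ring.
rewrite lerD ?tP //; apply: le_trans (normc_sum _ _) _.
apply: (@le_trans _ _ (\sum_(k < N) d)); last by rewrite sumr_const card_ord mulr_natl.
apply: ler_sum => k _; rewrite normcM -[leRHS]mulr1.
rewrite ler_pM ?normc_ge0 ?tP ?normc_node ?rho_gt0 ?lexx // lagrange_le1 //.
by case/andP: wr.
Qed.

Lemma lagrange_differentiable k (w : C) : differentiable (lagrange k : C^o -> C^o) (w : C^o).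
Proof.
apply: differentiableM; first exact: differentiable_cst.
apply: differentiable_bigsum => n; apply: differentiable_expr.
by apply: differentiableM; [exact: differentiable_id | exact: differentiable_cst].
Qed.

(** The Taylor estimate omits the centre; continuity of the error term at 0 recovers it. *)
Lemma interpolation_error0 (f : C -> C) M r w : rho < r < 1 ->
  (forall z : C, normc z < 1 -> differentiable (f : C^o -> C^o) (z : C^o)) ->
  (forall z, normc z < 1 -> normc (f z) <= M) ->
  normc w <= rho ->
  normc (f w - \sum_(k < N) f (node k) * lagrange k w) <= M * interp_err r.
Proof.
move=> rr fd fM wr.
have err u : 0 < normc u <= rho ->
    normc (f u - \sum_(k < N) f (node k) * lagrange k u) <= M * interp_err r.
  by apply: interpolation_error => // z /andP[_ ?]; [exact: fd | exact: fM].
have [->|w0] := eqVneq w 0; last by apply: err; rewrite normc_gt0.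
pose phi u := f u - \sum_(k < N) f (node k) * lagrange k u.
have phid : ceps phi 0.
  apply/cdiff_ceps/cdiff_differentiable; apply: differentiableB.
    by apply: fd; rewrite normc0.
  apply: differentiable_bigsum => k; apply: differentiableM.
    exact: differentiable_cst.
  exact: lagrange_differentiable.
apply/ler_addgt0Pr => e e0; have [d d0 dP] := phid _ e0.
pose h : R := Num.min (d / 2) rho.
have h0 : 0 < h by rewrite lt_min rho_gt0 divr_gt0.
have hE : normc h%:C = h by rewrite normcC ger0_norm // ltW.
have hd : normc h%:C < d.
  by rewrite hE gt_min; apply/orP; left; rewrite ltr_pdivrMr // ltr_pMr // ltr1n.
have := dP _ hd; rewrite add0r normcB => H.
rewrite -/(phi 0) -[phi 0](subrK (phi h%:C)) addrC.
apply: le_trans (le_normcD _ _) _; rewrite lerD //.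
by apply: err; rewrite hE h0 ge_min lexx orbT.
Qed.

(** One variable at a time: one error in the first variable, then one in the second for each of the
    [N] nodes. Only the second variable has to avoid 0. *)
Theorem interpolation2_error (g : C -> C -> C) r w1 w2 : rho < r < 1 ->
  (forall u z : C, 0 < normc u < 1 -> normc z < 1 ->
     differentiable ((fun z => g z u) : C^o -> C^o) (z : C^o)) ->
  (forall u z : C, normc u < 1 -> 0 < normc z < 1 ->
     differentiable (g u : C^o -> C^o) (z : C^o)) ->
  (forall u v, normc u < 1 -> 0 < normc v < 1 -> normc (g u v) <= 1) ->
  normc w1 <= rho -> 0 < normc w2 <= rho ->
  normc (g w1 w2 - \sum_(k < N) \sum_(l < N) g (node k) (node l) * (lagrange k w1 * lagrange l w2))
    <= N.+1%:R * interp_err r.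
Proof.
move=> rr gd1 gd2 g1 w1r w2r; have /andP[rr' r1] := rr.
have w21 : 0 < normc w2 < 1.
  by case/andP: w2r => -> /le_lt_trans; apply; apply: lt_trans r1.
have rho1 : rho < 1 by apply: lt_trans r1.
have nodelt k : normc (node k) < 1 by rewrite normc_node.
have -> : g w1 w2 - \sum_(k < N) \sum_(l < N) g (node k) (node l) * (lagrange k w1 * lagrange l w2) =
   (g w1 w2 - \sum_(k < N) g (node k) w2 * lagrange k w1) +
   \sum_(k < N) (g (node k) w2 - \sum_(l < N) g (node k) (node l) * lagrange l w2) * lagrange k w1.
  under [X in _ = _ + X]eq_bigr do rewrite mulrBl.
  rewrite sumrB addrA subrK; congr (_ - _); apply: eq_bigr => k _.
  by rewrite mulr_suml; apply: eq_bigr => l _; ring.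
have E1 : normc (g w1 w2 - \sum_(k < N) g (node k) w2 * lagrange k w1) <= 1 * interp_err r.
  apply: (@interpolation_error0 (fun z => g z w2)) => // z z1; first exact: gd1.
  exact: g1.
have E2 (k : 'I_N) : normc (g (node k) w2 - \sum_(l < N) g (node k) (node l) * lagrange l w2) <=
    1 * interp_err r.
  apply: (@interpolation_error (g (node k))) => // z z1; first exact: gd2.
  exact: g1.
rewrite mul1r in E1.
apply: le_trans (le_normcD _ _) _; rewrite -natr1 mulrDl mul1r addrC lerD //.
apply: le_trans (normc_sum _ _) _.
apply: (@le_trans _ _ (\sum_(k < N) interp_err r)); last by rewrite sumr_const card_ord mulr_natl.
apply: ler_sum => k _; rewrite normcM -[leRHS]mulr1 ler_pM ?normc_ge0 //.
  by rewrite -[leRHS]mul1r.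
exact: lagrange_le1.
Qed.

End Interpolation.

Lemma interp_err_small rho r e : 0 < rho < r -> 0 < e ->
  exists2 N, (0 < N)%N & N.+1%:R * interp_err N rho r <= e.
Proof.
move=> /andP[rho0 rr] e0.
have r0 : 0 < r by apply: lt_trans rr.
pose q := rho / r; have q0 : 0 < q by rewrite divr_gt0.
have q1 : q < 1 by rewrite ltr_pdivrMr // mul1r.
(* With [s^4 = q], two factors [s^N] absorb the [(N + 1)^2] through [(N + 1) s^N <= 1 / (1 - s)],
   and the remaining ones tend to 0. *)
pose s := Num.sqrt (Num.sqrt q).
have s0 : 0 < s by rewrite !sqrtr_gt0.
have s1 : s < 1 by rewrite -sqrtr1 ltr_sqrt // -sqrtr1 ltr_sqrt.
have sE : s ^+ 4 = q.
  by rewrite -[4%N]/(2 * 2)%N exprM !sqr_sqrtr ?sqrtr_ge0 // ltW.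
have Ns N : N.+1%:R * s ^+ N <= (1 - s)^-1.
  rewrite -[leRHS]mul1r ler_pdivlMr ?subr_gt0 //.
  apply: (@le_trans _ _ ((\sum_(n < N.+1) s ^+ n) * (1 - s))).
    rewrite ler_pM2r ?subr_gt0 //.
    apply: (@le_trans _ _ (\sum_(n < N.+1) s ^+ N)); first by rewrite sumr_const card_ord mulr_natl.
    apply: ler_sum => n _; apply: ler_wiXn2l; [exact: ltW | exact: ltW | by rewrite -ltnS].
  have -> : (\sum_(n < N.+1) s ^+ n) * (1 - s) = 1 - s ^+ N.+1.
    by have := subrX1 s N.+1; rewrite mulrC => H; rewrite -[RHS]opprB H; ring.
  by rewrite gerBl exprn_ge0 // ltW.
have rr0 : 0 < r - rho by rewrite subr_gt0.
have s10 : 0 < 1 - s by rewrite subr_gt0.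
pose K := 4 * (1 - s)^-1 ^+ 2 / (r - rho).
have K0 : 0 < K by rewrite divr_gt0 // mulr_gt0 // exprn_gt0 // invr_gt0.
have ss1 : `|s| < 1 by rewrite ger0_norm // ltW.
have := cvg_expr ss1 => /cvgrPdist_lt /(_ _ (divr_gt0 e0 K0)) [m _ /(_ m.+1 (leqnSn m))].
rewrite sub0r normrN normrX ger0_norm ?(ltW s0) // => mP.
exists m.+1 => //; rewrite /interp_err -/q -sE.
have -> : m.+2%:R * (4 * m.+2%:R * (s ^+ 4) ^+ m.+1 / (r - rho)) =
   4 * (m.+2%:R * s ^+ m.+1) ^+ 2 / (r - rho) * (s ^+ m.+1 * s ^+ m.+1).
  by rewrite -!exprM [(4 * _)%N]mulnC !exprM; ring.
apply: (@le_trans _ _ (K * (s ^+ m.+1 * 1))).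
  have sm0 : 0 <= s ^+ m.+1 by rewrite exprn_ge0 // ltW.
  have sm1 : s ^+ m.+1 <= 1 by rewrite exprn_ile1 // ltW.
  have XK : 4 * (m.+2%:R * s ^+ m.+1) ^+ 2 / (r - rho) <= K.
    rewrite /K ler_pM2r ?invr_gt0 // ler_pM2l // lerXn2r ?Ns // nnegrE; first exact: mulr_ge0.
    by rewrite invr_ge0 ltW.
  apply: ler_pM XK _; last by rewrite ler_wpM2l.
    by rewrite divr_ge0 ?(ltW rr0) // mulr_ge0 // exprn_ge0 // mulr_ge0.
  exact: mulr_ge0.
by rewrite mulr1 mulrC -ler_pdivlMr // ltW.
Qed.

End RootsOfUnity.

(** * Polynomials bounded by 1 on the torus that approximate [psi] at the points *)

Section Approximation.
Variables (R : realType) (k : nat).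
Notation C := R[i].
Import Normc.
Variables (psi : C * C -> C) (lambda : 'I_k -> C * C).
Hypothesis psi_hol : holomorphic_on (@hartogs_triangle R) psi.
Hypothesis psi_le1 : forall x, hartogs_triangle x -> `|psi x| <= 1.
Hypothesis lambda_triangle : forall j, hartogs_triangle (lambda j).

Lemma hartogs_product (u v : C) : normc u < 1 -> 0 < normc v < 1 -> hartogs_triangle (u * v, v).
Proof.
move=> u1 /andP[v0 v1]; rewrite /hartogs_triangle /= !norm_normc !ltcR normcM; split=> //.
by rewrite gtr_pMl.
Qed.

(** Scaling both bidisc coordinates by [1 - t] scales the first coordinate of the triangle, their
    product, by [(1 - t)^2]. *)
Lemma dilation_continuous j (e : R) : 0 < e -> exists2 d, 0 < d &
  forall t, 0 < t < d -> t < 1 ->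
    normc (psi (((1 - t) ^+ 2)%:C * (lambda j).1, (1 - t)%:C * (lambda j).2) - psi (lambda j)) <= e.
Proof.
move=> e0; have [l12 l21] := lambda_triangle j.
have /differentiable_continuous/cvgrPdist_le := psi_hol (lambda_triangle j).
have e0' : 0 < e%:C :> C by rewrite ltcR.
move=> /(_ _ e0') /nbhs_ballP [d /= d0 dP].
have dE : d = (complex.Re d)%:C by rewrite RRe_real // gtr0_real.
exists (complex.Re d / 2) => [|t /andP[t0 td] t1]; first by rewrite divr_gt0 // -ltcR -dE.
have l2' : normc (lambda j).2 < 1 by rewrite -ltcR.
have l1' : normc (lambda j).1 < 1.
  by rewrite -ltcR; apply: lt_trans l21.
have t2d : 2 * t < complex.Re d by move: td; rewrite ltr_pdivlMr // mulrC.
rewrite normcB -lecR; apply: dP; split => /=; rewrite /ball /= dE norm_normc ltcR.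
  have -> : (lambda j).1 - ((1 - t) ^+ 2)%:C * (lambda j).1 = (1 - (1 - t) ^+ 2)%:C * (lambda j).1.
    by rewrite rmorphB mulrBl mul1r.
  rewrite normcM normcC; apply: le_lt_trans t2d.
  have -> : 1 - (1 - t) ^+ 2 = t * (2 - t) by ring.
  rewrite ger0_norm; last by rewrite mulr_ge0 ?(ltW t0) //; lra.
  apply: (@le_trans _ _ (t * (2 - t))).
    by rewrite ler_piMr ?(ltW l1') // mulr_ge0 ?(ltW t0) //; lra.
  by rewrite mulrC ler_pM2r //; lra.
have -> : (lambda j).2 - (1 - t)%:C * (lambda j).2 = t%:C * (lambda j).2.
  by rewrite rmorphB /=; ring.
rewrite normcM normcC ger0_norm ?(ltW t0) //; apply: le_lt_trans t2d.
apply: (@le_trans _ _ t); first by rewrite ler_piMr ?(ltW l2') // ltW.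
by lra.
Qed.

Lemma dilation_uniform (e : R) : 0 < e -> exists2 rho : R, 0 < rho < 1 &
  forall j, normc (psi ((rho ^+ 2)%:C * (lambda j).1, rho%:C * (lambda j).2) - psi (lambda j)) <= e.
Proof.
move=> e0; have /fin_all_exists [d dP] : forall j, exists d, 0 < d /\ forall t, 0 < t < d -> t < 1 ->
    normc (psi (((1 - t) ^+ 2)%:C * (lambda j).1, (1 - t)%:C * (lambda j).2) - psi (lambda j)) <= e.
  by move=> j; have [d d0 dP] := dilation_continuous j e0; exists d.
(* Smaller than every [d j], and smaller than 1 even when there are no points. *)
pose t := (2 + \sum_j (d j)^-1)^-1.
have s0 : 0 <= \sum_j (d j)^-1 by apply: sumr_ge0 => j _; rewrite invr_ge0 ltW //; have [] := dP j.
have t20 : 0 < 2 + \sum_j (d j)^-1 by rewrite ltr_pwDl.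
have t0 : 0 < t by rewrite invr_gt0.
have t1 : t < 1 by rewrite /t invf_lt1 //; lra.
exists (1 - t) => [|j]; first by apply/andP; split; lra.
have [dj0 ->] // := dP j; rewrite t0 /= /t -[d j]invrK ltf_pV2 ?posrE ?invr_gt0 //.
rewrite (bigD1 j) //= addrCA ltrDl ltr_pwDl // sumr_ge0 // => i _.
by rewrite invr_ge0 ltW //; have [] := dP i.
Qed.

(** Three errors of at most [e / 3]: dilating [psi], interpolating it, and dividing the interpolant
    by its bound [1 + eta] on the torus. *)
Theorem polynomial_approximation (e : C) : 0 < e -> exists c d,
     (forall x y : C, `|x| = 1 -> `|y| = 1 -> `|bieval c d x y| <= 1) /\
     forall j, `|bieval c d ((lambda j).1 / (lambda j).2) (lambda j).2 - psi (lambda j)| <= e.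
Proof.
move=> e0; have eE : e = (complex.Re e)%:C by rewrite RRe_real // gtr0_real.
pose e3 := complex.Re e / 3.
have e30 : 0 < e3 by rewrite divr_gt0 // -ltcR -eE.
have [rho /andP[rho0 rho1] rhoP] := dilation_uniform e30.
pose r := (1 + rho) / 2.
have rr : rho < r < 1 by rewrite /r; apply/andP; split; lra.
have rho_r : 0 < rho < r by rewrite rho0; case/andP: rr.
have [N N0 etaP] := interp_err_small rho_r e30.
pose eta := N.+1%:R * interp_err N rho r.
have [zeta zetaP] := primitive_root_exists R N0.
pose g (u v : C) := psi (u * v, v).
pose G a b := g (node zeta rho a) (node zeta rho b).
pose P u v : C := \sum_(a < N) \sum_(b < N) G a b *
   (lagrange N zeta rho a (rho%:C * u) * lagrange N zeta rho b (rho%:C * v)).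
have P_err u v : normc u <= 1 -> 0 < normc v <= 1 ->
    normc (g (rho%:C * u) (rho%:C * v) - P u v) <= eta.
  move=> u1 /andP[v0 v1].
  have nrho x : normc (rho%:C * x) = rho * normc x by rewrite normcM normcC ger0_norm // ltW.
  apply: (interpolation2_error N0 zetaP rho0 rr).
  - move=> w z /= w1 z1; apply: (@differentiable_comp _ C^o (C^o * C^o)%type C^o
      (fun z : C^o => (z * w : C^o, w : C^o)) psi).
      apply: differentiable_pair; last exact: differentiable_cst.
      by apply: differentiableM; [exact: differentiable_id | exact: differentiable_cst].
    exact/psi_hol/hartogs_product.
  - move=> w z /= w1 z1; apply: (@differentiable_comp _ C^o (C^o * C^o)%type C^o
      (fun z : C^o => (w * z : C^o, z : C^o)) psi).
      apply: differentiable_pair; last exact: differentiable_id.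
      by apply: differentiableM; [exact: differentiable_cst | exact: differentiable_id].
    exact/psi_hol/hartogs_product.
  - by move=> w z w1 z1; rewrite -lecR; apply/psi_le1/hartogs_product.
  - by rewrite nrho ler_piMr // ltW.
  - by rewrite nrho mulr_gt0 //= ler_piMr // ltW.
have eta0 : 0 <= eta.
  by apply: le_trans (normc_ge0 _) (P_err 0 1 _ _); rewrite ?normc0 ?normc1 ?ltr01 ?ler01 ?lexx.
have g_le1 u v : normc u <= 1 -> 0 < normc v <= 1 -> normc (g (rho%:C * u) (rho%:C * v)) <= 1.
  move=> u1 /andP[v0 v1]; rewrite -lecR; apply/psi_le1/hartogs_product.
    by rewrite normcM normcC ger0_norm ?(ltW rho0) //; apply: le_lt_trans rho1; rewrite ler_piMr // ltW.
  rewrite normcM normcC ger0_norm ?(ltW rho0) // mulr_gt0 //=.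
  by apply: le_lt_trans rho1; rewrite ler_piMr // ltW.
have P_le u v : normc u <= 1 -> 0 < normc v <= 1 -> normc (P u v) <= 1 + eta.
  move=> u1 v1; have := P_err u v u1 v1; rewrite normcB => H.
  rewrite -[P u v](subrK (g (rho%:C * u) (rho%:C * v))) addrC.
  by apply: le_trans (le_normcD _ _) _; rewrite lerD // g_le1.
have eta1 : 0 < 1 + eta by rewrite ltr_pwDl.
pose c a b : C := (1 + eta)%:C^-1 * (N%:R^-1 * N%:R^-1) *
  \sum_(i < N) \sum_(j < N) G i j * ((zeta ^+ i)^-1 ^+ a * (zeta ^+ j)^-1 ^+ b).
have lagE a u : lagrange N zeta rho a (rho%:C * u) = N%:R^-1 * \sum_(n < N) (zeta ^+ a)^-1 ^+ n * u ^+ n.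
  rewrite /lagrange; congr (_ * _); apply: eq_bigr => n _; rewrite -exprMn /node; congr (_ ^+ _).
  by field; rewrite expf_neq0 ?(zeta_neq0 N0 zetaP) // rhoC_neq0.
have cE u v : bieval c N u v = (1 + eta)%:C^-1 * P u v.
  rewrite /bieval /P.
  transitivity (\sum_(a < N) \sum_(b < N) \sum_(i < N) \sum_(j < N)
     (1 + eta)%:C^-1 * (N%:R^-1 * N%:R^-1) * (G i j * ((zeta ^+ i)^-1 ^+ a * u ^+ a * ((zeta ^+ j)^-1 ^+ b * v ^+ b)))).
    apply: eq_bigr => a _; apply: eq_bigr => b _; rewrite /c mulr_sumr mulr_suml.
    apply: eq_bigr => i _; rewrite mulr_sumr mulr_suml; apply: eq_bigr => j _; ring.
  under eq_bigr do rewrite exchange_big.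
  rewrite exchange_big mulr_sumr; apply: eq_bigr => i _ /=.
  under eq_bigr do rewrite exchange_big.
  rewrite exchange_big mulr_sumr; apply: eq_bigr => j _ /=.
  rewrite !lagE.
  have assoc (x y n a b : C) : x * (y * ((n * a) * (n * b))) = x * (n * n) * y * (a * b) by ring.
  rewrite assoc.
  rewrite mulr_suml mulr_sumr; apply: eq_bigr => a _.
  by rewrite !mulr_sumr; apply: eq_bigr => b _; ring.
exists c, N; split=> [x y x1 y1|j].
  have x1' : normc x = 1 by apply: (@complexI R); rewrite -norm_normc x1.
  have y1' : normc y = 1 by apply: (@complexI R); rewrite -norm_normc y1.
  rewrite cE norm_normc -[X in _ <= X]/(1%:C) lecR normcM normcV normcC ger0_norm ?(ltW eta1) //.
  by rewrite mulrC ler_pdivrMr // mul1r P_le ?x1' ?y1' ?ltr01 /=.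
have [l12 l21] := lambda_triangle j.
set u := (lambda j).1 / (lambda j).2; set v := (lambda j).2.
have v0 : 0 < normc v.
  by rewrite -ltcR; apply: le_lt_trans l12.
have v1 : normc v < 1 by rewrite -ltcR.
have u1 : normc u < 1.
  by rewrite /u normcM normcV ltr_pdivrMr // mul1r -ltcR.
have gE : g (rho%:C * u) (rho%:C * v) = psi ((rho ^+ 2)%:C * (lambda j).1, rho%:C * (lambda j).2).
  rewrite /g; congr (psi (_, _)); rewrite /u /v rmorphXn /=; field.
  by apply: normc_neq0.
have vv : 0 < normc v <= 1 by rewrite v0 ltW.
have H1 := rhoP j; rewrite -gE in H1.
have H2 := P_err u v (ltW u1) vv.
have H3 := P_le u v (ltW u1) vv.
rewrite cE eE norm_normc lecR.
have -> : (1 + eta)%:C^-1 * P u v - psi (lambda j) =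
   ((1 + eta)%:C^-1 * P u v - P u v) + ((P u v - g (rho%:C * u) (rho%:C * v)) +
     (g (rho%:C * u) (rho%:C * v) - psi (lambda j))) by ring.
have H4 : normc ((1 + eta)%:C^-1 * P u v - P u v) <= eta.
  have -> : (1 + eta)%:C^-1 * P u v - P u v = - ((eta / (1 + eta))%:C * P u v).
    rewrite rmorphM fmorphV /=.
    have -> : eta%:C = (1 + eta)%:C - 1 :> C by rewrite rmorphD /=; ring.
    have : (1 + eta)%:C != 0 :> C by rewrite -[0]/(0%:C) (inj_eq (@complexI R)) gt_eqF.
    by move: (1 + eta)%:C => E E0; field.
  rewrite normcN normcM normcC ger0_norm; last by rewrite divr_ge0 // ltW.
  apply: (@le_trans _ _ (eta / (1 + eta) * (1 + eta))).
    by rewrite ler_wpM2l // divr_ge0 // ltW.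
  by rewrite divfK // gt_eqF.
have -> : complex.Re e = e3 + (e3 + e3) by rewrite /e3; field.
apply: le_trans (le_normcD _ _) _; rewrite lerD ?(le_trans H4) //.
apply: le_trans (le_normcD _ _) _; rewrite lerD //.
by rewrite normcB (le_trans H2).
Qed.

End Approximation.

Theorem proposition9p1 (R : realType) (k : nat)
    (lambda : 'I_k -> R[i] * R[i]) (z : 'I_k -> R[i])
    (lambda_inj : injective lambda)
    (lambda_triangle : forall j, hartogs_triangle (lambda j)) :
  (exists psi : R[i] * R[i] -> R[i],
     [/\ Hinfty (@hartogs_triangle R) psi,
         sup_norm (@hartogs_triangle R) psi <= 1
       & forall j, psi (lambda j) = z j])
  <->
  (exists A1 A2 : 'M[R[i]]_k,
     [/\ psdmx A1, psdmx A2
       & forall i j,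
           1 - (z i)^* * z j =
             ((lambda i).2^* * (lambda j).2
                - (lambda i).1^* * (lambda j).1) * A1 i j
             + (1 - (lambda i).2^* * (lambda j).2) * A2 i j]).
Proof.
(* A point of the triangle makes the filter of [ex_bound] proper and the set under [sup]
   nonempty. *)
have point : hartogs_triangle (0 : R[i], 2^-1 : R[i]).
  have half0 : (0 : R[i]) < 2^-1 by rewrite invr_gt0.
  by rewrite /hartogs_triangle /= normr0 gtr0_norm // half0 invf_lt1 // ltr1n.
have pf := globally_properfilter point.
split=> [[psi [[psi_hol psi_bnd] psi_sup psi_z]]|/(pick_sufficient lambda_triangle)].
- apply: (pick_necessary lambda_triangle) => e e0.
  have psi_le1 x : hartogs_triangle x -> `|psi x| <= 1.
    (* Boundedness makes [sup] a genuine upper bound, so the norm condition gives a pointwise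
       one. *)
    have /ex_bound [M /= MP] := psi_bnd.
    move=> xT; rewrite norm_normc -[X in _ <= X]/(1%:C) lecR; apply: le_trans psi_sup.
    apply: ub_le_sup; last by exists x.
    exists (complex.Re M) => _ [y yT <-].
    by have := MP y yT; rewrite lecE => /andP[].
  have [c [d [c1 cd]]] := polynomial_approximation psi_hol psi_le1 lambda_triangle e0.
  by exists c, d; split=> // j; rewrite -psi_z.
- move=> [psi [psi_hol psi_le1 psi_z]]; exists psi; split=> //.
  + split=> //; apply/ex_bound; exists 1 => x /= xT; exact: psi_le1.
  + apply: ge_sup; first by exists (complex.Re `|psi (0, 2^-1)|); exists (0, 2^-1).
    move=> _ [y yT <-].
    by have := psi_le1 y yT; rewrite lecE => /andP[].
Qed.
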